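(* Let $K$ be an algebraically closed field of characteristic $p=0$, and let $X\subset\mathbb{P}^{n+1}$ be a hypersurface of dimension $n\ge1$ and degree $d\ge 4$ with $s=s(X)\le n-2$. Assume that $\Delta'(X)$ is finite. (1) If $s=-1$, then $\sharp\Delta'(X)\le n+2$. Furthermore, equality holds if and only if $X$ is projectively equivalent to the Fermat hypersurface $X_0^d+\dots+X_{n+1}^d=0$. (2) If $s\ge 0$, then $\sharp\Delta'(X)\le n-s$. Furthermore, equality holds if and only if $X$ is projectively equivalent to the hypersurface defined by $$X_0^d+\dots+X_{n-s-1}^d+G=0,$$ where $G\in K[X_{n-s},\ldots,X_{n+1}]$ has a multiple component.
   Context: A hypersurface $X\subset\mathbb{P}^{n+1}$ is irreducible and reduced; $X_0,\ldots,X_{n+1}$ are homogeneous coordinates. $s(X):=\dim\mathrm{Sing}(X)$, with $\dim\emptyset=-1$. A point $P\in X_{\rm sm}\cup(\mathbb{P}^{n+1}\setminus X)$ ($X_{\rm sm}$ the smooth locus) is a Galois point for $X$ if the function field extension $K(X)/K(\mathbb{P}^n)$ induced by the projection $\pi_P:X\dashrightarrow\mathbb{P}^n$ from $P$ is Galois. $\Delta'(X)$ is the set of all Galois points contained in $\mathbb{P}^{n+1}\setminus X$. Projectively equivalent means related by a projective transformation of $\mathbb{P}^{n+1}$. $G$ is homogeneous of degree $d$; it has a multiple component if it is divisible by the square of a nonconstant polynomial. *)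

(* Defs.v *)
From HB Require Import structures.
From mathcomp Require Import all_boot all_order all_algebra all_field.
From mathcomp Require Import boolp classical_sets functions cardinality.
From mathcomp Require Import mpoly.

Set Implicit Arguments.
Unset Strict Implicit.
Unset Printing Implicit Defensive.

Import Order.TTheory GRing.Theory Num.Theory.
Local Open Scope classical_set_scope.
Local Open Scope ring_scope.

(* A point of P^N is a line through the origin of K^(N+1). *)
Record pspace (K : fieldType) (N : nat) := PPoint {
  pline :> {vspace 'rV[K]_N.+1};
  pline_dim : \dim pline == 1%N }.

HB.instance Definition _ K N := [isSub for @pline K N].
HB.instance Definition _ K N := [Choice of pspace K N by <:].

Lemma ptrans_subproof (K : fieldType) (N : nat) (M : 'M[K]_N.+1)
    (P : pspace K N) :
  M \in unitmx -> \dim (linfun (mulmxr M) @: P)%VS == 1%N.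
Proof.
move=> uM; rewrite limg_dim_eq ?pline_dim //.
apply/eqP; rewrite -subv0; apply/subvP => v.
rewrite memv_cap memv_ker => /andP[_ /eqP].
by rewrite lfunE /= memv0 => /(canRL (mulmxK uM)); rewrite mul0mx => ->.
Qed.

(* The projective transformation [v] |-> [v M], M invertible. *)
Definition ptrans (K : fieldType) (N : nat) (M : 'M[K]_N.+1)
    (uM : M \in unitmx) (P : pspace K N) : pspace K N :=
  PPoint (ptrans_subproof P uM).

Definition proj_equiv (K : fieldType) (N : nat) (Y Z : set (pspace K N)) :=
  exists (M : 'M[K]_N.+1) (uM : M \in unitmx), ptrans uM @` Y = Z.

Definition vanishes_at (K : fieldType) (N : nat) (F : {mpoly K[N.+1]})
    (P : pspace K N) : Prop :=
  forall v : 'rV[K]_N.+1, v \in pline P -> F.@[fun i => v 0 i] = 0.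

Definition zero_locus (K : fieldType) (N : nat) (F : {mpoly K[N.+1]}) :
    set (pspace K N) := [set P | vanishes_at F P].

Definition zariski_closed (K : fieldType) (N : nat) (Z : set (pspace K N)) :=
  exists I : set {mpoly K[N.+1]},
    (forall F, I F -> exists k, F \is k.-homog) /\
    Z = \bigcap_(F in I) zero_locus F.

Definition irreducible_closed (K : fieldType) (N : nat)
    (Z : set (pspace K N)) :=
  [/\ zariski_closed Z, Z !=set0 &
    forall Z1 Z2, zariski_closed Z1 -> zariski_closed Z2 ->
      Z = Z1 `|` Z2 -> Z = Z1 \/ Z = Z2].

(* A strictly increasing chain C 0 < ... < C (m - 1) of m irreducible closed
   subsets of Z; its length, as counted in the Krull dimension, is m - 1. *)
Definition has_chain (K : fieldType) (N : nat) (Z : set (pspace K N))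
    (m : nat) :=
  exists C : nat -> set (pspace K N),
    (forall i, (i < m)%N -> irreducible_closed (C i) /\ C i `<=` Z) /\
    (forall i, (i.+1 < m)%N -> C i `<` C i.+1).

(* Z has Krull dimension s; as there is always a chain of 0 subsets, the empty
   set has dimension -1. *)
Definition has_dim (K : fieldType) (N : nat) (Z : set (pspace K N))
    (s : int) : Prop :=
  forall m : nat, has_chain Z m <-> m%:Z <= s + 1.

Definition mp_dvd (K : fieldType) (m : nat) (F G : {mpoly K[m]}) : Prop :=
  exists Q, G = Q * F.

(* An irreducible and reduced hypersurface of P^(n+1): the homogeneous ideal
   (F) is a nonzero prime ideal. *)
Record hypersurface (K : fieldType) (n d : nat) := Hypersurface {
  heq : {mpoly K[n.+2]};
  heq_neq0 : heq != 0;
  heq_homog : heq \is d.-homog;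
  heq_proper : ~ mp_dvd heq 1;
  heq_prime : forall A B, mp_dvd heq (A * B) -> mp_dvd heq A \/ mp_dvd heq B }.

Definition hpoints (K : fieldType) (n d : nat) (X : hypersurface K n d) :
  set (pspace K n.+1) := zero_locus (heq X).

(* Jacobian criterion: heq X generates the full ideal of X. *)
Definition hsing (K : fieldType) (n d : nat) (X : hypersurface K n d) :
    set (pspace K n.+1) :=
  [set P | hpoints X P /\ forall i, vanishes_at (heq X)^`M(i) P].

Definition hsmooth (K : fieldType) (n d : nat) (X : hypersurface K n d) :
  set (pspace K n.+1) := hpoints X `\` hsing X.

Section CoordinateRing.
Variables (K : fieldType) (n d : nat) (X : hypersurface K n d).

Definition hideal : {pred {mpoly K[n.+2]}} := fun G => `[< mp_dvd (heq X) G >].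

Lemma hideal_closed : idealr_closed hideal.
Proof.
split.
- by apply/asboolP; exists 0; rewrite mul0r.
- by apply/asboolPn; exact: heq_proper.
- move=> A U V /asboolP[Q ->] /asboolP[Q' ->]; apply/asboolP.
  by exists (A * Q + Q'); rewrite mulrDl mulrA.
Qed.

Lemma hideal_prime : prime_idealr_closed hideal.
Proof.
move=> A B /asboolP /heq_prime[] h; apply/orP; [left|right]; exact/asboolP.
Qed.

HB.instance Definition _ := isIdealr.Build {mpoly K[n.+2]} hideal hideal_closed.
HB.instance Definition _ :=
  isPrimeIdealrClosed.Build {mpoly K[n.+2]} hideal hideal_prime.

Definition coord_ring : Type := {ideal_quot hideal}.
HB.instance Definition _ := GRing.ComNzRing.on coord_ring.

Definition coord_unit : pred coord_ring :=
  fun x => `[< exists y, y * x = 1 >].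
Definition coord_inv (x : coord_ring) : coord_ring :=
  if pselect (exists y, y * x = 1) is left h then projT1 (cid h) else x.

Lemma coord_mulVx : {in coord_unit, left_inverse 1 coord_inv *%R}.
Proof.
move=> x /asboolP h; rewrite /coord_inv.
by case: pselect => // h'; case: cid.
Qed.

Lemma coord_unitPl (x y : coord_ring) : y * x = 1 -> coord_unit x.
Proof. by move=> h; apply/asboolP; exists y. Qed.

Lemma coord_inv_out : {in [predC coord_unit], coord_inv =1 id}.
Proof.
move=> x /asboolPn h; rewrite /coord_inv.
by case: pselect.
Qed.

HB.instance Definition _ := GRing.ComNzRing_hasMulInverse.Build coord_ring
  coord_mulVx coord_unitPl coord_inv_out.

Lemma coord_idomain (x y : coord_ring) : x * y = 0 -> (x == 0) || (y == 0).
Proof. exact: Quotient.rquot_IdomainAxiom. Qed.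

HB.instance Definition _ :=
  GRing.ComUnitRing_isIntegral.Build coord_ring coord_idomain.

Definition coord_pi : {rmorphism {mpoly K[n.+2]} -> coord_ring} :=
  (\pi_{ideal_quot hideal})%qT.

End CoordinateRing.

(* The subfield of E with carrier a division-closed predicate S. *)
Section Subfield.
Variables (E : fieldType) (S : divringClosed E).

Record subfield := Subfield { sfval :> E; sfvalP : sfval \in S }.

HB.instance Definition _ := [isSub for sfval].
HB.instance Definition _ := [Choice of subfield by <:].
HB.instance Definition _ := [SubChoice_isSubIntegralDomain of subfield by <:].
HB.instance Definition _ := [SubIntegralDomain_isSubField of subfield by <:].

End Subfield.

(* For phi the projection of K[x_0, ..., x_(m-1)] onto a homogeneous coordinate
   ring R, ratfun phi is the field of rational functions: the quotients of
   homogeneous elements of R of the same degree. *)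
Section RationalFunctions.
Variables (K : fieldType) (m : nat) (R : idomainType).
Variable phi : {rmorphism {mpoly K[m]} -> R}.
Local Notation "x %:F" := (@FracField.tofrac R x).

Definition degree0_frac : {pred {fraction R}} := fun x =>
  `[< exists (k : nat) (G H : {mpoly K[m]}),
      [/\ G \is k.-homog, H \is k.-homog, phi H != 0 &
          x = (phi G)%:F / (phi H)%:F] >].

Lemma degree0_frac_closed : divring_closed degree0_frac.
Proof.
have F0 a : a != 0 -> a%:F != 0 by rewrite tofrac_eq0.
split.
- apply/asboolP; exists 0%N, 1, 1.
  by rewrite rmorph1 oner_eq0 dhomog1 tofrac1 divr1.
- move=> x y /asboolP[k [G [H [hG hH nH ->]]]].
  move=> /asboolP[k' [G' [H' [hG' hH' nH' ->]]]]; apply/asboolP.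
  exists (k + k')%N, (G * H' - G' * H), (H * H'); split.
  + by apply: rpredB; [|rewrite addnC]; exact: dhomogM.
  + exact: dhomogM.
  + by rewrite rmorphM mulf_neq0.
  + by rewrite rmorphB !rmorphM /= tofracB !tofracM -[X in _ + X]mulNr
       addf_div ?F0 // mulNr.
- move=> x y /asboolP[k [G [H [hG hH nH ->]]]].
  move=> /asboolP[k' [G' [H' [hG' hH' nH' ->]]]]; apply/asboolP.
  have [G'0|nG'] := eqVneq (phi G') 0.
    exists 0%N, 0, 1; split; rewrite ?rpred0 ?dhomog1 ?rmorph1 ?oner_eq0 //.
    by rewrite G'0 !rmorph0 !mul0r invr0 mulr0.
  exists (k + k')%N, (G * H'), (H * G'); split; rewrite ?dhomogM //.
  + by rewrite rmorphM mulf_neq0.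
  + by rewrite !rmorphM /= invf_div mulf_div.
Qed.

HB.instance Definition _ := GRing.isDivringClosed.Build {fraction R}
  degree0_frac degree0_frac_closed.

Definition ratfun : fieldType := subfield degree0_frac.

End RationalFunctions.

Definition funfield_proj (K : fieldType) (N : nat) : fieldType :=
  ratfun (idfun : {rmorphism {mpoly K[N.+1]} -> {mpoly K[N.+1]}}).

Definition funfield (K : fieldType) (n d : nat) (X : hypersurface K n d) :
  fieldType := ratfun (coord_pi X).

(* iota : F -> E is a (finite) Galois extension: some F-isomorphic copy L of E
   is a splitting field over F and is Galois over the base field. *)
Definition galois_extension (F E : fieldType) (iota : {rmorphism F -> E}) :=
  exists (L : splittingFieldType F) (f : {rmorphism L -> E}),
    [/\ bijective f, (forall x : F, f x%:A = iota x) & galois 1 {:L}].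

Section Projection.
Variables (K : fieldType) (n d : nat) (X : hypersurface K n d).

(* [v] |-> [v A] is a linear projection P^(n+1) --> P^n with center P. *)
Definition has_center (A : 'M[K]_(n.+2, n.+1)) (P : pspace K n.+1) :=
  forall v : 'rV[K]_n.+2, (v \in pline P) = (v *m A == 0).

Definition pullback (A : 'M[K]_(n.+2, n.+1)) (G : {mpoly K[n.+1]}) :
    {mpoly K[n.+2]} :=
  G \mPo [tuple \sum_i A i j *: 'X_i | j < n.+1].

(* iota sends G/H to (G o A)/(H o A), restricted to X. *)
Definition induced_by (A : 'M[K]_(n.+2, n.+1))
    (iota : {rmorphism funfield_proj K n -> funfield X}) :=
  forall (k : nat) (G H : {mpoly K[n.+1]}) (x : funfield_proj K n),
    G \is k.-homog -> H \is k.-homog -> H != 0 ->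
    sfval x = FracField.tofrac G / FracField.tofrac H ->
    sfval (iota x) * FracField.tofrac (coord_pi X (pullback A H))
      = FracField.tofrac (coord_pi X (pullback A G)).

Definition galois_point (P : pspace K n.+1) :=
  (hsmooth X P \/ ~ hpoints X P) /\
  exists (A : 'M[K]_(n.+2, n.+1))
         (iota : {rmorphism funfield_proj K n -> funfield X}),
    [/\ has_center A P, induced_by A iota & galois_extension iota].

Definition outer_galois_points : set (pspace K n.+1) :=
  [set P | galois_point P /\ ~ hpoints X P].

End Projection.

Definition fermat (K : fieldType) (n d : nat) : {mpoly K[n.+2]} :=
  \sum_(i < n.+2) 'X_i ^+ d.

(* G lies in K[X_k, ..., X_(m-1)]. *)
Definition only_vars_from (K : fieldType) (m k : nat) (G : {mpoly K[m]}) :=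
  forall u, u \in msupp G -> forall i : 'I_m, (i < k)%N -> u i = 0%N.

Definition has_multiple_component (K : fieldType) (m : nat)
    (G : {mpoly K[m]}) :=
  exists H : {mpoly K[m]}, (forall c : K, H != c%:MP) /\ mp_dvd (H ^+ 2) G.

(* Main.v *)
(* Projecting from an outer Galois point P = [v] presents X as a monic equation
   F(t) = 0 of degree d over K[y_0, ..., y_n], whose d roots lie in the function
   field of X.  Since dim Sing X <= n - 2 the homogeneous coordinate ring is
   normal, so these integral roots are linear forms; F(t) is then, up to scalars,
   invariant under d affine substitutions of t, hence of the form (t + l)^d + g.
   Thus P is an outer Galois point if and only if the derivative of F along v is
   d F(v) c^(d-1) for a linear form c with c(v) = 1.

   For two such points the mixed second derivative of F shows that each linear
   form vanishes at the other point, unless F is a cone; and cones have no or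
   infinitely many outer Galois points.  So m outer Galois points bring F to the
   shape Y_0^d + ... + Y_(m-1)^d + G(Y_m, ..., Y_(n+1)).  In particular
   m <= n + 2, with equality for the Fermat hypersurface.  On Sing X the first m
   coordinates vanish, and a chain of prime ideals of K[Y_0, ..., Y_(n+1)] running
   through the ideal of a component of Sing X, the ideals (Y_0, ..., Y_(j-1)) and,
   if m = n - s, the ideal (Y_0, ..., Y_(m-1), H) for a prime factor H of G gives
   both m <= n - s and, in case of equality, H^2 | G. *)

Require Import Defs.
From HB Require Import structures.
From mathcomp Require Import all_boot all_order all_algebra all_field.
From mathcomp Require Import boolp classical_sets functions cardinality.
From mathcomp Require Import mpoly.
From mathcomp Require Import ring zify.
Import Order.TTheory GRing.Theory Num.Theory.
Local Open Scope classical_set_scope.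
Local Open Scope ring_scope.

Set Implicit Arguments.
Unset Strict Implicit.
Unset Printing Implicit Defensive.

(** Normality is obtained by hand. The coordinate ring is presented as S[t]/(F) with S a polynomial
    ring, hence factorial, and F monic. An integral root that is not polynomial then has a prime h
    of S in its denominator, and an explicit prime ideal over h is shown to contain F together with
    all its derivatives. Dimension is available only through chains of irreducible closed sets.
    Lower bounds come from lifting chains of linear subspaces through finite projections, upper
    bounds from turning a chain into prime ideals of a polynomial ring, whose length is bounded by
    algebraic independence. Frames serve both purposes: they describe the projection from an
    arbitrary point [v] and identify K[x] with S[t] without moving [v] to a coordinate point. That
    the roots are linear comes from the grading: a conjugate of x/x_0 has degree 0, so its product
    with x_0 has degree 1, and a polynomial that represents it can be cut down to its component of
    degree 1. *)

Lemma mpoly_rmorph_eq (R : comNzRingType) (S : comNzRingType) (n : nat)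
    (f g : {rmorphism {mpoly R[n]} -> S}) :
  (forall c, f c%:MP = g c%:MP) -> (forall i, f 'X_i = g 'X_i) -> f =1 g.
Proof.
move=> fgC fgX p; rewrite (mpolyE p) !rmorph_sum; apply: eq_bigr => m _.
rewrite -mul_mpolyC !rmorphM fgC; congr (_ * _).
rewrite mpolyXE_id !rmorph_prod; apply: eq_bigr => i _.
by rewrite !rmorphXn /= fgX.
Qed.

Lemma mderivXU (R : comNzRingType) n (i j : 'I_n) :
  ('X_i)^`M(j) = (i == j)%:R :> {mpoly R[n]}.
Proof.
rewrite mderivX mnm1E; case: eqP => [->|_]; last by rewrite scale0r.
by rewrite scale1r -{1}(add0m U_(j)%MM) addmK mpolyX0.
Qed.

(** Both sides obey the same Leibniz rule along [f] and agree on constants and variables. With [f]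
    equal to [lsub A], [evline u v] or [Phi B v] this yields the chain rule for that
    substitution. *)
Lemma mpoly_deriv_chain (R : comNzRingType) (S : comNzRingType) (n : nat)
    (f : {rmorphism {mpoly R[n]} -> S}) (D : {mpoly R[n]} -> S) :
  (forall p q, D (p + q) = D p + D q) ->
  (forall p q, D (p * q) = D p * f q + f p * D q) ->
  (forall c, D c%:MP = 0) ->
  forall p, D p = \sum_i f p^`M(i) * D 'X_i.
Proof.
move=> DD DM DC.
pose E p := \sum_i f p^`M(i) * D 'X_i.
have ED p q : E (p + q) = E p + E q.
  rewrite /E -big_split; apply: eq_bigr => i _.
  by rewrite /= mderivD rmorphD mulrDl.
have EM p q : E (p * q) = E p * f q + f p * E q.
  rewrite /E mulr_suml mulr_sumr -big_split; apply: eq_bigr => i _ /=.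
  by rewrite mderivM rmorphD !rmorphM; ring.
have EC c : E c%:MP = 0.
  by rewrite /E big1 // => i _; rewrite mderivC rmorph0 mul0r.
have EX i : E 'X_i = D 'X_i.
  rewrite /E (bigD1 i) //= big1 => [|j ji].
    by rewrite addr0 mderivXU eqxx rmorph1 mul1r.
  by rewrite mderivXU eq_sym (negPf ji) rmorph0 mul0r.
have D0 : D 0 = 0 by rewrite -[RHS](DC 0) mpolyC0.
have E0 : E 0 = 0 by rewrite -[RHS](EC 0) mpolyC0.
have H1 : D 1 = E 1 by rewrite -mpolyC1 DC EC.
suff DE p : D p = E p by [].
elim/mpolyind: p => [|c m p _ _ IH]; first by rewrite D0 E0.
rewrite DD ED IH -mul_mpolyC DM EM DC EC !mul0r !add0r; congr (_ * _ + _).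
have Hexp x k : D x = E x -> D (x ^+ k) = E (x ^+ k).
  by move=> h; elim: k => // k IHk; rewrite exprS DM EM h IHk.
rewrite mpolyXE_id; elim/big_ind: _ => //.
- by move=> x y hx hy; rewrite DM EM hx hy.
- by move=> i _; apply: Hexp; rewrite EX.
Qed.

(** * Evaluation, linear substitutions and directional derivatives *)

Section Evaluation.
Variable K : comNzRingType.

Definition ev n (v : 'rV[K]_n) (F : {mpoly K[n]}) : K := F.@[fun i => v 0 i].
HB.instance Definition _ n v :=
  GRing.RMorphism.copy (@ev n v) (meval (fun i => v 0 i)).
Definition lin n (c : 'cV[K]_n) : {mpoly K[n]} := \sum_i c i 0 *: 'X_i.
Definition lsub m n (A : 'M[K]_(m, n)) (G : {mpoly K[n]}) : {mpoly K[m]} :=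
  G \mPo [tuple \sum_i A i j *: 'X_i | j < n].
HB.instance Definition _ m n A :=
  GRing.RMorphism.copy (@lsub m n A)
    (comp_mpoly [tuple \sum_i A i j *: 'X_i | j < n]).

Lemma evC n c v : ev v (c%:MP_[n]) = c. Proof. exact: mevalC. Qed.
Lemma evX n i (v : 'rV_n) : ev v 'X_i = v 0 i. Proof. exact: mevalXU. Qed.
Lemma evZ n c (F : {mpoly K[n]}) v : ev v (c *: F) = c * ev v F.
Proof. exact: mevalZ. Qed.
Lemma evD n (F G : {mpoly K[n]}) v : ev v (F + G) = ev v F + ev v G.
Proof. exact: mevalD. Qed.
Lemma evM n (F G : {mpoly K[n]}) v : ev v (F * G) = ev v F * ev v G.
Proof. exact: mevalM. Qed.
Lemma ev_exp n (F : {mpoly K[n]}) k v : ev v (F ^+ k) = ev v F ^+ k.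
Proof. exact: rmorphXn. Qed.
Lemma ev_sum n v I (r : seq I) (P : pred I) (F : I -> {mpoly K[n]}) :
  ev v (\sum_(i <- r | P i) F i) = \sum_(i <- r | P i) ev v (F i).
Proof. exact: (raddf_sum (ev v)). Qed.
Lemma ev_lin n (c : 'cV_n) v : ev v (lin c) = (v *m c) 0 0.
Proof.
by rewrite raddf_sum mxE; apply: eq_bigr => i _; rewrite /= evZ evX mulrC.
Qed.

Lemma ev_lsub m n (A : 'M_(m, n)) G v : ev v (lsub A G) = ev (v *m A) G.
Proof.
rewrite /ev comp_mpoly_meval; apply: meval_eq => j.
rewrite tnth_mktuple !mxE -/(ev v _) raddf_sum; apply: eq_bigr => i _.
by rewrite /= evZ evX mulrC.
Qed.

Lemma lsubC m n (A : 'M_(m, n)) c : lsub A c%:MP = c%:MP.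
Proof. exact: comp_mpolyC. Qed.
Lemma lsubX m n (A : 'M_(m, n)) j : lsub A 'X_j = lin (col j A).
Proof.
rewrite /lsub comp_mpolyXU -tnth_nth tnth_mktuple.
by apply: eq_bigr => i _; rewrite mxE.
Qed.
Lemma lsub_exp m n (A : 'M_(m, n)) G k : lsub A (G ^+ k) = lsub A G ^+ k.
Proof. exact: rmorphXn. Qed.
Lemma mpoly0_const (F : {mpoly K[0]}) : F = (ev 0 F)%:MP.
Proof.
by apply: (mpoly_rmorph_eq (f := idfun) (g := @mpolyC 0 K \o @ev 0 0))
  => [c|[]//]; rewrite /= evC.
Qed.

Definition dird n (v : 'rV[K]_n) (F : {mpoly K[n]}) : {mpoly K[n]} :=
  \sum_i v 0 i *: F^`M(i).

Lemma mderiv_lin n (c : 'cV_n) i : (lin c)^`M(i) = (c i 0)%:MP.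
Proof.
rewrite /lin raddf_sum (bigD1 i) //= big1 => [|j ji].
  by rewrite addr0 mderivZ mderivXU eqxx -mul_mpolyC mulr1.
by rewrite mderivZ mderivXU (negPf ji) scaler0.
Qed.

Lemma dird_lin n v (c : 'cV_n) : dird v (lin c) = ((v *m c) 0 0)%:MP.
Proof.
rewrite /dird mxE raddf_sum; apply: eq_bigr => i _ /=.
by rewrite mderiv_lin mpolyCM mul_mpolyC.
Qed.

Lemma mderiv_lsub m n (A : 'M_(m, n)) F i :
  (lsub A F)^`M(i) = lsub A (dird (row i A) F).
Proof.
rewrite (mpoly_deriv_chain (f := lsub A) (D := fun p => (lsub A p)^`M(i))).
- rewrite /dird raddf_sum; apply: eq_bigr => j _.
  by rewrite lsubX mderiv_lin /= -mul_mpolyC rmorphM /= lsubC !mxE mulrC.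
- by move=> p q; rewrite raddfD mderivD.
- by move=> p q; rewrite rmorphM mderivM.
- by move=> c; rewrite lsubC mderivC.
Qed.

Lemma dirdD n v (F G : {mpoly K[n]}) : dird v (F + G) = dird v F + dird v G.
Proof.
by rewrite /dird -big_split; apply: eq_bigr => i _; rewrite mderivD scalerDr.
Qed.
Lemma dirdC n v c : dird v c%:MP_[n] = 0.
Proof. by rewrite /dird big1 // => i _; rewrite mderivC scaler0. Qed.
Lemma dirdM n v (F G : {mpoly K[n]}) :
  dird v (F * G) = dird v F * G + F * dird v G.
Proof.
rewrite /dird mulr_suml mulr_sumr -big_split; apply: eq_bigr => i _ /=.
by rewrite mderivM -scalerAl -scalerAr -scalerDr.
Qed.
Lemma dirdZ n v c (F : {mpoly K[n]}) : dird v (c *: F) = c *: dird v F.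
Proof. by rewrite -mul_mpolyC dirdM dirdC mul0r add0r mul_mpolyC. Qed.
Lemma dird_exp n v (F : {mpoly K[n]}) k :
  dird v (F ^+ k) = (F ^+ k.-1 * dird v F) *+ k.
Proof.
elim: k => [|k IH]; first by rewrite expr0 -mpolyC1 dirdC.
rewrite exprS dirdM IH -pred_Sn; case: k {IH} => [|k].
  by rewrite !expr0 mulr0n mulr0 addr0 mulrC.
by rewrite -pred_Sn mulrnAr mulrA -exprS [RHS]mulrS mulrC.
Qed.
Lemma mderiv_dird n v (F : {mpoly K[n]}) i : (dird v F)^`M(i) = dird v F^`M(i).
Proof.
rewrite /dird (raddf_sum (mderiv i)); apply: eq_bigr => j _.
by rewrite /= mderivZ mderiv_comm.
Qed.
Lemma dird_sum n v I (r : seq I) (P : pred I) (F : I -> {mpoly K[n]}) :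
  dird v (\sum_(i <- r | P i) F i) = \sum_(i <- r | P i) dird v (F i).
Proof.
by apply: (big_morph (dird v)); [exact: dirdD | rewrite -mpolyC0 dirdC].
Qed.
Lemma dird_comm n u v (F : {mpoly K[n]}) : dird u (dird v F) = dird v (dird u F).
Proof.
rewrite {1}/dird [dird u F]/dird dird_sum.
by apply: eq_bigr => i _; rewrite mderiv_dird dirdZ.
Qed.
Lemma dird_is_linear_dir n a u v (F : {mpoly K[n]}) :
  dird (a *: u + v) F = a *: dird u F + dird v F.
Proof.
rewrite /dird scaler_sumr -big_split; apply: eq_bigr => i _ /=.
by rewrite !mxE scalerDl scalerA.
Qed.

Definition evline n (u v : 'rV[K]_n) : {mpoly K[n]} -> {poly K} :=
  mmap polyC (fun i => (u 0 i)%:P + v 0 i *: 'X).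
HB.instance Definition _ n u v :=
  GRing.RMorphism.copy (@evline n u v)
    (mmap polyC (fun i => (u 0 i)%:P + v 0 i *: 'X)).

Lemma evlineC n u v c : @evline n u v c%:MP = c%:P.
Proof. by rewrite /evline mmapC. Qed.
Lemma evlineX n u v i : @evline n u v 'X_i = (u 0 i)%:P + v 0 i *: 'X.
Proof. by rewrite /evline mmapX mmap1U. Qed.

Lemma evlineE n (u v : 'rV_n) F t : (evline u v F).[t] = ev (u + t *: v) F.
Proof.
suff: horner_eval t \o evline u v =1 ev (u + t *: v) by apply.
apply: mpoly_rmorph_eq => [c|i] /=; first by rewrite evlineC evC /horner_eval hornerC.
by rewrite evlineX evX !mxE /horner_eval hornerD hornerC hornerZ hornerX mulrC.
Qed.

Lemma deriv_evline n (u v : 'rV_n) F :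
  (evline u v F)^`() = evline u v (dird v F).
Proof.
rewrite (mpoly_deriv_chain (f := evline u v) (D := fun p => (evline u v p)^`())).
- rewrite /dird raddf_sum; apply: eq_bigr => i _.
  rewrite evlineX derivD derivC add0r derivZ derivX.
  by rewrite /= -mul_mpolyC rmorphM /= evlineC alg_polyC mulrC.
- by move=> p q; rewrite raddfD derivD.
- by move=> p q; rewrite rmorphM derivM.
- by move=> c; rewrite evlineC derivC.
Qed.

End Evaluation.

(** * Coordinates adapted to the projection from a point *)

Section Frames.
Variables (K : closedFieldType) (m : nat).

(* The coordinates (w A, w c) on K^(m+1), with inverse (y, a) |-> y B + a v;
   the point [v] is the center of the projection [w] |-> [w A].  Phi writes a
   polynomial as a polynomial in the coordinate a over K[y]; Psi is its inverse. *)
Definition frame (A : 'M[K]_(m.+1, m)) (c : 'cV[K]_m.+1)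
    (B : 'M[K]_(m, m.+1)) (v : 'rV[K]_m.+1) :=
  [/\ B *m A = 1%:M, B *m c = 0, v *m A = 0, v *m c = 1%:M &
      A *m B + c *m v = 1%:M].

Definition Phi (B : 'M[K]_(m, m.+1)) (v : 'rV[K]_m.+1) :
    {mpoly K[m.+1]} -> {poly {mpoly K[m]}} :=
  mmap (polyC \o @mpolyC m K) (fun i => (lin (col i B))%:P + (v 0 i)%:MP *: 'X).
HB.instance Definition _ B v := GRing.RMorphism.copy (@Phi B v)
  (mmap (polyC \o @mpolyC m K) (fun i => (lin (col i B))%:P + (v 0 i)%:MP *: 'X)).

Definition Psi (A : 'M[K]_(m.+1, m)) (c : 'cV[K]_m.+1)
    (p : {poly {mpoly K[m]}}) : {mpoly K[m.+1]} := (map_poly (lsub A) p).[lin c].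
HB.instance Definition _ A c := GRing.RMorphism.copy (@Psi A c)
  (horner_eval (lin c) \o map_poly (lsub A)).

Lemma PsiD A c : {morph Psi A c : p q / p + q}. Proof. exact: rmorphD. Qed.
Lemma PsiM A c : {morph Psi A c : p q / p * q}. Proof. exact: rmorphM. Qed.

Lemma PhiC B v a : Phi B v a%:MP = (a%:MP)%:P.
Proof. by rewrite /Phi mmapC. Qed.
Lemma PhiX B v i : Phi B v 'X_i = (lin (col i B))%:P + (v 0 i)%:MP *: 'X.
Proof. by rewrite /Phi mmapX mmap1U. Qed.

Lemma PsiC A c G : Psi A c G%:P = lsub A G.
Proof. by rewrite /Psi map_polyC hornerC. Qed.
Lemma PsiX A c : Psi A c 'X = lin c.
Proof. by rewrite /Psi map_polyX hornerX. Qed.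

Lemma PhiE B v F y a :
  (map_poly (ev y) (Phi B v F)).[a] = ev (y *m B + a *: v) F.
Proof.
suff: horner_eval a \o map_poly (ev y) \o Phi B v =1 ev (y *m B + a *: v) by apply.
apply: mpoly_rmorph_eq => [b|i]; rewrite /= /horner_eval.
  by rewrite PhiC map_polyC hornerC /= !evC.
rewrite PhiX rmorphD /= map_polyC map_polyZ map_polyX hornerD hornerC hornerZ.
rewrite hornerX /= evC ev_lin evX !mxE mulrC; congr (_ + _).
by apply: eq_bigr => j _; rewrite mxE.
Qed.

Variables (A : 'M[K]_(m.+1, m)) (c : 'cV[K]_m.+1).
Variables (B : 'M[K]_(m, m.+1)) (v : 'rV[K]_m.+1).
Hypothesis fr : frame A c B v.

Lemma lin_mul k l (M : 'M[K]_(k, l)) (d : 'cV[K]_l) :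
  lsub M (lin d) = lin (M *m d).
Proof.
rewrite /lin raddf_sum /=.
under eq_bigr => i _ do rewrite -mul_mpolyC rmorphM /= lsubC lsubX mul_mpolyC
  /lin scaler_sumr.
rewrite exchange_big; apply: eq_bigr => j _.
rewrite mxE scaler_suml; apply: eq_bigr => i _.
by rewrite mxE scalerA mulrC.
Qed.

Lemma linD k (a b : 'cV[K]_k) : lin (a + b) = lin a + lin b.
Proof.
by rewrite /lin -big_split; apply: eq_bigr => i _; rewrite mxE scalerDl.
Qed.
Lemma linZ k x (a : 'cV[K]_k) : lin (x *: a) = x *: lin a.
Proof.
by rewrite /lin scaler_sumr; apply: eq_bigr => i _; rewrite mxE scalerA.
Qed.
Lemma lin_delta k (i : 'I_k) : lin (delta_mx i 0) = 'X_i :> {mpoly K[k]}.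
Proof.
rewrite /lin (bigD1 i) //= big1 => [|j ji].
  by rewrite mxE !eqxx scale1r addr0.
by rewrite mxE (negPf ji) scale0r.
Qed.

Lemma Phi_lin d : Phi B v (lin d) = (lin (B *m d))%:P + ((v *m d) 0 0)%:MP *: 'X.
Proof.
rewrite {1}/lin raddf_sum /=.
under eq_bigr => i _ do rewrite -mul_mpolyC rmorphM /= PhiC PhiX mulrDr.
rewrite big_split /=; congr (_ + _).
  rewrite /lin.
  under eq_bigr => i _ do rewrite -polyCM mul_mpolyC scaler_sumr.
  rewrite -rmorph_sum /= exchange_big; congr (_%:P); apply: eq_bigr => j _.
  rewrite mxE scaler_suml; apply: eq_bigr => i _.
  by rewrite mxE scalerA mulrC.
rewrite mxE rmorph_sum scaler_suml; apply: eq_bigr => i _ /=.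
by rewrite mul_polyC scalerA -mpolyCM mulrC.
Qed.

Lemma Phi_lsub G : Phi B v (lsub A G) = G%:P.
Proof.
case: fr => BA Bc vA vc _.
apply: (mpoly_rmorph_eq (f := Phi B v \o lsub A) (g := polyC)) => [a|i] /=.
  by rewrite lsubC PhiC.
rewrite lsubX Phi_lin colE !mulmxA BA vA mul1mx lin_delta mul0mx mxE.
by rewrite mpolyC0 scale0r addr0.
Qed.

Lemma PhiK : cancel (Phi B v) (Psi A c).
Proof.
case: fr => BA Bc vA vc ABcv F.
apply: (mpoly_rmorph_eq (f := Psi A c \o Phi B v) (g := idfun)) => [a|i] /=.
  by rewrite PhiC PsiC lsubC.
rewrite PhiX rmorphD /= -mul_polyC rmorphM /= !PsiC PsiX lsubC.
rewrite mul_mpolyC -linZ lin_mul -linD -lin_delta; congr lin.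
rewrite -[RHS]mul1mx -ABcv mulmxDl -!mulmxA -!colE; congr (_ + _).
by apply/matrixP => j k; rewrite !mxE big_ord1 !mxE !ord1 mulrC.
Qed.

Lemma PsiK : cancel (Psi A c) (Phi B v).
Proof.
case: fr => BA Bc vA vc ABcv p.
elim/poly_ind: p => [|p G IH]; first by rewrite !rmorph0.
rewrite !rmorphD !rmorphM /= IH PsiC PsiX Phi_lsub Phi_lin Bc vc mxE eqxx.
rewrite /lin big1 => [|j _]; last by rewrite mxE scale0r.
by rewrite polyC0 add0r scale1r.
Qed.

Lemma frame_point w : w = (w *m A) *m B + ((w *m c) 0 0) *: v.
Proof.
case: fr => _ _ _ _ h; rewrite -{1}[w]mulmx1 -h mulmxDr !mulmxA; congr (_ + _).
by rewrite -mul_scalar_mx; congr (_ *m _); rewrite -mx11_scalar.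
Qed.

Lemma frame_A y a : (y *m B + a *: v) *m A = y.
Proof.
by case: fr => BA _ vA _ _; rewrite mulmxDl -mulmxA BA mulmx1 -scalemxAl vA scaler0 addr0.
Qed.
Lemma deriv_Phi F : (Phi B v F)^`() = Phi B v (dird v F).
Proof.
rewrite (mpoly_deriv_chain (f := Phi B v) (D := fun p => (Phi B v p)^`())).
- rewrite /dird raddf_sum; apply: eq_bigr => i _.
  rewrite PhiX derivD derivC add0r derivZ derivX.
  by rewrite /= -[v 0 i *: _]mul_mpolyC rmorphM /= PhiC alg_polyC mulrC.
- by move=> p q; rewrite raddfD derivD.
- by move=> p q; rewrite rmorphM derivM.
- by move=> a; rewrite PhiC derivC.
Qed.

End Frames.

Section FrameExistence.
Variable K : closedFieldType.

Lemma frame_of_center m (A : 'M[K]_(m.+1, m)) (c : 'cV[K]_m.+1) v :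
  (forall w : 'rV_m.+1, w *m A = 0 -> exists a, w = a *: v) ->
  v *m A = 0 -> v *m c = 1%:M -> exists B, frame A c B v.
Proof.
move=> kerA vA vc.
have rA : row_full A.
  rewrite /row_full eqn_leq rank_leq_col /=.
  have h : (kermx A <= v)%MS.
    apply/row_subP => i; have [|a ->] := kerA (row i (kermx A)); last exact: scalemx_sub.
    by rewrite -row_mul mulmx_ker row0.
  have := mxrankS h; rewrite mxrank_ker => h1.
  have := leq_trans h1 (rank_leq_row v).
  by rewrite leq_subLR addn1.
pose B0 := pinvmx A; have B0A : B0 *m A = 1%:M by rewrite mulVpmx.
(* The correction forces B c = 0, since v c = 1, and it does not disturb B A = 1, since v A = 0. *)
exists (B0 - B0 *m c *m v); have BA : (B0 - B0 *m c *m v) *m A = 1%:M.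
  by rewrite mulmxBl -(mulmxA _ v) vA mulmx0 subr0.
have Bc : (B0 - B0 *m c *m v) *m c = 0.
  by rewrite mulmxBl -(mulmxA _ v) vc mulmx1 subrr.
split=> //; set B := B0 - _ in BA Bc *.
apply/row_matrixP => i; apply/eqP; rewrite -subr_eq0 -linearB /=.
(* [D] kills both A and c. Its rows therefore lie in the kernel of A, so they are multiples of v,
   and v c = 1 makes these multiples zero. *)
set D := A *m B + c *m v - 1%:M.
have DA : D *m A = 0.
  by rewrite mulmxBl mulmxDl -!mulmxA BA vA mulmx1 mulmx0 addr0 mul1mx subrr.
have Dc : D *m c = 0.
  by rewrite mulmxBl mulmxDl -!mulmxA Bc vc mulmx1 mulmx0 add0r mul1mx subrr.
have [|a ha] := kerA (row i D); first by rewrite -row_mul DA row0.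
have : row i D *m c = 0 by rewrite -row_mul Dc row0.
rewrite ha -scalemxAl vc => /matrixP /(_ 0 0); rewrite !mxE eqxx mulr1 => ->.
by rewrite scale0r.
Qed.

Lemma frame_exists m (v : 'rV[K]_m.+1) (c : 'cV[K]_m.+1) :
  v *m c = 1%:M -> exists A B, frame A c B v.
Proof.
move=> vc; have v0 : v != 0.
  by apply/eqP => v0; move: vc => /matrixP /(_ 0 0) /eqP; rewrite v0 mul0mx !mxE eq_sym oner_eq0.
suff [A [vA kerA]] : exists A : 'M[K]_(m.+1, m), v *m A = 0 /\
    (forall w : 'rV_m.+1, w *m A = 0 -> exists a, w = a *: v).
  by have [B fB] := frame_of_center kerA vA vc; exists A, B.
have rk : \rank (cokermx v) = m by rewrite mxrank_coker rank_rV v0 subn1.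
have h1 : v *m col_base (cokermx v) = 0.
  apply: (row_free_inj (row_base_free (cokermx v))).
  by rewrite /= -mulmxA mulmx_base mulmx_coker mul0mx.
have h2 w : w *m col_base (cokermx v) = 0 -> exists a, w = a *: v.
  move=> h; have : (w <= v)%MS.
    by rewrite submxE -[cokermx v]mulmx_base mulmxA h mul0mx.
  by move=> /sub_rVP.
by move: (col_base _) h1 h2; rewrite rk => A h1 h2; exists A.
Qed.

Lemma dual_vector m (v : 'rV[K]_m) : v != 0 -> exists c : 'cV[K]_m, v *m c = 1%:M.
Proof.
move=> /rV0Pn [i vi]; exists ((v 0 i)^-1 *: delta_mx i 0).
rewrite -scalemxAr -colE; apply/matrixP => a b; rewrite !ord1 !mxE.
by rewrite mulVf.
Qed.

End FrameExistence.

(** * Polynomials over an infinite field as functions *)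

Section ClosedField.
Variable K : closedFieldType.

(** In the frame at the first coordinate vector F is a nonzero polynomial in one variable over n
    others: first avoid the zeros of its leading coefficient, then the roots of the specialized
    polynomial. *)
Lemma mpoly_nonroot n (F : {mpoly K[n]}) : F != 0 -> exists v, ev v F != 0.
Proof.
elim: n F => [|n IH] F F0.
  exists 0; apply: contraNneq F0 => F0.
  have : ev 0 F = 0 by []; move/(congr1 (@mpolyC 0 K)); rewrite mpolyC0 => <-.
  by apply/eqP; apply: (mpoly_rmorph_eq (f := idfun) (g := @mpolyC 0 K \o @ev K 0 0))
    => [c|[]//]; rewrite /= evC.
have e0 : delta_mx 0 ord0 != 0 :> 'rV[K]_n.+1.
  by apply/eqP => /matrixP /(_ 0 ord0) /eqP; rewrite !mxE oner_eq0.
have [c vc] := dual_vector e0.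
have [A [B fr]] := frame_exists vc.
have P0 : Phi B (delta_mx 0 ord0) F != 0.
  by apply: contraNneq F0 => h; rewrite -(PhiK fr F) h rmorph0.
have := P0; rewrite -lead_coef_eq0 => /IH [y hy].
have : map_poly (ev y) (Phi B (delta_mx 0 ord0) F) != 0.
  by rewrite map_poly_eq0_id0.
by move=> /closed_nonrootP [a ha]; exists (y *m B + a *: delta_mx 0 ord0); rewrite -PhiE.
Qed.

Lemma ev_inj n (F G : {mpoly K[n]}) : (forall v, ev v F = ev v G) -> F = G.
Proof.
move=> h; apply/eqP; rewrite -subr_eq0; apply: contraT => /mpoly_nonroot [v].
by rewrite raddfB /= h subrr eqxx.
Qed.

(** The converse compares the coefficients of t^d in F(tv) = sum_k t^k F_k(v). In this functional
    form homogeneity passes through linear substitutions at once. *)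
Lemma dhomog_ev n d (F : {mpoly K[n]}) :
  F \is d.-homog <-> (forall t v, ev (t *: v) F = t ^+ d * ev v F).
Proof.
have hom k (G : {mpoly K[n]}) : G \is k.-homog ->
    forall t v, ev (t *: v) G = t ^+ k * ev v G.
  move=> hG t v; rewrite /ev !mevalE mulr_sumr.
  rewrite big_seq [RHS]big_seq; apply: eq_bigr => m mG.
  rewrite mulrCA; congr (_ * _).
  rewrite -(dhomog_mf hG mG) /= mdegE -prodrXr -big_split.
  by apply: eq_bigr => i _; rewrite /= mxE exprMn.
split; first exact: hom.
move=> h; suff -> : F = pihomog mdeg d F by apply: pihomogP.
apply: ev_inj => v.
pose N := (maxn d.+1 (msize F)).
have FE : F = \sum_(k < N) pihomog mdeg k F by apply: pihomog_partitionE; rewrite leq_maxr.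
pose p : {poly K} :=
  \sum_(k < N) ev v (pihomog mdeg k F) *: 'X^k - ev v F *: 'X^d.
have dN : (d < N)%N by rewrite leq_max leqnn.
have p0 : p = 0.
  apply/eqP; apply: contraT => /closed_nonrootP [t]; rewrite rootE /p hornerD hornerN.
  rewrite hornerZ hornerXn horner_sum mulrC -h [F in ev _ F]FE ev_sum.
  rewrite subr_eq0 => /eqP []; apply: eq_bigr => k _.
  rewrite hornerZ hornerXn mulrC; apply/esym.
  exact: (hom k _ (pihomogP mdeg k F) t v).
have : p`_d = 0 by rewrite p0 coef0.
rewrite coefB coefZ coefXn eqxx mulr1 coef_sum => /eqP.
rewrite subr_eq0 => /eqP <-; rewrite (bigD1 (Ordinal dN)) //= big1 => [|k kd].
  by rewrite addr0 coefZ coefXn eqxx mulr1.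
rewrite coefZ coefXn; case: eqP => [e|_]; last by rewrite mulr0.
by case/eqP: kd; apply: val_inj.
Qed.

Lemma dhomog_lsub m n d (A : 'M[K]_(m, n)) F :
  F \is d.-homog -> lsub A F \is d.-homog.
Proof.
move=> /dhomog_ev h; apply/dhomog_ev => t v.
by rewrite !ev_lsub -scalemxAl h.
Qed.

Lemma dhomog_lin n (c : 'cV[K]_n) : lin c \is 1.-homog.
Proof. by apply/dhomog_ev => t v; rewrite !ev_lin -scalemxAl mxE expr1. Qed.

End ClosedField.

(** * Unique factorization *)

Section UFD.

Definition rdvd (R : comNzRingType) (a b : R) := exists q, b = q * a.

Definition prime_elt (R : idomainType) (p : R) :=
  [/\ p != 0, p \isn't a GRing.unit &
      forall a b, rdvd p (a * b) -> rdvd p a \/ rdvd p b].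

(** The factors are prime, not merely irreducible, so existence already carries uniqueness. *)
Definition ufd (R : idomainType) := forall x : R, x != 0 ->
  exists (u : R) (s : seq R), [/\ u \is a GRing.unit,
    (forall p, p \in s -> prime_elt p) & x = u * \prod_(p <- s) p].

Lemma rdvdD (R : comNzRingType) (a b c : R) : rdvd a b -> rdvd a c -> rdvd a (b + c).
Proof. by move=> [q ->] [r ->]; exists (q + r); rewrite mulrDl. Qed.
Lemma rdvdN (R : comNzRingType) (a b : R) : rdvd a b -> rdvd a (- b).
Proof. by move=> [q ->]; exists (- q); rewrite mulNr. Qed.
Lemma rdvdB (R : comNzRingType) (a b c : R) : rdvd a b -> rdvd a c -> rdvd a (b - c).
Proof. by move=> h1 h2; apply: rdvdD => //; exact: rdvdN. Qed.
Lemma rdvd_mull (R : comNzRingType) (a b c : R) : rdvd a b -> rdvd a (c * b).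
Proof. by move=> [q ->]; exists (c * q); rewrite mulrA. Qed.
Lemma rdvd_mulr (R : comNzRingType) (a b c : R) : rdvd a b -> rdvd a (b * c).
Proof. by rewrite mulrC; exact: rdvd_mull. Qed.
Lemma rdvd0 (R : comNzRingType) (a : R) : rdvd a 0.
Proof. by exists 0; rewrite mul0r. Qed.
Lemma rdvdxx (R : comNzRingType) (a : R) : rdvd a a.
Proof. by exists 1; rewrite mul1r. Qed.
Lemma rdvd_trans (R : comNzRingType) (a b c : R) : rdvd a b -> rdvd b c -> rdvd a c.
Proof. by move=> [q ->] [r ->]; exists (r * q); rewrite mulrA. Qed.
Lemma rdvd_sum (R : comNzRingType) (a : R) I (r : seq I) (P : pred I) (F : I -> R) :
  (forall i, P i -> rdvd a (F i)) -> rdvd a (\sum_(i <- r | P i) F i).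
Proof.
move=> h; elim/big_ind: _ => //; first exact: rdvd0.
by move=> x y; exact: rdvdD.
Qed.

Lemma prime_elt_expr (R : idomainType) (p a : R) k :
  prime_elt p -> rdvd p (a ^+ k) -> rdvd p a.
Proof.
move=> [p0 up pp]; elim: k => [|k IH]; last by rewrite exprS => /pp [|/IH].
rewrite expr0 => -[q h]; case/negP: up.
by apply/unitrP; exists q; rewrite -h mulrC -h.
Qed.

Lemma prime_elt_prod (R : idomainType) (p : R) (s : seq R) :
  prime_elt p -> rdvd p (\prod_(x <- s) x) -> exists2 x, x \in s & rdvd p x.
Proof.
move=> pP; case: (pP) => p0 up pp; elim: s => [|x s IH].
  rewrite big_nil => -[q h]; case/negP: up.
  by apply/unitrP; exists q; rewrite -h mulrC -h.
rewrite big_cons => /pp [h|/IH[y ys h]]; first by exists x; rewrite ?mem_head.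
by exists y; rewrite ?inE ?ys ?orbT.
Qed.

Variable R : idomainType.
Hypothesis ufdR : ufd R.
Implicit Types (f g a b : {poly R}).

Lemma rdvd_polyC (c : R) f : rdvd c%:P f <-> forall i, rdvd c f`_i.
Proof.
split=> [[q ->] i|h]; first by exists (q`_i); rewrite coefMC.
pose q := \poly_(i < size f) sval (cid (h i)).
exists q; apply/polyP => i; rewrite coefMC coef_poly.
case: ltnP => [_|le]; first exact: (svalP (cid (h i))).
by rewrite nth_default // mul0r.
Qed.

Lemma prime_polyC (p : R) : prime_elt p -> prime_elt p%:P.
Proof.
move=> [p0 up pp]; split; rewrite ?polyC_eq0 //.
  by rewrite poly_unitE size_polyC p0 coefC.
move=> f g /rdvd_polyC h; apply: contrapT => /not_orP[nf ng].
have min q : ~ rdvd p%:P q ->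
    exists2 i, ~ rdvd p q`_i & forall j, (j < i)%N -> rdvd p q`_j.
  move=> /rdvd_polyC /existsNP H.
  have H' : exists i, `[< ~ rdvd p q`_i >] by case: H => i ?; exists i; apply/asboolP.
  case: (ex_minnP H') => i /asboolP hi mini; exists i => // j ji.
  by apply: contrapT => /asboolP /mini; rewrite leqNgt ji.
have [i ni mi] := min _ nf; have [j nj mj] := min _ ng.
have := h (i + j)%N; rewrite coefM.
have lt : (i < (i + j).+1)%N by rewrite ltnS leq_addr.
rewrite (bigD1 (Ordinal lt)) //= addKn => hs.
suff : rdvd p (f`_i * g`_j) by move=> /pp[].
rewrite -[_ * _](addrK (\sum_(k < (i + j).+1 | k != Ordinal lt) f`_k * g`_(i + j - k))).
apply: rdvdB => //; apply: rdvd_sum => k kn.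
have [ki|ik] := ltnP k i; first by apply: rdvd_mulr; exact: mi.
apply/rdvd_mull/mj; rewrite ltn_subLR; last by rewrite -ltnS.
rewrite ltn_add2r ltn_neqAle ik andbT; apply: contraNneq kn => e.
by apply/eqP/val_inj.
Qed.

Definition primitive g := forall p : R, prime_elt p -> ~ rdvd p%:P g.

(** The primes of [c] are cancelled one at a time: such a p divides e g, is prime in R[X] and does
    not divide g, hence divides e. *)
Lemma primitive_cancel c g a : primitive g -> c != 0 ->
  rdvd g (c *: a) -> rdvd g a.
Proof.
move=> prg c0; have [u [s [uu sP ->]]] := ufdR c0; rewrite -scalerA.
move=> [e he]; have {he}: rdvd g ((\prod_(p <- s) p) *: a).
  by exists (u^-1 *: e); rewrite -scalerAl -he [RHS]scalerA mulVr ?scale1r.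
elim: s sP => [|p s IH] sP; first by rewrite big_nil scale1r.
rewrite big_cons -scalerA => -[{}e he]; apply: IH => [q qs|].
  by apply: sP; rewrite inE qs orbT.
have pP : prime_elt p by apply: sP; rewrite mem_head.
have [_ _ pp] := prime_polyC pP.
have /pp [|/(prg _ pP)//] : rdvd p%:P (e * g) by rewrite -he -mul_polyC mulrC; exists (\prod_(p <- s) p *: a).
move=> [e' ee']; exists e'; have /mulfI : p%:P != 0 by case: pP; rewrite polyC_eq0.
by apply; rewrite mul_polyC he ee' mulrAC mulrC.
Qed.

(** Each prime factor of [c] stays prime in R[X], so it can be removed from [a] or from [b] without
    changing degrees. *)
Lemma gauss_factor c f a b : c != 0 -> c *: f = a * b ->
  exists a' b', [/\ f = a' * b', size a' = size a & size b' = size b].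
Proof.
move=> c0; have [u [s [uu sP ->]]] := ufdR c0; rewrite -scalerA.
move=> /(congr1 (fun q => u^-1 *: q)) /=; rewrite [X in X = _ -> _]scalerA mulVr // scale1r scalerAl.
have : size (u^-1 *: a) = size a.
  by rewrite size_scale // invr_eq0; apply: contraTneq uu => ->; rewrite unitr0.
move: (u^-1 *: a) => a1 <-; elim: s sP a1 b => [|p s IH] sP a1 b.
  by rewrite big_nil scale1r => ->; exists a1, b.
rewrite big_cons -scalerA => he.
have pP : prime_elt p by apply: sP; rewrite mem_head.
have [p0 _ pp] := prime_polyC pP.
have p00 : p != 0 by rewrite -polyC_eq0.
have sP' q : q \in s -> prime_elt q by move=> qs; apply: sP; rewrite inE qs orbT.
have : rdvd p%:P (a1 * b) by rewrite -he -mul_polyC mulrC; exists (\prod_(p <- s) p *: f).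
case/pp => -[e ee].
- have [|a' [b' [fE sa sb]]] := IH sP' e b.
    by apply: (mulfI p0); rewrite mul_polyC he ee mulrCA mulrA.
  by exists a', b'; split; rewrite // ?sa ?sb ee mulrC mul_polyC size_scale.
- have [|a' [b' [fE sa sb]]] := IH sP' a1 e.
    by apply: (mulfI p0); rewrite mul_polyC he ee mulrA mulrC.
  by exists a', b'; split; rewrite // ?sa ?sb ee mulrC mul_polyC size_scale.
Qed.

(** Euclidean descent on the degree of [a], with g dividing a b. A long [a] is replaced by its
    pseudo-remainder modulo g, a short one by the pseudo-remainder of g modulo [a]. If the latter is
    zero, [gauss_factor] contradicts irreducibility; otherwise it is too short to be a multiple of
    g, so g divides [b]. *)
Lemma primitive_prime g : primitive g -> (1 < size g)%N ->
  (forall a b, g = a * b -> (1 < size a)%N -> (1 < size b)%N -> False) ->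
  prime_elt g.
Proof.
move=> prg sg irr.
have g0 : g != 0 by rewrite -size_poly_gt0 (ltn_trans _ sg).
split=> //; first by rewrite poly_unitE gtn_eqF.
move=> a; move: {2}(size a) (leqnn (size a)) => k.
elim: k a => [|k IH] a sa b gab.
  by left; move: sa; rewrite leqn0 size_poly_eq0 => /eqP ->; exact: rdvd0.
have [le|lt] := leqP (size g) (size a).
  have E := Pdiv.Idomain.divp_eq a g.
  have lc0 : lead_coef g ^+ scalp a g != 0 by rewrite expf_neq0 // lead_coef_eq0.
  have [||h|] := IH (a %% g) _ b.
  - by have := ltn_modp a g; rewrite g0 => h; rewrite -ltnS (leq_trans h) // (leq_trans le).
  - have -> : a %% g = lead_coef g ^+ scalp a g *: a - a %/ g * g.
      by rewrite E [RHS]addrC addKr.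
    rewrite mulrBl; apply: rdvdB; first by rewrite -scalerAl -mul_polyC; exact: rdvd_mull.
    by rewrite mulrAC; exists (a %/ g * b).
  - left; apply: (primitive_cancel prg lc0); rewrite E.
    by apply: rdvdD => //; exists (a %/ g).
  - by right.
have [a0|an0] := eqVneq a 0; first by left; rewrite a0; exact: rdvd0.
have [sa1|sa1] := leqP (size a) 1.
  right; move: gab; rewrite (size1_polyC sa1) mul_polyC; apply: primitive_cancel => //.
  by rewrite -polyC_eq0 -size1_polyC.
have E := Pdiv.Idomain.divp_eq g a.
have lc0 : lead_coef a ^+ scalp g a != 0 by rewrite expf_neq0 // lead_coef_eq0.
have sr : (size (g %% a)%R < size a)%N by rewrite ltn_modp.
have [r0|rn0] := eqVneq (g %% a) 0.
  move: E; rewrite r0 addr0 => E.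
  have [a' [b' [gE _ sb']]] := gauss_factor lc0 E.
  have b'1 : (1 < size b')%N by rewrite sb'.
  have sa' : (size a' <= 1)%N by rewrite leqNgt; apply/negP => /(irr _ _ gE) /(_ b'1).
  have : (size g <= size a)%N.
    by rewrite gE -sb' (size1_polyC sa') mul_polyC; exact: size_scale_leq.
  by rewrite leqNgt lt.
have [||h|] := IH (g %% a) _ b; last by right.
- by rewrite -ltnS (leq_trans sr).
- have -> : g %% a = lead_coef a ^+ scalp g a *: g - g %/ a * a.
    by rewrite E [RHS]addrC addKr.
  rewrite mulrBl; apply: rdvdB.
    by rewrite -scalerAl -mul_polyC; apply/rdvd_mull/rdvd_mulr/rdvdxx.
  by rewrite -mulrA; apply: rdvd_mull.
- case: h => q qE; have q0 : q != 0 by apply: contraNneq rn0 => q0; rewrite qE q0 mul0r.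
  have : (size g <= size (g %% a)%R)%N.
    by rewrite qE size_mul // -subn1 leq_subRL ?leq_add2r ?size_poly_gt0 // addn_gt0 size_poly_gt0 q0.
  by rewrite leqNgt (ltn_trans sr).
Qed.

(** A prime dividing [f] divides its leading coefficient, so no more primes can be extracted than
    that coefficient has prime factors. *)
Lemma strip_content f : f != 0 ->
  exists (t : seq R) g, [/\ forall p, p \in t -> prime_elt p,
    f = (\prod_(p <- t) p) *: g & primitive g].
Proof.
move=> f0; have lf0 : lead_coef f != 0 by rewrite lead_coef_eq0.
have [u [s [uu sP ls]]] := ufdR lf0.
have : rdvd (lead_coef f) (\prod_(p <- s) p).
  by exists u^-1; rewrite ls mulrA mulVr ?mul1r.
move: {ls lf0} (erefl (size s)); move: {2}(size s) => k ks.
elim: k s ks sP f f0 => [|k IH] s ks sP f f0 ls.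
  exists [::], f; split=> //; first by rewrite big_nil scale1r.
  move=> p [p0 up pp] [q fE]; case/negP: up.
  move/size0nil: ks ls => -> [r]; rewrite big_nil fE lead_coefM lead_coefC => e.
  by apply/unitrP; exists (r * lead_coef q); rewrite [p * _]mulrC -mulrA -e.
have [prf|] := pselect (primitive f); first by exists [::], f; rewrite big_nil scale1r; split.
move=> /existsNP [p /not_implyP [pP /contrapT [q fE]]].
have [p0 up pp] := pP.
have q0 : q != 0 by apply: contraNneq f0 => q0; rewrite fE q0 mul0r.
have [x xs [e xE]] : exists2 x, x \in s & rdvd p x.
  apply: prime_elt_prod => //; apply: rdvd_trans ls.
  by rewrite fE lead_coefM lead_coefC; exists (lead_coef q).
(* Since x = e p is prime too, p and x are associates, and dropping x from the list accounts for
   p. *)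
have ue : e \is a GRing.unit.
  have [x0 ux xx] := sP _ xs.
  have /xx [[r eE]|[r pE]] : rdvd x (e * p) by rewrite -xE; exact: rdvdxx.
    case/negP: up; apply/unitrP; exists r.
    have e0 : e != 0 by apply: contraNneq x0 => e0; rewrite xE e0 mul0r.
    have h : (r * p) * e = 1 * e by rewrite mul1r {2}eE xE; ring.
    by rewrite [p * r]mulrC (mulIf e0 h).
  apply/unitrP; exists r; have h : (r * e) * p = 1 * p.
    by rewrite mul1r {2}pE xE; ring.
  by rewrite [e * r]mulrC (mulIf p0 h).
have [|||t [g [tP qE prg]]] := IH (rem x s) _ _ q q0.
- by rewrite size_rem // ks.
- by move=> y /mem_rem /sP.
- case: ls => r; rewrite (perm_big _ (perm_to_rem xs)) /= big_cons fE lead_coefM lead_coefC xE.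
  move=> h; exists (e^-1 * r); apply: (mulIf p0); apply: (mulrI ue).
  rewrite -[e * (_ * p)]mulrC -mulrA [p * e]mulrC mulrC h.
  by rewrite !mulrA mulrV // mul1r.
- exists (p :: t), g; split=> //.
    by move=> y; rewrite inE => /orP[/eqP ->|/tP].
  by rewrite big_cons -scalerA -qE fE mulrC mul_polyC.
Qed.

Lemma ufd_poly : ufd {poly R}.
Proof.
have consts (t : seq R) : (forall p, p \in t -> prime_elt p) ->
    forall p, p \in map polyC t -> prime_elt p.
  by move=> tP p /mapP [q /tP qP ->]; exact: prime_polyC.
move=> f; move: {2}(size f) (leqnn (size f)) => k.
elim: k f => [|k IH] f sf f0.
  by move: sf f0; rewrite leqn0 size_poly_eq0 => ->.
have [sf1|sf1] := leqP (size f) 1.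
  have f00 : f`_0 != 0 by rewrite -polyC_eq0 -size1_polyC.
  have [u [s [uu sP fE]]] := ufdR f00.
  exists u%:P, (map polyC s); split; last 1 first.
  - by rewrite big_map -rmorph_prod -polyCM -fE -size1_polyC.
  - by rewrite rmorph_unit.
  - exact: consts.
suff [s [sP gE]] : exists s, (forall p, p \in s -> prime_elt p) /\
    exists2 u, u \is a GRing.unit & f = u * \prod_(p <- s) p.
  by case: gE => u uu ->; exists u, s.
have [t [g [tP fE prg]]] := strip_content f0.
have c0 : \prod_(p <- t) p != 0.
  by apply: contraNneq f0 => h; rewrite fE h scale0r.
have sg : size g = size f by rewrite fE size_scale.
suff [s [sP [u uu gE]]] : exists s, (forall p, p \in s -> prime_elt p) /\
    exists2 u, u \is a GRing.unit & g = u * \prod_(p <- s) p.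
  exists (map polyC t ++ s); split=> [p|].
    by rewrite mem_cat => /orP[/(consts _ tP)|/sP].
  exists u => //; rewrite big_cat big_map -rmorph_prod /= mulrCA -gE fE.
  by rewrite mul_polyC.
have [[a [b [gE sa sb]]]|nex] := pselect (exists a b, [/\ g = a * b, (1 < size a)%N & (1 < size b)%N]).
  have a0 : a != 0 by rewrite -size_poly_gt0 (ltn_trans _ sa).
  have b0 : b != 0 by rewrite -size_poly_gt0 (ltn_trans _ sb).
  have sab : size f = (size a + size b).-1 by rewrite -sg gE size_mul.
  have [||u [s [uu sP aE]]] := IH a => //; first by lia.
  have [||u' [s' [uu' sP' bE]]] := IH b => //; first by lia.
  exists (s ++ s'); split=> [p|]; first by rewrite mem_cat => /orP[/sP|/sP'].
  by exists (u * u'); rewrite ?unitrM ?uu // big_cat gE {1}aE {1}bE mulrACA.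
exists [:: g]; split=> [p|]; last by exists 1; rewrite ?unitr1 // big_seq1 mul1r.
rewrite inE => /eqP ->; apply: primitive_prime => //; first by rewrite sg.
by move=> a b gE sa sb; apply: nex; exists a, b.
Qed.

End UFD.

Lemma ufd_transfer (R S : idomainType) (f : {rmorphism R -> S}) (g : {rmorphism S -> R}) :
  cancel f g -> cancel g f -> ufd R -> ufd S.
Proof.
move=> fK gK ufdR x x0.
have gx0 : g x != 0 by apply: contraNneq x0 => h; rewrite -(gK x) h rmorph0.
have [u [s [uu sP gE]]] := ufdR _ gx0.
exists (f u), (map f s); split; first exact: rmorph_unit.
- move=> p /mapP [q /sP [q0 uq qq] ->]; split.
  + by apply: contraNneq q0 => h; rewrite -(fK q) h rmorph0.
  + by apply: contraNN uq => h; rewrite -(fK q) rmorph_unit.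
  + move=> a b [r ab]; have : rdvd q (g a * g b).
      by exists (g r); rewrite -rmorphM ab rmorphM fK.
    case/qq => -[e he]; [left|right]; exists (f e);
      by rewrite -rmorphM -he gK.
- by rewrite big_map -rmorph_prod -rmorphM -gE gK.
Qed.

Lemma ufd_mpoly (K : closedFieldType) n : ufd {mpoly K[n]}.
Proof.
elim: n => [|n IH].
  move=> x x0; exists x, [::]; split=> //; last by rewrite big_nil mulr1.
  have xE := mpoly0_const x.
  have : ev 0 x != 0 by apply: contraNneq x0 => h; rewrite xE h mpolyC0.
  by rewrite -unitfE xE => h; rewrite evC in h *; exact: (rmorph_unit (@mpolyC 0 K)).
have e0 : delta_mx 0 ord0 != 0 :> 'rV[K]_n.+1.
  by apply/eqP => /matrixP /(_ 0 ord0) /eqP; rewrite !mxE oner_eq0.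
have [c vc] := dual_vector e0; have [A [B fr]] := frame_exists vc.
exact: (ufd_transfer (PsiK fr) (PhiK fr) (ufd_poly IH)).
Qed.

(** * Normality *)

Section Normality.
Variables (S : idomainType) (E : fieldType) (F : {poly S}).
Variable theta : {rmorphism {poly S} -> E}.
Hypothesis monF : F \is monic.
Hypothesis kerE : forall p, theta p = 0 <-> rdvd F p.

Definition integral_elt (x : E) :=
  exists k (c : nat -> {poly S}), x ^+ k = \sum_(i < k) theta (c i) * x ^+ i.

Definition derivation (R : comNzRingType) (delta : R -> R) :=
  (forall p q, delta (p + q) = delta p + delta q) /\
  (forall p q, delta (p * q) = delta p * q + p * delta q).

Lemma integral_mul r x : integral_elt x -> integral_elt (theta r * x).
Proof.
move=> [k [c hx]]; exists k, (fun i => r ^+ (k - i) * c i).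
rewrite exprMn hx mulr_sumr; apply: eq_bigr => i _.
rewrite exprMn rmorphM !rmorphXn /= -{1}(subnK (ltnW (ltn_ord i))) exprD.
by ring.
Qed.

Lemma integral_root (P : {poly {poly S}}) x :
  P \is monic -> root (map_poly theta P) x -> integral_elt x.
Proof.
move=> mP /rootP; rewrite horner_coef size_map_poly_id0; last first.
  by rewrite (monicP mP) rmorph1 oner_eq0.
have : (0 < size P)%N by rewrite size_poly_gt0 monic_neq0.
case sP: (size P) => [//|k] _; rewrite big_ord_recr /=.
have lk : P`_k = 1 by move/monicP: mP; rewrite lead_coefE sP.
rewrite coef_map lk /= rmorph1 mul1r => /eqP; rewrite addrC addr_eq0 => /eqP hx.
exists k, (fun i => - P`_i); rewrite hx -sumrN; apply: eq_bigr => i _.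
by rewrite coef_map rmorphN mulNr.
Qed.

Lemma theta1F : (1 < size F)%N.
Proof.
rewrite ltnNge; apply/negP => s1; have F0 := monic_neq0 monF.
have /eqP : theta 1 = 0.
  apply/kerE; move/monicP: monF; rewrite (size1_polyC s1) lead_coefC => ->.
  exact: rdvdxx.
by rewrite rmorph1 oner_eq0.
Qed.

Variable h : S.
Hypothesis prh : prime_elt h.

(** For b representing h x, the element x is polynomial exactly when b lies in this ideal (h, F). *)
Let I (r : {poly S}) := exists x y, r = h%:P * x + y * F.

Let ID a b : I a -> I b -> I (a + b).
Proof. by move=> [x [y ->]] [x' [y' ->]]; exists (x + x'), (y + y'); ring. Qed.
Let IM a b : I b -> I (a * b).
Proof. by move=> [x [y ->]]; exists (a * x), (a * y); ring. Qed.
Let IB a b : I a -> I b -> I (a - b).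
Proof. by move=> ha hb; rewrite -mulN1r; apply: ID => //; exact: IM. Qed.
Let Ih a : rdvd h%:P a -> I a.
Proof. by move=> [q ->]; exists q, 0; rewrite mul0r addr0 mulrC. Qed.
Let IF a : rdvd F a -> I a.
Proof. by move=> [q ->]; exists 0, q; rewrite mulr0 add0r. Qed.

Let F_division p : exists q r, [/\ p = q * F + r, (size r < size F)%N &
  (size q <= size p - (size F).-1)%N].
Proof.
exists (p %/ F), (p %% F); split; first exact: Pdiv.IdomainMonic.divp_eq.
  by rewrite ltn_modp monic_neq0.
by rewrite size_divp // monic_neq0.
Qed.

(** F being monic, S[t]/(F) is free over S on the powers of t below deg F, so for a reduced
    representative divisibility by h modulo F is divisibility in S[t]. *)
Let I_small r : I r -> (size r < size F)%N -> rdvd h%:P r.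
Proof.
move=> [x [y rE]] sr; have [q [x' [xE sx _]]] := F_division x.
have [h0 _ _] := prh.
have E1 : r - h%:P * x' = (y + h%:P * q) * F by rewrite rE xE; ring.
have s1 : (size (r - h%:P * x')%R < size F)%N.
  rewrite (leq_ltn_trans (size_polyD _ _)) // gtn_max sr size_polyN.
  by rewrite mul_polyC (leq_ltn_trans (size_scale_leq _ _)).
have z : y + h%:P * q = 0.
  apply: contraTeq s1 => z; rewrite E1 -leqNgt size_mul ?(monic_neq0 monF) //.
  by have := z; rewrite -size_poly_gt0; lia.
by exists x'; apply/eqP; rewrite mulrC -subr_eq0 E1 z mul0r.
Qed.

(** For the same reason S[t]/(h, F) is free over the domain S/(h), hence torsion-free. *)
Let I_tors c x : ~ rdvd h c -> I (c%:P * x) -> I x.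
Proof.
move=> hc Icx; have [q [r [xE sr _]]] := F_division x; rewrite xE.
apply: ID; first by apply: IF; exists q.
have Icr : I (c%:P * r).
  have -> : c%:P * r = c%:P * x - c%:P * q * F by rewrite xE; ring.
  by apply: IB => //; apply: IF; exists (c%:P * q).
have sc : (size (c%:P * r)%R < size F)%N.
  by rewrite mul_polyC (leq_ltn_trans (size_scale_leq _ _)).
have [_ _ pp] := prime_polyC prh.
have /pp [|] := I_small Icr sc; last exact: Ih.
by move=> /rdvd_polyC /(_ 0%N); rewrite coefC.
Qed.

Let thF : theta F = 0. Proof. by apply/kerE; exact: rdvdxx. Qed.
Let thh : theta h%:P != 0.
Proof.
apply/eqP => /kerE [q hE]; have [h0 _ _] := prh.
have := congr1 (fun p : {poly S} => size p) hE; rewrite size_polyC h0 /=.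
have [->|q0] := eqVneq q 0; first by rewrite mul0r size_poly0.
rewrite size_mul ?(monic_neq0 monF) //; have := theta1F.
have : (0 < size q)%N by rewrite size_poly_gt0.
by move: (size q) (size F) => k l; lia.
Qed.

Let cand b := ~ I b /\ exists2 x, integral_elt x & theta b = theta h%:P * x.

(* Suppose x is integral and h x lies in S[t]/(F), but x does not.  Among the
   nonzero classes b modulo (h, F) with b / h integral, a class with
   annihilator of minimal degree has a prime annihilator, and at that prime
   the hypersurface F = 0 is singular. *)
Lemma singular_prime x b : integral_elt x -> theta b = theta h%:P * x ->
  (forall r, x <> theta r) ->
  exists pp : {poly S} -> Prop, [/\ forall a b, pp a -> pp b -> pp (a + b),
    forall a b, pp b -> pp (a * b), forall a, pp a%:P -> rdvd h a, pp F &
    forall delta, derivation delta -> pp (delta F)].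
Proof.
move=> ix bE xn.
have cb : cand b.
  split; last by exists x.
  move=> [y [z bE']]; apply: (xn y); apply: (mulfI thh).
  by rewrite -bE bE' rmorphD !rmorphM /= thF mulr0 addr0.
have prC := prime_polyC prh; have [_ uh hh] := prh.
(* F annihilates every class modulo (h, F) and its leading coefficient 1 is prime to h; so
   annihilators of this kind exist, and N is their least size over all candidates at once. *)
have ex : exists k, `[< exists b g, [/\ cand b, I (g * b), ~ rdvd h (lead_coef g) &
    size g = k] >].
  exists (size F); apply/asboolP; exists b, F; split=> //.
    by apply: IF; rewrite mulrC; exists b.
  rewrite (monicP monF) => -[q e]; case/negP: uh; apply/unitrP; exists q.
  by rewrite -e mulrC -e.
case: (ex_minnP ex) => N /asboolP [{}b [g [{}cb gb lg sg]]] minN {x ix bE xn ex}.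
(* Below size N the leading coefficient of an annihilator must be divisible by h. Removing the
   leading term gives a shorter annihilator, and so on down to 0. *)
have small b' r : cand b' -> I (r * b') -> (size r < N)%N -> rdvd h%:P r.
  move=> cb'; move: {2}(size r) (leqnn (size r)) => k.
  elim: k r => [|k IHk] r sr rb lt.
    by move: sr; rewrite leqn0 size_poly_eq0 => /eqP ->; exact: rdvd0.
  have [hl|nl] := pselect (rdvd h (lead_coef r)); last first.
    have := minN (size r); rewrite leqNgt lt => H; exfalso; apply: notF; apply: H.
    by apply/asboolP; exists b', r; split.
  have [r0|r0] := eqVneq r 0; first by rewrite r0; exact: rdvd0.
  pose r1 := r - lead_coef r *: 'X^((size r).-1).
  have hd : rdvd h%:P (lead_coef r *: 'X^((size r).-1)).
    by case: hl => q ->; exists (q *: 'X^((size r).-1)); rewrite -scalerA mulrC mul_polyC scalerA scalerA mulrC.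
  have sr1 : (size r1 < size r)%N.
    have sr0 : (0 < size r)%N by rewrite size_poly_gt0.
    rewrite -[ltnRHS](prednK sr0) ltnS; apply/leq_sizeP => j lej.
    rewrite /r1 coefB coefZ coefXn; have [->|jn] := eqVneq j (size r).-1.
      by rewrite mulr1 lead_coefE subrr.
    rewrite mulr0 subr0 nth_default // -[leqLHS](prednK sr0).
    by rewrite ltn_neqAle eq_sym jn.
  rewrite -[r](subrK (lead_coef r *: 'X^((size r).-1))); apply: rdvdD => //.
  apply: IHk; [|by rewrite mulrBl; apply: IB => //; apply: Ih; exact: rdvd_mulr|].
  - by rewrite -ltnS (leq_trans sr1).
  - exact: ltn_trans lt.
pose pp r := I (r * b).
have ppD r s : pp r -> pp s -> pp (r + s) by rewrite /pp mulrDl; exact: ID.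
have ppM r s : pp s -> pp (r * s) by rewrite /pp -mulrA; exact: IM.
have pph r : rdvd h%:P r -> pp r by move=> hr; apply: Ih; exact: rdvd_mulr.
have ppF r : rdvd F r -> pp r by move=> hr; apply: IF; exact: rdvd_mulr.
(* If r is outside [pp], then r b is again a candidate. The pseudo-remainder of s by g annihilates
   it and is shorter than N, so h divides it; the power of the leading coefficient of g is then
   cancelled by [I_tors]. *)
have pp_prime r s : pp (r * s) -> pp r \/ pp s.
  move=> prs; have [|nr] := pselect (pp r); [by left|right].
  have cb1 : cand (r * b).
    split=> //; case: cb => _ [x ix bE]; exists (theta r * x); first exact: integral_mul.
    by rewrite rmorphM bE mulrCA.
  have dE := Pdiv.Idomain.divp_eq s g; set c := _ ^+ _ in dE.
  have g0 : g != 0.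
    by apply/eqP => g0; apply: lg; rewrite g0 lead_coef0; exact: rdvd0.
  have h1 : rdvd h%:P (s %% g).
    apply: (small _ _ cb1); last by rewrite -sg ltn_modp.
    have -> : s %% g * (r * b) = c%:P * (r * s * b) - s %/ g * r * (g * b).
      have -> : s %% g = c *: s - s %/ g * g by rewrite dE [RHS]addrC addKr.
      by rewrite -mul_polyC; ring.
    by apply: IB; exact: IM.
  apply: (@I_tors c); first by move=> /(prime_elt_expr prh).
  rewrite mulrA mul_polyC dE mulrDl -mulrA; apply: ID; first exact: IM.
  by apply: Ih; exact: rdvd_mulr.
have pp1 : ~ pp 1 by rewrite /pp mul1r; case: cb.
have pp_exp r k : pp (r ^+ k) -> pp r.
  by elim: k => [|k IHk]; rewrite ?expr0 // exprS => /pp_prime [].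
case: (cb) => nIb [x ix bE].
(* The integral equation of x makes c^k a multiple of a modulo F. With a = h this puts b into [pp],
   with a = g it will do the same for [gam]. *)
have pp_int a c : pp a -> theta c = theta a * x -> pp c.
  move=> pa cE; case: ix => k [d hx]; apply: (@pp_exp _ k).
  pose T := \sum_(i < k) d i * a ^+ (k - i).-1 * c ^+ i.
  have : rdvd F (c ^+ k - a * T).
    apply/kerE; rewrite rmorphB rmorphM rmorphXn cE exprMn hx !mulr_sumr /T rmorph_sum.
    rewrite mulr_sumr -sumrB big1 // => i _; rewrite /= !rmorphM !rmorphXn /= cE exprMn.
    have -> : theta a ^+ k = theta a * theta a ^+ (k - i).-1 * theta a ^+ i.
      by rewrite -exprS -exprD; congr (_ ^+ _); have := ltn_ord i; lia.
    by ring.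
  move=> /ppF H; rewrite -[c ^+ k](subrK (a * T)); apply: ppD => //.
  by rewrite mulrC; exact: ppM.
have ppb : pp b by apply: (@pp_int h%:P) => //; apply: pph; exact: rdvdxx.
have [q1 [b1 [b1E sb1 _]]] := F_division b.
have [q [r0 [gbE sr0 sq]]] := F_division (g * b1).
have Igb1 : I (g * b1).
  have -> : g * b1 = g * b - (g * q1) * F by rewrite b1E; ring.
  by apply: IB => //; apply: IF; exists (g * q1).
have [gam r0E] : rdvd h%:P r0.
  apply: I_small => //; have -> : r0 = g * b1 - q * F by rewrite gbE; ring.
  by apply: IB => //; apply: IF; exists q.
have thb1 : theta b1 = theta h%:P * x.
  by rewrite -bE b1E rmorphD rmorphM /= thF mulr0 add0r.
have ppg : pp g by [].
have ppgam : pp gam.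
  apply: (pp_int g) => //; apply: (mulfI thh).
  rewrite mulrCA -thb1 -!rmorphM gbE r0E rmorphD !rmorphM /= thF mulr0 add0r.
  by rewrite mulrC.
have ppb1 : pp b1.
  have -> : b1 = b - q1 * F by rewrite b1E; ring.
  by rewrite -mulNr; apply: ppD => //; apply: ppF; exists (- q1).
(* The quotient q is shorter than g, so q in [pp] would give h | q and h | g b1, hence h | g or h |
   b1; the first contradicts the leading coefficient of g, the second that b is not in (h, F). *)
have nppq : ~ pp q.
  move=> ppq; have hq : rdvd h%:P q.
    apply: (small b) => //; have g0 : g != 0.
      by apply/eqP => g0; apply: lg; rewrite g0 lead_coef0; exact: rdvd0.
    rewrite -sg (leq_ltn_trans sq) //; have := size_polyMleq g b1.
    have := theta1F; have : (0 < size g)%N by rewrite size_poly_gt0.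
    move: sb1; move: (size (g * b1)%R) (size g) (size b1) (size F).
    by move=> i j k l; lia.
  have : rdvd h%:P (g * b1).
    by rewrite gbE r0E; apply: rdvdD; [exact: rdvd_mulr|exists gam].
  have [_ _ HH] := prC; case/HH => [/rdvd_polyC hg|hb].
    by apply: lg; rewrite lead_coefE.
  apply: nIb; rewrite b1E; apply: ID; last exact: Ih.
  by apply: IF; exists q1.
exists pp; split=> //.
- move=> a ppa; apply: contrapT => ha; apply: nIb; exact: (I_tors ha).
- by apply: (ppF); exact: rdvdxx.
(* Differentiate g b1 = q F + gam h. Since g, b1, F, gam and h lie in [pp], so does q delta(F); as q
   does not, delta(F) does. *)
- move=> delta [dD dM].
  have := congr1 delta gbE; rewrite r0E dD !dM => H.
  have : pp (q * delta F); last by case/pp_prime.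
  have -> : q * delta F = delta g * b1 + g * delta b1 - delta q * F
     - delta gam * h%:P - gam * delta h%:P by rewrite H; ring.
  have ppN r : pp r -> pp (- r) by rewrite -mulN1r; exact: (ppM).
  apply: (ppD); last by apply: (ppN); rewrite mulrC; exact: (ppM).
  apply: (ppD); last by apply: (ppN); apply: (ppM); apply: (pph); exact: rdvdxx.
  apply: (ppD); last by apply: (ppN); apply: (ppM); apply: (ppF); exact: rdvdxx.
  by apply: (ppD); [exact: (ppM)|rewrite mulrC; exact: (ppM)].
Qed.

End Normality.

Lemma normal_or_singular (S : idomainType) (E : fieldType) (F : {poly S})
    (theta : {rmorphism {poly S} -> E}) (D : S) (a : {poly S}) (x : E) :
  ufd S -> F \is monic -> (forall p, theta p = 0 <-> rdvd F p) ->
  integral_elt theta x -> D != 0 -> theta D%:P * x = theta a ->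
  (exists r, x = theta r) \/
  exists h, [/\ prime_elt h, rdvd h D &
    exists pp : {poly S} -> Prop, [/\ forall a b, pp a -> pp b -> pp (a + b),
      forall a b, pp b -> pp (a * b), forall a, pp a%:P -> rdvd h a, pp F &
      forall delta, derivation delta -> pp (delta F)]].
Proof.
move=> ufdS monF kerE ix D0 Dx; have [u [s [uu sP DE]]] := ufdS _ D0.
have {Dx} : exists a, theta (\prod_(p <- s) p)%:P * x = theta a.
  exists (u^-1%:P * a); rewrite rmorphM -Dx DE mulrA -rmorphM -polyCM mulrA.
  by rewrite mulVr // mul1r.
have : forall p, p \in s -> rdvd p D.
  move=> p ps; rewrite DE; apply: rdvd_mull; rewrite (perm_big _ (perm_to_rem ps)) /=.
  by rewrite big_cons; apply/rdvd_mulr/rdvdxx.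
elim: {DE} s sP x ix => [|h s IH] sP x ix sD [b xb].
  by left; exists b; rewrite -xb big_nil rmorph1 mul1r.
pose y := theta (\prod_(p <- s) p)%:P * x.
have iy : integral_elt theta y by exact: integral_mul.
have hy : theta b = theta h%:P * y.
  by rewrite -xb big_cons /y polyCM rmorphM mulrA.
have [[r yr]|ny] := pselect (exists r, y = theta r).
  apply: IH => //; last by exists r.
  - by move=> p ps; apply: sP; rewrite inE ps orbT.
  - by move=> p ps; apply: sD; rewrite inE ps orbT.
right; exists h; have prh : prime_elt h by apply: sP; rewrite mem_head.
split=> //; first by apply: sD; rewrite mem_head.
by apply: (singular_prime monF kerE prh iy hy) => r yr; apply: ny; exists r.
Qed.

Lemma map_resultant_com (R S : comNzRingType) (f : {rmorphism R -> S})
    (p q : {poly R}) :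
  f (lead_coef p) != 0 -> f (lead_coef q) != 0 ->
  f (resultant p q) = resultant (map_poly f p) (map_poly f q).
Proof.
move=> nz_fp nz_fq; rewrite /resultant /Sylvester_mx !size_map_poly_id0 //.
rewrite -det_map_mx /= map_col_mx; congr (\det (col_mx _ _));
  by apply: map_lin1_mx => v; rewrite map_poly_rV rmorphM /= map_rVpoly.
Qed.

Lemma common_root (S : comNzRingType) (T : idomainType) (e : {rmorphism S -> T})
    (p q u w : {poly S}) (b : S) (a : T) : b%:P = u * p + w * q ->
  root (map_poly e p) a -> root (map_poly e q) a -> e b = 0.
Proof.
move=> bE /rootP rp /rootP rq.
have := congr1 (fun r => (map_poly e r).[a]) bE.
rewrite map_polyC hornerC => /= ->.
rewrite (rmorphD (map_poly e)) !(rmorphM (map_poly e)) hornerD !hornerM /=.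
by rewrite rp rq !mulr0 addr0.
Qed.

(* Replacing q by q + X^k p makes both polynomials monic, so that the
   resultant commutes with specialization. *)
Lemma elimination (S : comNzRingType) (K : closedFieldType) (p q : {poly S}) :
  p \is monic -> (1 < size p)%N ->
  exists b u w, b%:P = u * p + w * q /\
    forall e : {rmorphism S -> K}, e b = 0 ->
      exists2 a, root (map_poly e p) a & root (map_poly e q) a.
Proof.
move=> mp sp; pose k := (size q).+1.
pose q' := p * 'X^k + q.
have spX : size (p * 'X^k) = (k + size p)%N by rewrite size_mulXn // monic_neq0.
have ltq : (size q < size (p * 'X^k)%R)%N.
  by rewrite spX /k; move: (size q) (size p) => i j; lia.
have mq' : q' \is monic.
  by rewrite monicE lead_coefDl // lead_coef_Mmonic ?monicXn // (monicP mp).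
have sq' : (1 < size q')%N.
  by rewrite size_polyDl // spX; move: sp; move: (size p) => i; lia.
have [[u w] _ /= E] := resultant_in_ideal sp sq'.
exists (resultant p q'), (u + w * 'X^k), w; split.
  by rewrite E /q'; ring.
move=> e; have le r : r \is monic -> e (lead_coef r) != 0.
  by move=> /monicP ->; rewrite rmorph1 oner_eq0.
rewrite map_resultant_com ?le // => /eqP; rewrite resultant_eq0.
move=> sg; have /closed_rootP [a] : size (gcdp (map_poly e p) (map_poly e q')) != 1%N.
  by rewrite gtn_eqF.
rewrite root_gcd => /andP[rp rq']; exists a => //.
move: rq'; rewrite /q' rmorphD rmorphM /= !rootE hornerD hornerM.
by rewrite (rootP rp) mul0r add0r.
Qed.

(** * Projective closed sets *)

Section Projective.
Variable K : closedFieldType.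
Local Notation eval0 v F := (evline 0 v F).

Section Points.
Variable N : nat.
Implicit Types (P Q : pspace K N) (v w : 'rV[K]_N.+1) (F G : {mpoly K[N.+1]}).

Definition on P v := v \in pline P /\ v != 0.

Lemma on_exists P : exists v, on P v.
Proof.
have /eqP dP := pline_dim P; exists (vpick (pline P)); split; first exact: memv_pick.
by rewrite vpick0 -dimv_eq0 dP.
Qed.

Lemma on_line P v : on P v -> pline P = <[v]>%VS.
Proof.
move=> [vP v0]; apply/esym/eqP; rewrite eqEdim -memvE vP dim_vline v0.
by rewrite (eqP (pline_dim P)).
Qed.

Lemma on_inj P Q v : on P v -> on Q v -> P = Q.
Proof. by move=> /on_line hP /on_line hQ; apply: val_inj; rewrite /= hP hQ. Qed.

Lemma point_exists v : v != 0 -> exists P, on P v.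
Proof.
move=> v0; have d1 : \dim <[v]>%VS == 1%N by rewrite dim_vline v0.
by exists (PPoint d1); split=> //=; exact: memv_line.
Qed.

Lemma on_mem P v w : on P v -> (w \in pline P) <-> exists a, w = a *: v.
Proof.
move=> /on_line ->; split=> [/vlineP[a ->]|[a ->]]; first by exists a.
by rewrite memvZ ?memv_line.
Qed.

Lemma on_scale P v a : on P v -> a != 0 -> on P (a *: v).
Proof. by move=> [vP v0] a0; split; rewrite ?memvZ // scaler_eq0 negb_or a0. Qed.

Lemma on_proportional P v w : on P v -> on P w -> exists2 a, a != 0 & w = a *: v.
Proof.
move=> vP [wP w0]; have /(on_mem _ vP) [a wE] := wP; exists a => //.
by apply: contraNneq w0 => a0; rewrite wE a0 scale0r.
Qed.

Lemma vanishes_on P v F : on P v -> vanishes_at F P <-> forall t, ev (t *: v) F = 0.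
Proof.
move=> vP; split=> [h t|h w wP].
  by apply: h; case: vP => vP _; rewrite memvZ.
by have /(on_mem _ vP) [a ->] := wP; exact: h.
Qed.

(** Vanishing at a point becomes an equation in the domain K[t]; this gives [vanishesM] for
    polynomials that need not be homogeneous. *)
Lemma vanishes_evline P v F : on P v -> vanishes_at F P <-> evline 0 v F = 0.
Proof.
move=> vP; split=> [/(vanishes_on _ vP) h|h].
  apply/eqP; apply: contraT => /closed_nonrootP [t].
  by rewrite rootE evlineE add0r h eqxx.
by apply/(vanishes_on _ vP) => t; rewrite -[_ *: _]add0r -evlineE h horner0.
Qed.

Lemma vanishes_homog P v F k : on P v -> F \is k.-homog ->
  vanishes_at F P <-> ev v F = 0.
Proof.
move=> vP /dhomog_ev h; split=> [/(vanishes_on _ vP) /(_ 1)|h0].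
  by rewrite scale1r.
by apply/(vanishes_on _ vP) => t; rewrite h h0 mulr0.
Qed.

Lemma vanishes_pihomog P F : vanishes_at F P <->
  forall k, vanishes_at (pihomog mdeg k F) P.
Proof.
have [v vP] := on_exists P; split=> [|h]; last first.
  apply/(vanishes_on _ vP) => t.
  rewrite [F in ev _ F](@pihomog_partitionE _ _ mdeg (msize F) F) // ev_sum.
  rewrite big1 // => k _.
  by apply: (iffLR (vanishes_on _ vP)).
move=> /(vanishes_on _ vP) h k; apply/(vanishes_homog vP (pihomogP _ _ _)).
pose n := maxn k.+1 (msize F).
have kn : (k < n)%N by rewrite leq_max leqnn.
pose p : {poly K} := \sum_(i < n) ev v (pihomog mdeg i F) *: 'X^i.
have p0 : p = 0.
  apply/eqP; apply: contraT => /closed_nonrootP [t]; rewrite rootE horner_sum.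
  suff <- : ev (t *: v) F = \sum_(i < n) (ev v (pihomog mdeg i F) *: 'X^i).[t].
    by rewrite h eqxx.
  rewrite {1}(@pihomog_partitionE _ _ mdeg n F) ?leq_maxr // ev_sum.
  apply: eq_bigr => i _; rewrite hornerZ hornerXn mulrC.
  exact: (iffLR (dhomog_ev i _) (pihomogP mdeg i F) t v).
have : p`_k = 0 by rewrite p0 coef0.
rewrite coef_sum (bigD1 (Ordinal kn)) //= big1 => [|i ik].
  by rewrite addr0 coefZ coefXn eqxx mulr1.
rewrite coefZ coefXn; case: eqP => [e|_]; last by rewrite mulr0.
by case/eqP: ik; apply: val_inj.
Qed.

Lemma vanishesM P F G : vanishes_at (F * G) P <-> vanishes_at F P \/ vanishes_at G P.
Proof.
have [v vP] := on_exists P; rewrite !(vanishes_evline _ vP) rmorphM; split.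
  by move/eqP; rewrite mulf_eq0 => /orP[/eqP|/eqP]; [left|right].
by case=> h; apply/eqP; rewrite mulf_eq0; apply/orP; [left|right]; apply/eqP.
Qed.

Lemma vanishesD P F G : vanishes_at F P -> vanishes_at G P -> vanishes_at (F + G) P.
Proof.
have [v vP] := on_exists P; rewrite !(vanishes_evline _ vP) => hF hG.
by rewrite rmorphD /= hF hG addr0.
Qed.

Lemma vanishesZ P a F : vanishes_at F P -> vanishes_at (a *: F) P.
Proof. by rewrite -mul_mpolyC => h; apply/vanishesM; right. Qed.

Definition ideal_of (Z : set (pspace K N)) F := forall P, Z P -> vanishes_at F P.

Lemma closedP (Z : set (pspace K N)) : zariski_closed Z <->
  forall P, (forall F, ideal_of Z F -> vanishes_at F P) -> Z P.
Proof.
split=> [[I [_ ->]] P h F IF|h].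
  by apply: h => Q /(_ F IF).
exists [set F | ideal_of Z F /\ exists k, F \is k.-homog]; split.
  by move=> F [].
rewrite eqEsubset; split=> [P ZP F [IF _]|P hP]; first exact: IF.
apply: h => F IF; apply/vanishes_pihomog => k; apply: hP; split.
  by move=> Q /IF /vanishes_pihomog.
by exists k; apply: pihomogP.
Qed.

Lemma closed_separate (Z : set (pspace K N)) P : zariski_closed Z -> ~ Z P ->
  exists F k, [/\ ideal_of Z F, F \is k.-homog & ~ vanishes_at F P].
Proof.
move=> /closedP cZ nP; apply: contrapT => H; apply: nP; apply: cZ => F IF.
apply/vanishes_pihomog => k; apply: contrapT => nv; apply: H.
exists (pihomog mdeg k F), k; split=> //; last exact: pihomogP.
by move=> Q /IF /vanishes_pihomog.
Qed.

Lemma closedI (Z1 Z2 : set (pspace K N)) :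
  zariski_closed Z1 -> zariski_closed Z2 -> zariski_closed (Z1 `&` Z2).
Proof.
move=> /closedP c1 /closedP c2; apply/closedP => P h.
by split; [apply: c1|apply: c2] => F IF; apply: h => Q [? ?]; exact: IF.
Qed.

Lemma closed_bigcap I (D : set I) (Z : I -> set (pspace K N)) :
  (forall i, D i -> zariski_closed (Z i)) -> zariski_closed (\bigcap_(i in D) Z i).
Proof.
move=> h; apply/closedP => P hP i Di; apply: (iffLR (closedP _) (h i Di)) => F IF.
by apply: hP => Q /(_ i Di) /IF.
Qed.

Lemma closed_zero_locus F : zariski_closed (zero_locus F).
Proof. by apply/closedP => P; apply. Qed.

Lemma irreducibleP (Z : set (pspace K N)) : irreducible_closed Z <->
  [/\ zariski_closed Z, Z !=set0 &
    forall F G, ideal_of Z (F * G) -> ideal_of Z F \/ ideal_of Z G].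
Proof.
split=> -[cZ neZ h]; split=> //.
- move=> F G IFG.
  have cF := closedI cZ (closed_zero_locus F).
  have cG := closedI cZ (closed_zero_locus G).
  have E : Z = (Z `&` zero_locus F) `|` (Z `&` zero_locus G).
    rewrite eqEsubset; split=> [P ZP|P [[]|[]]] //.
    by case/vanishesM: (IFG P ZP) => ?; [left|right].
  by have [{}E|{}E] := h _ _ cF cG E; [left|right] => P; rewrite E => -[].
- move=> Z1 Z2 c1 c2 E.
  have sub1 : Z1 `<=` Z by rewrite E => P; left.
  have sub2 : Z2 `<=` Z by rewrite E => P; right.
  have [[Z1Z|nZ1] [Z2Z|nZ2]] := (pselect (Z `<=` Z1), pselect (Z `<=` Z2)).
  + by left; rewrite eqEsubset; split.
  + by left; rewrite eqEsubset; split.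
  + by right; rewrite eqEsubset; split.
  + exfalso; move/existsNP: nZ1 => [P /not_implyP [ZP nP]].
    move/existsNP: nZ2 => [Q /not_implyP [ZQ nQ]].
    have [F [_ [IF _ nF]]] := closed_separate c1 nP.
    have [G [_ [IG _ nG]]] := closed_separate c2 nQ.
    have [R|/(_ P ZP)//|/(_ Q ZQ)//] := h F G.
    by rewrite E => -[/IF|/IG] ?; apply/vanishesM; [left|right].
Qed.

(** For all but finitely many a the combination F + a G vanishes neither where F does not nor where
    G does not. This replaces prime avoidance. *)
Lemma avoid_points (J : {mpoly K[N.+1]} -> Prop) (s : seq 'rV[K]_N.+1) :
  J 0 -> (forall a F G, J F -> J G -> J (F + a *: G)) ->
  (forall w, w \in s -> exists2 F, J F & ev w F != 0) ->
  exists2 F, J F & forall w, w \in s -> ev w F != 0.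
Proof.
move=> J0 JD; elim: s => [|w s IH] h; first by exists 0.
have [|F JF hF] := IH; first by move=> x xs; apply: h; rewrite inE xs orbT.
have [G JG wG] := h w (mem_head _ _).
pose p : {poly K} := \prod_(x <- w :: s) ((ev x F)%:P + ev x G *: 'X).
have p0 : p != 0.
  rewrite prodf_seq_neq0; apply/allP => x; rewrite inE => xs /=.
  apply/eqP => h0; case/orP: xs => [/eqP xw|/hF /eqP]; last first.
    by apply; have := congr1 (fun q : {poly K} => q`_0) h0;
      rewrite coefD coefC coefZ coefX mulr0 addr0 coef0.
  have := congr1 (fun q : {poly K} => q`_1) h0; rewrite coefD coefC coefZ coefX mulr1 add0r coef0.
  by rewrite xw => /eqP; rewrite (negPf wG).
have /closed_nonrootP [a] := p0; rewrite rootE horner_prod prodf_seq_neq0 => /allP ha.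
exists (F + a *: G); first exact: JD.
move=> x xs; have := ha x xs; rewrite hornerD hornerC hornerZ hornerX evD evZ.
by rewrite mulrC.
Qed.

End Points.
End Projective.

(** * Homogeneous polynomials in frame coordinates *)

Section PhiHomogeneous.
Variables (K : closedFieldType) (m : nat).
Variables (B : 'M[K]_(m, m.+1)) (v : 'rV[K]_m.+1).

(** The coefficient of index j has degree k - j. The factor X^j on the left avoids the subtraction,
    so that the case j > k is covered too, where the identity forces the coefficient to vanish. *)
Lemma coef_Phi_line F k y j : F \is k.-homog ->
  evline 0 y (Phi B v F)`_j * 'X^j = ev y (Phi B v F)`_j *: 'X^k.
Proof.
move=> /dhomog_ev hF; apply/eqP; rewrite -subr_eq0; apply: contraT => /closed_nonrootP [t].
rewrite rootE hornerD hornerN hornerM hornerZ !hornerXn evlineE add0r.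
have : map_poly (ev (t *: y)) (Phi B v F) \Po (t *: 'X) =
   t ^+ k *: map_poly (ev y) (Phi B v F).
  apply/eqP; rewrite -subr_eq0; apply: contraT => /closed_nonrootP [a].
  rewrite rootE hornerD hornerN hornerZ horner_comp hornerZ hornerX !PhiE.
  by rewrite -scalemxAl -scalerA -scalerDr (hF t (y *m B + a *: v)) subrr eqxx.
move/(congr1 (fun p : {poly K} => p`_j)); rewrite coefZ coef_map /= mulrC => <-.
suff -> : (map_poly (ev (t *: y)) (Phi B v F) \Po (t *: 'X))`_j =
    ev (t *: y) (Phi B v F)`_j * t ^+ j by rewrite subrr eqxx.
rewrite comp_polyE coef_sum.
have [lt|le] := ltnP j (size (map_poly (ev (t *: y)) (Phi B v F))).
  rewrite (bigD1 (Ordinal lt)) //= big1 => [|i ij].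
    by rewrite addr0 coefZ exprZn coefZ coefXn eqxx mulr1 coef_map.
  rewrite coefZ exprZn coefZ coefXn; case: eqP => [e|_]; last by rewrite !mulr0.
  by case/eqP: ij; apply: val_inj.
rewrite big1 => [|i _].
  have := nth_default 0 le; rewrite coef_map /= => ->.
  by rewrite mul0r.
rewrite coefZ exprZn coefZ coefXn; case: eqP => [e|_]; last by rewrite !mulr0.
by have := ltn_ord i; rewrite -e ltnNge le.
Qed.

Lemma coef_Phi_gt F k j : F \is k.-homog -> (k < j)%N -> (Phi B v F)`_j = 0.
Proof.
move=> hF kj; apply: ev_inj => y; rewrite rmorph0.
have /(congr1 (fun p : {poly K} => p`_k)) := coef_Phi_line y j hF.
by rewrite coefMXn kj coefZ coefXn eqxx mulr1 => <-.
Qed.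

Lemma coef_Phi_homog F k j : F \is k.-homog -> (j <= k)%N ->
  (Phi B v F)`_j \is (k - j).-homog.
Proof.
move=> hF jk; apply/dhomog_ev => t y.
have E : evline 0 y (Phi B v F)`_j = ev y (Phi B v F)`_j *: 'X^(k - j).
  apply: (mulIf (x := 'X^j)); first by rewrite -size_poly_eq0 size_polyXn.
  by rewrite (coef_Phi_line y j hF) -scalerAl -exprD subnK.
by rewrite -[t *: y]add0r -evlineE E hornerZ hornerXn mulrC.
Qed.

Lemma coef_Phi_top F k : F \is k.-homog -> (Phi B v F)`_k = (ev v F)%:MP.
Proof.
move=> hF; have h0 := coef_Phi_homog hF (leqnn k); rewrite subnn in h0.
apply: ev_inj => y; rewrite evC.
have <- : ev 0 (Phi B v F)`_k = ev y (Phi B v F)`_k.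
  have := iffLR (dhomog_ev _ _) h0 0 y.
  by rewrite scale0r expr0 mul1r.
suff : map_poly (ev 0) (Phi B v F) = ev v F *: 'X^k.
  by move/(congr1 (fun p : {poly K} => p`_k)); rewrite coef_map coefZ coefXn eqxx mulr1.
apply/eqP; rewrite -subr_eq0; apply: contraT => /closed_nonrootP [a].
rewrite rootE hornerD hornerN hornerZ hornerXn PhiE mul0mx add0r.
by rewrite (iffLR (dhomog_ev _ _) hF a v) mulrC subrr eqxx.
Qed.

Lemma size_Phi F k : F \is k.-homog -> ev v F != 0 -> size (Phi B v F) = k.+1.
Proof.
move=> hF Fv; apply/eqP; rewrite eqn_leq; apply/andP; split.
  by apply/leq_sizeP => j kj; exact: (coef_Phi_gt hF).
rewrite ltnNge; apply: contraNN Fv => le.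
have := nth_default 0 le; rewrite (coef_Phi_top hF) => /eqP.
by rewrite mpolyC_eq0.
Qed.

Lemma monic_Phi F k : F \is k.-homog -> ev v F = 1 -> Phi B v F \is monic.
Proof.
move=> hF Fv; rewrite monicE lead_coefE (size_Phi hF) ?Fv ?oner_eq0 //.
by rewrite (coef_Phi_top hF) Fv.
Qed.

End PhiHomogeneous.

(** * Projection of a closed set from a point outside it *)

Section Projection.
Variables (K : closedFieldType) (N : nat).
Variables (A : 'M[K]_(N.+2, N.+1)) (c : 'cV[K]_N.+2).
Variables (B : 'M[K]_(N.+1, N.+2)) (v0 : 'rV[K]_N.+2).
Hypothesis fr : frame A c B v0.
Variable P0 : pspace K N.+1.
Hypothesis onP0 : on P0 v0.
Implicit Types (Z : set (pspace K N.+1)) (W : set (pspace K N)).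

Definition proj (P : pspace K N.+1) (Q : pspace K N) :=
  exists2 v, on P v & on Q (v *m A).

Definition image Z : set (pspace K N) := [set Q | exists2 P, Z P & proj P Q].

Lemma proj_lift P Q y : proj P Q -> on Q y -> exists a, on P (y *m B + a *: v0).
Proof.
move=> [v vP vQ] yQ; have [a a0 yE] := on_proportional vQ yQ.
exists (((a *: v) *m c) 0 0); rewrite yE scalemxAl -(frame_point fr).
exact: on_scale.
Qed.

Lemma proj_point P Q y a : on Q y -> on P (y *m B + a *: v0) -> proj P Q.
Proof. by move=> yQ h; exists (y *m B + a *: v0); rewrite ?(frame_A fr). Qed.

Lemma lift_point y a : y != 0 -> exists P, on P (y *m B + a *: v0).
Proof.
move=> y0; apply: point_exists; apply: contraNneq y0 => h.
by rewrite -(frame_A fr y a) h mul0mx.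
Qed.

Section Closed.
Variable Z : set (pspace K N.+1).
Hypothesis cZ : zariski_closed Z.
Hypothesis nZ : ~ Z P0.

Lemma monic_equation : exists F, [/\ ideal_of Z F, Phi B v0 F \is monic &
  (1 < size (Phi B v0 F))%N].
Proof.
have [F [k [IF hF]]] := closed_separate cZ nZ.
move=> /(vanishes_homog onP0 hF) /eqP Fv0.
have [_ _ _ vc _] := fr.
(* The factor [lin c] keeps the degree positive even if Z is empty and F a nonzero constant. *)
have h1 : (ev v0 F)^-1 *: F * lin c \is (k + 1).-homog.
  by apply: dhomogM; [exact: rpredZ|exact: dhomog_lin].
have e1 : ev v0 ((ev v0 F)^-1 *: F * lin c) = 1.
  by rewrite evM evZ mulVf // mul1r ev_lin vc mxE eqxx.
exists ((ev v0 F)^-1 *: F * lin c); split.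
- by move=> P ZP; apply/vanishesM; left; apply/vanishesZ/IF.
- exact: monic_Phi h1 e1.
- by rewrite (size_Phi _ h1) ?e1 ?oner_eq0 // addn1.
Qed.

Lemma fiber_finite Q y : on Q y -> exists s : seq K, forall P, Z P -> proj P Q ->
  exists2 a, a \in s & on P (y *m B + a *: v0).
Proof.
move=> yQ; have [F [IF mF sF]] := monic_equation.
have [s Es] := closed_field_poly_normal (map_poly (ev y) (Phi B v0 F)).
exists s => P ZP PQ; have [a aP] := proj_lift PQ yQ; exists a => //.
have : root (map_poly (ev y) (Phi B v0 F)) a.
  by rewrite rootE PhiE; apply/eqP/(IF P ZP); case: aP.
rewrite Es rootZ ?root_prod_XsubC // lead_coef_eq0 -size_poly_eq0.
by rewrite size_map_poly_id0 ?(monicP mF) ?rmorph1 ?oner_eq0 // gtn_eqF // ltnW.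
Qed.

(** Over a point y outside the image, finitely many points satisfy the monic equation and none is in
    Z, so some G in the ideal of Z vanishes at none of them. Eliminating the fibre coordinate gives
    b in the ideal of the image; b(y) = 0 would produce a common root of the equation and G. *)
Lemma image_closed : zariski_closed (image Z).
Proof.
apply/closedP => Q hQ; apply: contrapT => nQ.
have [y yQ] := on_exists Q; have y0 : y != 0 by case: yQ.
have [F [IF mF sF]] := monic_equation.
have [s Es] := closed_field_poly_normal (map_poly (ev y) (Phi B v0 F)).
have [||w|G IG hG] := @avoid_points K N.+1 (ideal_of Z)
    [seq y *m B + a *: v0 | a <- s].
- by move=> P ZP w _; rewrite rmorph0.
- by move=> a F1 F2 I1 I2 P ZP; apply: vanishesD; [exact: I1|apply/vanishesZ/I2].
- move=> /mapP [a _ ->]; have [P aP] := lift_point a y0.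
  have nP : ~ Z P by move=> ZP; apply: nQ; exists P => //; exact: (proj_point yQ aP).
  have [G [k [IG hG nG]]] := closed_separate cZ nP.
  by exists G => //; apply: contra_notN nG => /eqP h; apply/(vanishes_homog aP hG).
have [b [u [w [bE hb]]]] := @elimination _ K _ (Phi B v0 G) mF sF.
have Ib : ideal_of (image Z) b.
  move=> Q' [P ZP PQ'] y' y'Q'.
  have [v vP vQ'] := PQ'; have /(on_mem _ vQ') [a y'E] := y'Q'.
  have mem : a *: v \in pline P by case: vP => vP _; rewrite memvZ.
  have wE := frame_point fr (a *: v).
  apply: (common_root (e := ev y') (a := ((a *: v) *m c) 0 0) bE).
    by rewrite rootE PhiE y'E scalemxAl -wE; apply/eqP/(IF P ZP).
  by rewrite rootE PhiE y'E scalemxAl -wE; apply/eqP/(IG P ZP).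
have by0 : ev y b = 0 by apply: (hQ b Ib); case: yQ.
have [a ra] := hb (ev y) by0; rewrite rootE PhiE => /eqP Ga.
have : a \in s.
  move: ra; rewrite Es rootZ ?root_prod_XsubC // lead_coef_eq0 -size_poly_eq0.
  by rewrite size_map_poly_id0 ?(monicP mF) ?rmorph1 ?oner_eq0 // gtn_eqF // ltnW.
by move=> as_; have := hG _ (map_f _ as_); rewrite Ga eqxx.
Qed.

End Closed.

(* Fibres are finite, so a minimal closed subset of Z lying over C exists;
   as images are closed, it is irreducible. *)
Lemma irreducible_lift Z C : zariski_closed Z -> ~ Z P0 -> irreducible_closed C ->
  C `<=` image Z ->
  exists D, [/\ irreducible_closed D, D `<=` Z & image D = C].
Proof.
move=> cZ nZ iC CZ; have [cC [Q0 CQ0] _] := iC.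
pose good D := [/\ zariski_closed D, D `<=` Z, image D `<=` C & C `<=` image D].
pose Y := Z `&` \bigcap_(b in ideal_of C) zero_locus (lsub A b).
have gY : good Y.
  have cY : zariski_closed Y.
    by apply: closedI => //; apply: closed_bigcap => b _; exact: closed_zero_locus.
  split=> //; first by move=> P [].
  - move=> Q [P [ZP hP] [v vP vQ]]; apply: (iffLR (closedP _) cC) => b Ib w.
    move=> /(on_mem _ vQ) [a ->]; rewrite scalemxAl.
    rewrite -/(ev (a *: v *m A) b) -ev_lsub; apply: (hP b Ib).
    by case: vP => vP _; rewrite memvZ.
  - move=> Q CQ; have [P ZP PQ] := CZ Q CQ; exists P => //; split=> // b Ib w wP.
    have [v vP vQ] := PQ; have /(on_mem _ vP) [a ->] := wP.
    rewrite -/(ev (a *: v) (lsub A b)) ev_lsub -scalemxAl; apply: (Ib Q CQ).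
    by case: vQ => vQ _; rewrite memvZ.
pose T := {D | good D}; pose R (D1 D2 : T) := `[< sval D2 `<=` sval D1 >].
have [D minD] : exists D : T, forall D', R D D' -> D' = D.
  apply: Zorn.
  - by move=> D; apply/asboolP.
  - by move=> D1 D2 D3 /asboolP h1 /asboolP h2; apply/asboolP => P /h2 /h1.
  - move=> [D1 g1] [D2 g2] /asboolP h1 /asboolP h2; apply: eq_exist => /=.
    by rewrite eqEsubset; split.
  - move=> S totS; have [[D1 SD1]|nS] := pselect (exists D, S D); last first.
      by exists (exist _ Y gY) => D SD; case: nS; exists D.
    have gI : good (\bigcap_(D in S) sval D).
      split.
      + by apply: closed_bigcap => D _; case: (svalP D).
      + by move=> P /(_ D1 SD1); case: (svalP D1) => _ h _ _ /h.
      + move=> Q [P hP PQ]; case: (svalP D1) => _ _ h _; apply: h.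
        by exists P => //; exact: hP.
      + move=> Q CQ; apply: contrapT => nQ.
        (* The intersection of the chain must still map onto C. If it missed the fibre over Q, each
           of the finitely many possible points would be missed by some member, and the smallest of
           these members would miss them all. *)
        have [y yQ] := on_exists Q; have [s hs] := fiber_finite cZ nZ yQ.
        have [D' SD' hD'] : exists2 D', S D' & forall a P, a \in s ->
            on P (y *m B + a *: v0) -> ~ sval D' P.
          elim: s {hs} => [|a s [D2 SD2 h2]]; first by exists D1.
          have [P aP] := lift_point a (proj2 yQ).
          have /existsNP [D3 /not_implyP [SD3 nD3]] :
              ~ (\bigcap_(D in S) sval D) P.
            by move=> hP; apply: nQ; exists P => //; exact: (proj_point yQ aP).
          have [/asboolP h|/asboolP h] := totS _ _ SD2 SD3.
            exists D3 => // b P'; rewrite inE => /orP[/eqP -> bP'|bs bP'].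
              by rewrite (on_inj bP' aP).
            by move=> /h; exact: (h2 _ _ bs bP').
          exists D2 => // b P'; rewrite inE => /orP[/eqP -> bP'|bs bP'].
            by rewrite (on_inj bP' aP) => /h.
          exact: (h2 _ _ bs bP').
        case: (svalP D') => _ DZ _ /(_ Q CQ) [P DP PQ].
        by have [a as_ aP] := hs P (DZ _ DP) PQ; exact: (hD' a P as_ aP).
    exists (exist _ _ gI) => D SD; apply/asboolP => /= P; exact.
case: D minD => D gD minD; have [cD DZ DC CD] := gD.
have {}minD D' : good D' -> D' `<=` D -> D' = D.
  move=> g' sub; have /minD : R (exist _ D gD) (exist _ D' g') by apply/asboolP.
  by case.
exists D; split=> //; last by rewrite eqEsubset; split.
split=> //; first by have [P DP _] := CD Q0 CQ0; exists P.
move=> Z1 Z2 c1 c2 DE.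
have s1 : Z1 `<=` D by rewrite DE => P; left.
have s2 : Z2 `<=` D by rewrite DE => P; right.
have n1 : ~ Z1 P0 by move=> /s1 /DZ.
have n2 : ~ Z2 P0 by move=> /s2 /DZ.
have i1 : image Z1 `<=` C by move=> Q [P /s1 DP PQ]; apply: DC; exists P.
have i2 : image Z2 `<=` C by move=> Q [P /s2 DP PQ]; apply: DC; exists P.
have CE : C = image Z1 `|` image Z2.
  rewrite eqEsubset; split=> [Q /CD [P DP PQ]|Q [/i1|/i2]] //.
  by move: DP; rewrite DE => -[?|?]; [left|right]; exists P.
case: iC => _ _ /(_ _ _ (image_closed c1 n1) (image_closed c2 n2) CE) [E|E].
- left; apply/esym/minD => //; split=> //; last by rewrite E.
  by move=> P /s1 /DZ.
- right; apply/esym/minD => //; split=> //; last by rewrite E.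
  by move=> P /s2 /DZ.
Qed.

(** Lifted from the top down: the largest set is lifted into Z, and the rest of the chain into that
    lift. Strictness is inherited because the images are distinct. *)
Lemma has_chain_lift Z W m : zariski_closed Z -> ~ Z P0 -> W `<=` image Z ->
  has_chain W m -> has_chain Z m.
Proof.
move=> cZ nZ WZ [C [hC sC]].
suff [D [hD sD _]] : exists D : nat -> set (pspace K N.+1),
    [/\ forall i, (i < m)%N -> irreducible_closed (D i) /\ D i `<=` Z,
    forall i, (i.+1 < m)%N -> D i `<` D i.+1 &
    forall i, (i < m)%N -> image (D i) = C i] by exists D.
have {W WZ hC} : forall i, (i < m)%N -> irreducible_closed (C i) /\ C i `<=` image Z.
  by move=> i /hC [? h]; split=> // P /h /WZ.
elim: m Z cZ nZ C sC => [|m IH] Z cZ nZ C sC hC; first by exists (fun=> set0).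
have [iC CZ] := hC m (leqnn _).
have [Dm [iD DZ DE]] := irreducible_lift cZ nZ iC CZ.
have [cD _ _] := iD.
have mono i : (i <= m)%N -> C i `<=` C m.
  move=> im; have : forall k, (i + k <= m)%N -> C i `<=` C (i + k)%N.
    elim=> [_|k IHk]; first by rewrite addn0.
    rewrite addnS => lt.
    exact: subset_trans (IHk (ltnW lt)) (properW (sC (i + k)%N lt)).
  by move=> /(_ (m - i)%N); rewrite subnKC // => /(_ (leqnn m)).
have [|||D [hD sD imD]] := IH Dm cD _ C.
- by move=> /DZ.
- by move=> i im; apply: sC; exact: ltnW.
- move=> i im; rewrite DE; split; last by apply: mono; exact: ltnW.
  by have [] := hC i (ltnW im).
exists (fun i => if i == m then Dm else D i); split=> [i|i|i].
- rewrite ltnS leq_eqVlt; case: eqP => [//|_ /= im].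
  by have [? h] := hD i im; split=> // P /h /DZ.
- rewrite ltnS => im; rewrite ltn_eqF //; case: eqP => [im1|/eqP nim]; last first.
    by apply: sD; rewrite ltn_neqAle nim.
  have [_ sub] := hD i im; rewrite properEneq; split=> //; apply/eqP => E.
  have := sC i; rewrite im1 ltnSn => /(_ isT).
  by rewrite -(imD i im) E DE properEneq eqxx => -[].
- rewrite ltnS leq_eqVlt; case: eqP => [-> //|_ /= im]; exact: imD.
Qed.

End Projection.

Section Chains.
Variable K : closedFieldType.

Definition trunc_mx N (j : nat) : 'M[K]_N.+1 :=
  \matrix_(i, k) ((i == k) && (i <= j)%N)%:R.

Lemma mul_trunc N j (v : 'rV[K]_N.+1) i :
  (v *m trunc_mx N j) 0 i = if (i <= j)%N then v 0 i else 0.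
Proof.
rewrite mxE (bigD1 i) //= big1 => [|k ki].
  by rewrite mxE eqxx addr0 /=; case: leqP => _; rewrite ?mulr1 ?mulr0.
by rewrite mxE (negPf ki) mulr0.
Qed.

(** The chain of coordinate subspaces x_(j+1) = ... = x_N = 0; the ideal of each is the kernel of a
    substitution into a domain, hence prime. *)
Lemma has_chain_setT N : has_chain [set: pspace K N] N.+1.
Proof.
pose L (j : nat) : set (pspace K N) :=
  [set P | forall i : 'I_N.+1, (j < i)%N -> vanishes_at 'X_i P].
have LP j P v : on P v -> L j P <-> v *m trunc_mx N j = v.
  move=> vP; split=> [h|h i ji].
    apply/rowP => i; rewrite mul_trunc; case: leqP => // ji.
    have := h i ji v (proj1 vP); rewrite -/(ev v _) evX => -> //.
  have hX : ('X_i : {mpoly K[N.+1]}) \is 1.-homog.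
    by rewrite dhomogX /= mdeg1.
  apply/(vanishes_homog vP hX); rewrite evX -h mul_trunc leqNgt ji //.
have proj_L j (v : 'rV[K]_N.+1) : v *m trunc_mx N j *m trunc_mx N j = v *m trunc_mx N j.
  by apply/rowP => i; rewrite !mul_trunc; case: leqP.
have e0 i : delta_mx 0 i != 0 :> 'rV[K]_N.+1.
  by apply/eqP => /matrixP /(_ 0 i) /eqP; rewrite !mxE !eqxx oner_eq0.
have Le j i P : on P (delta_mx 0 i) -> (i <= j)%N -> L j P.
  move=> iP ij; apply/(LP _ _ _ iP)/rowP => k; rewrite mul_trunc !mxE eqxx /=.
  by case: leqP => //; case: eqP => // -> ; rewrite ltnNge ij.
have idL j F : ideal_of (L j) F <-> lsub (trunc_mx N j) F = 0.
  split=> [h|h P /= LjP v vP].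
    apply: ev_inj => v; rewrite ev_lsub rmorph0.
    have [z|nz] := eqVneq (v *m trunc_mx N j) 0.
      have [P oP] := point_exists (e0 ord0).
      have := h P (Le j _ _ oP (leq0n _)) 0; rewrite z; apply; exact: mem0v.
    have [P oP] := point_exists nz.
    have LPj : L j P by apply/(LP _ _ _ oP).
    exact: h P LPj _ (proj1 oP).
  have [w wP] := on_exists P; have /(on_mem _ wP) [a ->] := vP.
  rewrite -/(ev _ F) -(iffLR (LP _ _ _ wP) LjP) scalemxAl -ev_lsub h rmorph0 //.
exists L; split=> [i iN|i iN].
  split=> //; apply/irreducibleP; split.
  - apply/closedP => P h k ik; apply: h => Q; exact.
  - by have [P oP] := point_exists (e0 ord0); exists P; apply: (Le _ _ _ oP).
  - move=> F G; rewrite !idL rmorphM => /eqP; rewrite mulf_eq0.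
    by case/orP => /eqP; [left|right].
rewrite properEneq; split; last by move=> P LP' k ik; apply: LP'; exact: ltnW.
apply/eqP => E; have [P oP] := point_exists (e0 (Ordinal iN)).
have := Le i.+1 _ _ oP (leqnn _); rewrite -E => /(LP _ _ _ oP) /rowP /(_ (Ordinal iN)).
by rewrite mul_trunc /= ltnn mxE !eqxx => /eqP; rewrite eq_sym oner_eq0.
Qed.

(** Projection from a point off h = 0 maps this hypersurface onto P^N, whose chain is lifted. *)
Lemma has_chain_zero_locus N k (h : {mpoly K[N.+2]}) :
  h != 0 -> h \is k.+1.-homog -> has_chain (zero_locus h) N.+1.
Proof.
move=> h0 hh; have [v hv] := mpoly_nonroot h0.
have v0 : v != 0.
  apply: contraNneq hv => ->; have := iffLR (dhomog_ev _ _) hh 0 0.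
  by rewrite scale0r expr0n mul0r => ->.
have [c vc] := dual_vector v0; have [A [B fr]] := frame_exists vc.
have [P0 oP0] := point_exists v0.
apply: (has_chain_lift fr oP0 (closed_zero_locus h) _ _ (@has_chain_setT N)).
  by move=> /(vanishes_homog oP0 hh) /eqP; rewrite (negPf hv).
move=> Q _; have [y yQ] := on_exists Q.
pose p := map_poly (ev y) (Phi B v h).
have sp : size p != 1%N.
  have lp : lead_coef (Phi B v h) = (ev v h)%:MP.
    by rewrite lead_coefE (size_Phi _ hh) //= (coef_Phi_top _ _ hh).
  by rewrite size_map_poly_id0 ?(size_Phi _ hh) // lp /= evC.
have /closed_rootP [a] := sp; rewrite rootE PhiE => /eqP ra.
have [P oP] := lift_point fr a (proj2 yQ).
exists P; last exact: (proj_point fr yQ oP).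
by apply/(vanishes_homog oP hh).
Qed.

End Chains.

Section Homogeneous.
Variables (K : closedFieldType) (n : nat).
Implicit Types (F G : {mpoly K[n]}).

Lemma pihomogM_dvd F u d j : F \is d.-homog -> rdvd F (pihomog mdeg j (u * F)).
Proof.
move=> hF; rewrite {1}(@pihomog_partitionE _ _ mdeg (msize u) u) // mulr_suml raddf_sum.
apply: rdvd_sum => i _ /=.
have hM : pihomog mdeg i u * F \is (i + d).-homog by apply: dhomogM; rewrite ?pihomogP.
have [e|ne] := eqVneq (i + d)%N j.
  by rewrite pihomog_dE -?e //; exists (pihomog mdeg i u).
by rewrite (pihomog_ne0 ne hM); exact: rdvd0.
Qed.

Lemma pihomogM F G d e : F \is d.-homog -> pihomog mdeg (e + d) (G * F) = pihomog mdeg e G * F.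
Proof.
move=> hF; pose k := maxn e.+1 (msize G).
have ek : (e < k)%N by rewrite leq_max leqnn.
rewrite {1}(@pihomog_partitionE _ _ mdeg k G) ?leq_maxr // mulr_suml raddf_sum.
have hM i : pihomog mdeg i G * F \is (i + d).-homog by apply: dhomogM; rewrite ?pihomogP.
rewrite (bigD1 (Ordinal ek)) //= big1 => [|i ie]; first by rewrite addr0 pihomog_dE.
rewrite (@pihomog_ne0 _ _ _ (i + d)%N) //; apply: contraNneq ie => /addIn e'.
by apply/eqP/val_inj.
Qed.

Definition dilate : {mpoly K[n]} -> {poly {mpoly K[n]}} :=
  mmap (polyC \o @mpolyC n K) (fun i => 'X_i *: 'X).
HB.instance Definition _ := GRing.RMorphism.copy dilate
  (mmap (polyC \o @mpolyC n K) (fun i => 'X_i *: 'X)).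

Lemma dilateE F v t : (map_poly (ev v) (dilate F)).[t] = ev (t *: v) F.
Proof.
suff: horner_eval t \o map_poly (ev v) \o dilate =1 ev (t *: v) by apply.
apply: mpoly_rmorph_eq => [b|i]; rewrite /= /horner_eval.
  by rewrite /dilate mmapC map_polyC hornerC /= !evC.
rewrite /dilate mmapX mmap1U map_polyZ map_polyX hornerZ hornerX /= !evX.
by rewrite mxE mulrC.
Qed.

(** Write F(tx) = t^a f and G(tx) = t^b g with f, g nonzero at t = 0. Then f g t^(a+b) = F G t^k, so
    f g is constant in t, hence so is f. *)
Lemma homog_factor F G k : F * G \is k.-homog -> F * G != 0 ->
  exists j, F \is j.-homog.
Proof.
move=> hk nz; have dE : dilate (F * G) = (F * G) *: 'X^k.
  have E v t : (map_poly (ev v) (dilate (F * G))).[t] = (map_poly (ev v) ((F * G) *: 'X^k)).[t].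
    rewrite dilateE map_polyZ map_polyXn hornerZ hornerXn [RHS]mulrC.
    exact: (iffLR (dhomog_ev _ _) hk t v).
  have {}E v : map_poly (ev v) (dilate (F * G)) =
               map_poly (ev v) ((F * G) *: 'X^k).
    apply/eqP; rewrite -subr_eq0; apply: contraT => /closed_nonrootP [t].
    by rewrite rootE hornerD hornerN E subrr eqxx.
  by apply/polyP => i; apply: ev_inj => v; rewrite -!(coef_map (ev v)) E.
have [F0 G0] : F != 0 /\ G != 0 by move: nz; rewrite mulf_eq0 negb_or => /andP.
have dn0 H : H != 0 -> dilate H != 0.
  move=> H0; have [v hv] := mpoly_nonroot H0; apply: contraNneq hv => h.
  by rewrite -[v]scale1r -dilateE h rmorph0 horner0.
have [a [f f0 fE]] := multiplicity_XsubC (dilate F) 0.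
have [b [g g0 gE]] := multiplicity_XsubC (dilate G) 0.
rewrite dn0 //= in f0; rewrite dn0 //= in g0.
move: dE; rewrite rmorphM /= fE gE !subr0 => dE.
have E : (f * g) * 'X^(a + b) = (F * G)%:P * 'X^k.
  by rewrite mul_polyC -dE exprD; ring.
have fg0 : (f * g)`_0 != 0.
  rewrite coef0M mulf_eq0 negb_or -!horner_coef0 -!rootE.
  by rewrite f0 g0.
have abk : (a + b)%N = k.
  apply/eqP; rewrite eqn_leq; apply/andP; split; rewrite leqNgt; apply/negP => lt.
    have := congr1 (fun p : {poly _} => p`_k) E; rewrite !coefMXn lt ltnn subnn coefC.
    by move/esym/eqP; rewrite (negPf nz).
  have := congr1 (fun p : {poly _} => p`_(a + b)) E; rewrite !coefMXn lt ltnn subnn.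
  by move/eqP; rewrite (negPf fg0).
have : f * g = (F * G)%:P.
  rewrite abk in E; apply: (mulIf _ E).
  by rewrite -size_poly_eq0 size_polyXn.
move/(congr1 (fun p : {poly _} => size p)); rewrite size_polyC nz.
have f00 : f != 0 by apply: contraNneq f0 => ->; rewrite root0.
have g00 : g != 0 by apply: contraNneq g0 => ->; rewrite root0.
rewrite size_mul // => sfg.
have sf : (size f <= 1)%N.
  move: f00 g00 sfg; rewrite -!size_poly_gt0.
  by move: (size f) (size g) => i j /=; lia.
have E1 s v : ev (s *: v) F = s ^+ a * ev v f`_0.
  rewrite -dilateE fE (size1_polyC sf) subr0 mul_polyC map_polyZ map_polyXn.
  by rewrite hornerZ hornerXn coefC /= mulrC.
exists a; apply/dhomog_ev => t v.
by rewrite E1 -{2}(scale1r v) E1 expr1n mul1r.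
Qed.

Lemma homog1_lin F : F \is 1.-homog -> exists c, F = lin c.
Proof.
move=> hF; exists (\col_i F@_U_(i)); apply/mpolyP => m.
have [/mdeg1P [i /eqP ->]|m1] := boolP (mdeg m == 1%N); last first.
  by rewrite (dhomog_nemf_coeff hF m1) (dhomog_nemf_coeff (dhomog_lin _) m1).
rewrite /lin raddf_sum (bigD1 i) //= big1 => [|j ji].
  by rewrite addr0 mcoeffZ mcoeffX eqxx mulr1 mxE.
rewrite mcoeffZ mcoeffX (_ : (_ == _) = false) ?mulr0 //; apply: contraNF ji.
by move=> /eqP /mnmP /(_ j); rewrite !mnm1E eqxx eq_sym; case: eqP.
Qed.

End Homogeneous.

(** Over the fraction field of S, p and g are coprime: a nonconstant common divisor D has c p = q D,
    and the prime p divides q, impossible by degree, or D, hence a multiple e g with e a nonzero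
    constant. *)
Lemma bezout_const (S : idomainType) (p g : {poly S}) :
  p \is monic -> prime_elt p -> (1 < size p)%N -> ~ rdvd p g ->
  exists b u w, b != 0 /\ b%:P = u * p + w * g.
Proof.
move=> mp [p0 _ pp] sp pg.
have pC (c : S) : c != 0 -> ~ rdvd p c%:P.
  move=> c0 [q cE]; have := congr1 (fun r : {poly S} => size r) cE.
  rewrite size_polyC c0 /=; have [->|q0] := eqVneq q 0.
    by rewrite mul0r size_poly0.
  rewrite size_mul //; move: q0 sp; rewrite -size_poly_gt0.
  by move: (size q) (size p) => i j; lia.
have [cop|] := boolP (coprimep p g).
  have /Pdiv.Idomain.Bezout_coprimepP [[u w] /=] := cop.
  rewrite -size_poly_eq1 => /size_poly1P [b b0 bE].
  by exists b, u, w.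
rewrite /coprimep => sD; exfalso; set D := gcdp p g in sD.
have [D0 Dp Dg] : [/\ D != 0, Pdiv.Idomain.dvdp D p & Pdiv.Idomain.dvdp D g].
  by split; rewrite ?dvdp_gcdl ?dvdp_gcdr // gcdp_eq0 negb_and p0.
have /Pdiv.Idomain.dvdpP [[c q] /= c0 cE] := Dp.
have /Pdiv.Idomain.dvdpP [[e r] /= e0 eE] := Dg.
have : rdvd p (q * D) by rewrite -cE -mul_polyC; exists c%:P.
case/pp => [[x qE]|[x DE]].
  have x0 : x != 0.
    apply: contraNneq p0 => x0; move: cE; rewrite -mul_polyC qE x0 !mul0r.
    by move/eqP; rewrite mulf_eq0 polyC_eq0 (negPf c0).
  have : c%:P * p = (x * D) * p by rewrite mul_polyC cE qE; ring.
  move/(mulIf p0)/(congr1 (fun r : {poly S} => size r)).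
  rewrite size_polyC c0 size_mul //; move: sD x0 D0; rewrite -!size_poly_gt0.
  by move: (size x) (size D) => i j /=; lia.
have : rdvd p (e%:P * g).
  by rewrite mul_polyC eE DE; exists (r * x); rewrite mulrA.
by case/pp => // /(pC _ e0).
Qed.

(** * The coordinate ring of a hypersurface *)

Section Hypersurface.
Variables (K : closedFieldType) (n d : nat) (X : hypersurface K n d).
Local Notation F := (heq X).

Lemma coord_pi_eq0 G : coord_pi X G = 0 <-> rdvd F G.
Proof.
rewrite -(rmorph0 (coord_pi X)); split=> [/eqP|h].
  by rewrite -Quotient.idealrBE subr0 => /asboolP.
by apply/eqP; rewrite -Quotient.idealrBE subr0; apply/asboolP.
Qed.

Lemma heq_unit : F \isn't a GRing.unit.
Proof.
apply/negP => /unitrP [u [uF _]]; apply: (@heq_proper _ _ _ X).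
by exists u; rewrite uF.
Qed.

Lemma heq_prime_elt : prime_elt F.
Proof. split; [exact: heq_neq0|exact: heq_unit|exact: heq_prime]. Qed.

Variables (A : 'M[K]_(n.+2, n.+1)) (c : 'cV[K]_n.+2).
Variables (B : 'M[K]_(n.+1, n.+2)) (v : 'rV[K]_n.+2).
Hypothesis fr : frame A c B v.
Hypothesis Fv : ev v F != 0.
Hypothesis d_gt0 : (0 < d)%N.

Definition heq1 : {mpoly K[n.+2]} := (ev v F)^-1 *: F.
Local Notation F1 := heq1.
Definition hpoly : {poly {mpoly K[n.+1]}} := Phi B v F1.
Local Notation Ft := hpoly.

Lemma heq1_homog : F1 \is d.-homog.
Proof. by apply: rpredZ; exact: heq_homog. Qed.

Lemma heq1_v : ev v F1 = 1. Proof. by rewrite evZ mulVf. Qed.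

Lemma hpoly_monic : Ft \is monic.
Proof. exact: monic_Phi heq1_homog heq1_v. Qed.

Lemma hpoly_size : size Ft = d.+1.
Proof. by apply: (size_Phi _ heq1_homog); rewrite heq1_v oner_eq0. Qed.

Lemma Phi_dvd G : rdvd Ft (Phi B v G) <-> rdvd F G.
Proof.
split=> [[q qE]|[q ->]].
  exists (Psi A c q * (ev v F)^-1%:MP); rewrite -mulrA mul_mpolyC -/heq1.
  by rewrite -[G](PhiK fr) qE rmorphM /= (PhiK fr).
exists (Phi B v (q * (ev v F)%:MP)); rewrite -rmorphM /heq1 -mul_mpolyC.
congr (Phi _ _ _); rewrite mulrA -[q * _ * _]mulrA -mpolyCM mulfV //.
by rewrite mpolyC1 mulr1.
Qed.

Lemma hpoly_dvd p : rdvd Ft p <-> rdvd F (Psi A c p).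
Proof. by rewrite -Phi_dvd (PsiK fr). Qed.

Lemma hpoly_prime : prime_elt Ft.
Proof.
have [_ uF pF] := heq_prime_elt; split.
- exact/monic_neq0/hpoly_monic.
- by rewrite poly_unitE hpoly_size; case: d d_gt0.
- move=> a b /hpoly_dvd; rewrite rmorphM => /pF [] h; [left|right]; by rewrite hpoly_dvd.
Qed.

Lemma eval_norm G : ~ rdvd F G -> exists b u w, b != 0 /\
  b%:P = u * Ft + w * Phi B v G.
Proof.
move=> nG; apply: bezout_const; [exact: hpoly_monic|exact: hpoly_prime| |].
  by rewrite hpoly_size.
by rewrite Phi_dvd.
Qed.

(** [b] plays the part of the norm of G: it exchanges a denominator G for one coming from the base
    of the projection. *)
Lemma eval_norm_lsub G : ~ rdvd F G -> exists b u w, b != 0 /\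
  lsub A b = u * F + w * G.
Proof.
move=> /eval_norm [b [u [w [b0 bE]]]].
have E1 : Psi A c Ft = F1 by exact: (PhiK fr).
have E2 := PsiD A c (u * Ft) (w * Phi B v G).
have E3 := PsiM A c u Ft; have E4 := PsiM A c w (Phi B v G).
rewrite -bE PsiC in E2; rewrite {}E1 in E3; rewrite (PhiK fr) in E4.
move: (Psi A c u) (Psi A c w) E3 E4 => u' w' E3 E4.
exists b, (u' * (ev v F)^-1%:MP), w'; split=> //.
have -> : u' * (ev v F)^-1%:MP * F = u' * F1 by rewrite -mulrA mul_mpolyC.
by apply: (etrans E2); congr (_ + _); [exact: E3|exact: E4].
Qed.

Lemma hpoly_root y a : root (map_poly (ev y) Ft) a <-> ev (y *m B + a *: v) F = 0.
Proof.
rewrite rootE PhiE evZ mulf_eq0 invr_eq0 (negPf Fv) /=.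
by split=> /eqP.
Qed.

(** Otherwise some nonzero b of the base ring lies in (F, G). Over a point y with b(y) nonzero there
    is a point of X, where G vanishes, a contradiction. *)
Lemma nullstellensatz G : (forall w, ev w F = 0 -> ev w G = 0) -> rdvd F G.
Proof.
move=> h; apply: contrapT => /eval_norm [b [u [w [b0 bE]]]].
have [y yb] := mpoly_nonroot b0.
have /closed_rootP [a ra] : size (map_poly (ev y) Ft) != 1%N.
  rewrite size_map_poly_id0 ?hpoly_size ?(monicP hpoly_monic) ?rmorph1 ?oner_eq0 //.
  by case: d d_gt0.
case/eqP: yb; apply: (common_root bE ra).
by rewrite rootE PhiE; apply/eqP/h/hpoly_root.
Qed.

Local Notation "x %:F" := (@FracField.tofrac (coord_ring X) x).

(** The target is the whole fraction field of the homogeneous coordinate ring: the roots of the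
    equation have degree 1, so they lie outside the degree 0 part [funfield X]. *)
Definition htheta : {poly {mpoly K[n.+1]}} -> {fraction (coord_ring X)} :=
  @FracField.tofrac (coord_ring X) \o coord_pi X \o Psi A c.
HB.instance Definition _ := GRing.RMorphism.copy htheta
  (@FracField.tofrac (coord_ring X) \o coord_pi X \o Psi A c).
Local Notation theta := htheta.

Lemma thetaE p : theta p = (coord_pi X (Psi A c p))%:F. Proof. by []. Qed.

Lemma theta_Phi G : theta (Phi B v G) = (coord_pi X G)%:F.
Proof. by rewrite thetaE (PhiK fr). Qed.

Lemma theta_eq0 p : theta p = 0 <-> rdvd Ft p.
Proof.
rewrite hpoly_dvd -coord_pi_eq0 thetaE; split=> [/eqP|->]; last exact: tofrac0.
by rewrite tofrac_eq0 => /eqP.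
Qed.

Lemma theta_polyC_neq0 (b : {mpoly K[n.+1]}) : b != 0 -> theta b%:P != 0.
Proof.
move=> b0; apply/eqP => /theta_eq0 [q bE].
have := congr1 (fun r : {poly _} => size r) bE; rewrite size_polyC b0 /=.
have [->|q0] := eqVneq q 0; first by rewrite mul0r size_poly0.
rewrite size_mul ?(monic_neq0 hpoly_monic) // hpoly_size.
by move: q0 d_gt0; rewrite -size_poly_gt0; move: (size q) => i; lia.
Qed.

Definition hroot (x : {fraction (coord_ring X)}) :=
  root (map_poly (theta \o polyC) Ft) x.

Lemma hroot_integral x : hroot x -> integral_elt theta x.
Proof.
move=> rx; apply: (@integral_root _ _ theta (map_poly polyC Ft)).
  exact/monic_map/hpoly_monic.
by rewrite -map_poly_comp.
Qed.

Lemma hsing_closed : zariski_closed (hsing X).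
Proof.
apply/closedP => P h; split.
  by apply: h => Q [].
by move=> i; apply: h => Q [_ /(_ i)].
Qed.

Lemma hpoints_ev P w : on P w -> hpoints X P <-> ev w F = 0.
Proof. by move=> oP; apply: (vanishes_homog oP); exact: heq_homog. Qed.

Lemma mderiv_homog k i (G : {mpoly K[n.+2]}) : G \is k.+1.-homog -> G^`M(i) \is k.-homog.
Proof.
move=> hG; apply/dhomogP => m; rewrite mcoeff_msupp mcoeff_mderiv => nz.
have : G@_(m + U_(i)) != 0 by apply: contraNneq nz => ->; rewrite mul0rn.
rewrite -mcoeff_msupp => /(dhomog_mf hG) /=.
by rewrite mdegD mdeg1 addn1 => -[].
Qed.

Lemma hsing_ev P w : on P w ->
  hsing X P <-> ev w F = 0 /\ forall i, ev w F^`M(i) = 0.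
Proof.
move=> oP; rewrite /hsing /= (hpoints_ev oP).
have hd i : F^`M(i) \is d.-1.-homog.
  by apply: mderiv_homog; rewrite prednK //; exact: heq_homog.
by split=> -[h1 h2]; split=> // i; apply/(vanishes_homog oP (hd i)); exact: h2.
Qed.

(** If no point over y were singular, some G in [pp] would vanish at no point of the fibre.
    Eliminating t from F and G leaves b in [pp] free of t, hence divisible by h, so b(y) = 0 and G
    does vanish on the fibre. *)
Lemma singular_lift h (pp : {poly {mpoly K[n.+1]}} -> Prop) (y : 'rV[K]_n.+1) :
  (forall a b, pp a -> pp b -> pp (a + b)) -> (forall a b, pp b -> pp (a * b)) ->
  (forall a, pp a%:P -> rdvd h a) -> pp Ft ->
  (forall delta, derivation delta -> pp (delta Ft)) -> ev y h = 0 ->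
  exists2 a, ev (y *m B + a *: v) F = 0 &
    forall i, ev (y *m B + a *: v) F^`M(i) = 0.
Proof.
move=> ppD ppM pph ppF ppd yh; apply: contrapT => nex.
have sF : (1 < size Ft)%N by rewrite hpoly_size.
have [s Es] := closed_field_poly_normal (map_poly (ev y) Ft).
have memS a : root (map_poly (ev y) Ft) a -> a \in s.
  rewrite Es rootZ ?root_prod_XsubC // lead_coef_eq0 -size_poly_eq0.
  by rewrite size_map_poly_id0 ?(monicP hpoly_monic) ?rmorph1 ?oner_eq0 // gtn_eqF // ltnW.
have Smem a : a \in s -> root (map_poly (ev y) Ft) a.
  by move=> as_; rewrite Es rootE hornerZ; apply/eqP; rewrite (_ : _.[a] = 0) ?mulr0 //;
    apply/rootP; rewrite root_prod_XsubC.
have [||w|G JG hG] := @avoid_points K n.+1 (fun G => pp (Phi B v G))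
    [seq y *m B + a *: v | a <- s].
- by rewrite rmorph0 -[0](mul0r Ft); exact: (ppM).
- move=> a G H hG hH; rewrite (rmorphD (Phi B v)); apply: (ppD _ _ hG).
  rewrite -mul_mpolyC (rmorphM (Phi B v)); exact: (ppM _ _ hH).
- move=> /mapP [a as_ ->].
  have Fa : ev (y *m B + a *: v) F = 0 by apply/hpoly_root/Smem.
  have /existsNP [i ni] : ~ forall i, ev (y *m B + a *: v) F^`M(i) = 0.
    by move=> hi; apply: nex; exists a.
  exists F1^`M(i); last first.
    by rewrite /heq1 mderivZ evZ mulf_neq0 ?invr_eq0 //; apply/eqP.
  (* The i-th partial derivative of K[x], transported to S[t]. *)
  have der : derivation (fun p => Phi B v (Psi A c p)^`M(i)).
    split=> p q; first by rewrite (rmorphD (Psi A c)) mderivD (rmorphD (Phi B v)).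
    rewrite (rmorphM (Psi A c)) mderivM (rmorphD (Phi B v)) !(rmorphM (Phi B v)).
    by rewrite /= !(PsiK fr).
  by have := ppd _ der; rewrite /= {1}/hpoly (PhiK fr).
have [b [u [w [bE hb]]]] := @elimination _ K _ (Phi B v G) hpoly_monic sF.
have [q bq] : rdvd h b.
  by apply: pph; rewrite bE; apply: (ppD); exact: (ppM).
have by0 : ev y b = 0 by rewrite bq evM yh mulr0.
have [a ra] := hb (ev y) by0; rewrite rootE PhiE => /eqP Ga.
by have := hG _ (map_f _ (memS a ra)); rewrite Ga eqxx.
Qed.

End Hypersurface.

(** * Roots in the fraction field are linear forms, for X of dimension N + 1 *)

Section RootsLinear.
Variables (K : closedFieldType) (N d : nat) (X : hypersurface K N.+1 d).
Variables (A : 'M[K]_(N.+3, N.+2)) (c : 'cV[K]_N.+3).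
Variables (B : 'M[K]_(N.+2, N.+3)) (v : 'rV[K]_N.+3).
Hypothesis fr : frame A c B v.
Hypothesis Fv : ev v (heq X) != 0.
Hypothesis d_gt0 : (0 < d)%N.
Hypothesis sing_small : ~ has_chain (hsing X) N.+1.
Local Notation F := (heq X).
Local Notation theta := (htheta X A c).
Local Notation "x %:F" := (@FracField.tofrac (coord_ring X) x).

(* If x were not polynomial, singular_prime would give a hypersurface h = 0 of
   the base over which every point lifts to a singular point of X, so Sing X
   would have codimension one in X. *)
Lemma root_polynomial k (L G H : {mpoly K[N.+3]}) x :
  L \is 1.-homog -> G \is k.-homog -> H \is k.-homog -> coord_pi X H != 0 ->
  x * (coord_pi X H)%:F = (coord_pi X (L * G))%:F -> hroot A c B v x ->
  exists r, x = theta r.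
Proof.
move=> hL hG hH H0 xE rx.
have nH : ~ rdvd F H by rewrite -coord_pi_eq0; exact/eqP.
have [b [u [w [b0 bE]]]] := eval_norm_lsub fr Fv d_gt0 nH.
(* A homogeneous component D of b is still a multiple of H modulo F, because F and H are
   homogeneous. Being homogeneous, D has homogeneous prime factors, which define projective
   hypersurfaces. *)
have [j bj] : exists j, pihomog mdeg j b != 0.
  apply: contrapT => /forallNP h; case/eqP: b0.
  rewrite (@pihomog_partitionE _ _ mdeg (msize b) b) // big1 // => i _.
  by apply/eqP; apply: contrapT => /negP; exact: h.
pose D := pihomog mdeg j b.
have [w' Dw] : exists w', rdvd F (lsub A D - w' * H).
  have : lsub A D = pihomog mdeg j (lsub A b).
    have hb i : lsub A (pihomog mdeg i b) \is i.-homog.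
      exact: (dhomog_lsub A (pihomogP mdeg i b)).
    have bS : lsub A b = \sum_(i < maxn j.+1 (msize b)) lsub A (pihomog mdeg i b).
      rewrite -(raddf_sum (lsub A)); congr (lsub A _).
      by apply: pihomog_partitionE; rewrite leq_maxr.
    have jm : (j < maxn j.+1 (msize b))%N by rewrite leq_max leqnn.
    rewrite bS [RHS](raddf_sum (pihomog mdeg j)) (bigD1 (Ordinal jm)) //= big1 ?addr0 => [|i ij].
      by rewrite (pihomog_dE (hb j)).
    by rewrite (pihomog_ne0 _ (hb i)).
  rewrite bE pihomogD => ->.
  have [z zE] : rdvd H (pihomog mdeg j (w * H)) by exact: pihomogM_dvd hH.
  by exists z; rewrite zE addrK; exact: (pihomogM_dvd _ _ (heq_homog X)).
have D0 : D != 0 by [].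
have xD : theta D%:P * x = theta (Phi B v (w' * (L * G))).
  rewrite theta_Phi // thetaE PsiC.
  have HF0 : (coord_pi X H)%:F != 0 by rewrite tofrac_eq0.
  apply: (mulIf HF0); rewrite -mulrA xE -!tofracM -!rmorphM; congr (_%:F).
  apply/eqP; rewrite -subr_eq0 -rmorphB; apply/eqP/coord_pi_eq0.
  have -> : lsub A D * (L * G) - w' * (L * G) * H = (lsub A D - w' * H) * (L * G).
    by ring.
  exact: rdvd_mulr.
have ix := hroot_integral Fv rx.
have [//|[h [prh hD [pp [ppD ppM pph ppF ppd]]]]] :=
  normal_or_singular (@ufd_mpoly K _) (hpoly_monic B Fv)
    (theta_eq0 fr Fv) ix D0 xD.
(* Sing X maps onto a set containing the hypersurface h = 0 of P^(N+1), which carries a chain of N +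
   1 sets. *)
exfalso; apply: sing_small.
have [h0 uh _] := prh.
have [q DE] := hD.
have [e he] : exists e, h \is e.-homog.
  by apply: (@homog_factor _ _ h q j); rewrite mulrC -DE //; apply: pihomogP.
have {e he} [e he] : exists e, h \is e.+1.-homog.
  case: e he => [he|e he]; last by exists e.
  exfalso; case/negP: uh.
  have hE : h = (ev 0 h)%:MP.
    apply: ev_inj => y; rewrite evC.
    have := iffLR (dhomog_ev _ _) he 0 y; rewrite scale0r expr0 mul1r => -> //.
  have : ev 0 h != 0 by apply: contraNneq h0 => z; rewrite hE z mpolyC0.
  by rewrite -unitfE => uz; rewrite hE; exact: (rmorph_unit (@mpolyC N.+2 K)).
have v0 : v != 0 by apply/eqP => v0; case: fr => _ _ _; rewrite v0 mul0mx => /matrixP /(_ 0 0) /eqP; rewrite !mxE eq_sym oner_eq0.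
have [P0 oP0] := point_exists v0.
apply: (has_chain_lift fr oP0 (hsing_closed X) _ _ (has_chain_zero_locus h0 he)).
  by move=> /(hsing_ev X d_gt0 oP0) [/eqP]; rewrite (negPf Fv).
move=> Q hQ; have [y yQ] := on_exists Q.
have yh : ev y h = 0 by apply/(vanishes_homog yQ he).
have [a Fa dFa] := singular_lift fr Fv d_gt0 ppD ppM pph ppF ppd yh.
have [P oP] := lift_point fr a (proj2 yQ).
exists P; last exact: (proj_point fr yQ oP).
by apply/(hsing_ev X d_gt0 oP).
Qed.

(** The relation r H = L G modulo F is homogeneous of degree k + 1 on the right, so [r] may be
    replaced by its component of degree 1. *)
Lemma root_linear k (L G H : {mpoly K[N.+3]}) x :
  L \is 1.-homog -> G \is k.-homog -> H \is k.-homog -> coord_pi X H != 0 ->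
  x * (coord_pi X H)%:F = (coord_pi X (L * G))%:F -> hroot A c B v x ->
  exists e l, l \is 1.-homog /\ x = theta (l%:P + e%:MP *: 'X).
Proof.
move=> hL hG hH H0 xE rx.
have [r xr] := root_polynomial hL hG hH H0 xE rx.
pose M := pihomog mdeg 1 (Psi A c r).
have hM : M \is 1.-homog by exact: pihomogP.
have xM : x = theta (Phi B v M).
  have HF0 : (coord_pi X H)%:F != 0 by rewrite tofrac_eq0.
  rewrite theta_Phi //; apply: (mulIf HF0); rewrite xE -tofracM -rmorphM; congr (_%:F).
  apply/eqP; rewrite -subr_eq0 -rmorphB; apply/eqP/coord_pi_eq0.
  have [z zE] : rdvd F (Psi A c r * H - L * G).
    apply/coord_pi_eq0; rewrite rmorphB; apply/eqP; rewrite subr_eq0 -tofrac_eq; apply/eqP.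
    by rewrite -xE xr thetaE rmorphM tofracM.
  have := pihomogM_dvd z (1 + k) (heq_homog X); rewrite -zE raddfB /=.
  rewrite (pihomogM _ _ hH) (@pihomog_dE _ _ _ (1 + k) (L * G)) ?dhomogM //.
  by move=> h; rewrite -opprB; apply: rdvdN.
exists (ev v M), (Phi B v M)`_0; split.
  exact: (coef_Phi_homog _ _ hM).
rewrite xM; congr (theta _); apply/polyP => i.
rewrite coefD coefC coefZ coefX; case: i => [|[|i]] /=.
- by rewrite mulr0 addr0.
- by rewrite mulr1 add0r (coef_Phi_top _ _ hM).
- by rewrite mulr0 addr0 (coef_Phi_gt _ _ hM).
Qed.

End RootsLinear.

Lemma coef_comp_scale (S : comNzRingType) (p : {poly S}) (a : S) j :
  (p \Po (a *: 'X))`_j = p`_j * a ^+ j.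
Proof.
rewrite comp_polyE coef_sum; have [lt|le] := ltnP j (size p).
  rewrite (bigD1 (Ordinal lt)) //= big1 => [|i ij].
    by rewrite addr0 coefZ exprZn coefZ coefXn eqxx mulr1.
  rewrite coefZ exprZn coefZ coefXn; case: eqP => [e|_]; last by rewrite !mulr0.
  by case/eqP: ij; apply: val_inj.
rewrite nth_default // mul0r big1 // => i _.
rewrite coefZ exprZn coefZ coefXn; case: eqP => [e|_]; last by rewrite !mulr0.
by have := ltn_ord i; rewrite -e ltnNge le.
Qed.

Lemma coef_affine_exp (S : comNzRingType) (a l : S) k j :
  ((l%:P + a *: 'X) ^+ k)`_j =
    if (j <= k)%N then l ^+ (k - j) * a ^+ j *+ 'C(k, j) else 0.
Proof.
rewrite exprDn coef_sum.
have E (i : 'I_k.+1) : ((l%:P ^+ (k - i) * (a *: 'X) ^+ i) *+ 'C(k, i))`_j =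
    (l ^+ (k - i) * a ^+ i * (j == i)%:R) *+ 'C(k, i).
  by rewrite coefMn -rmorphXn mul_polyC coefZ exprZn coefZ coefXn mulrA.
under eq_bigr => i _ do rewrite E.
case: leqP => [|lt]; last first.
  rewrite big1 // => i _; rewrite (gtn_eqF (leq_ltn_trans _ lt)) ?mulr0 ?mul0rn //.
  by rewrite -ltnS.
rewrite -ltnS => lt; rewrite (bigD1 (Ordinal lt)) //= big1 => [|i ij].
  by rewrite eqxx mulr1 addr0.
rewrite (_ : (_ == _) = false) ?mulr0 ?mul0rn //.
by apply: contraNF ij => /eqP e; apply/eqP/val_inj.
Qed.

(* A polynomial of degree d commuting, up to scalars, with d affine
   substitutions X |-> c X + l is a d-th power plus a constant. *)
Lemma affine_symmetric (K : fieldType) (S : idomainType) (i0 : {rmorphism K -> S})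
    (d : nat) (p : {poly S}) (s : seq (K * S)) :
  [pchar K] =i pred0 -> p \is monic -> size p = d.+1 -> prime_elt p -> (1 < d)%N ->
  uniq s -> (d <= size s)%N ->
  (forall x, x \in s -> rdvd p (p \Po (x.2%:P + i0 x.1 *: 'X))) ->
  exists e : S, p = ('X + (i0 d%:R^-1 * p`_d.-1)%:P) ^+ d + e%:P.
Proof.
move=> charK mp sp prp d1 us ds hs.
have [p0 _ pp] := prp.
have i0_neq0 x : x != 0 -> i0 x != 0.
  move=> x0; apply/eqP => h; have := rmorph1 i0; rewrite -(mulfV x0) rmorphM h mul0r.
  by move/eqP; rewrite eq_sym oner_eq0.
have i0_inj : injective i0.
  move=> x y h; apply/eqP; rewrite -subr_eq0; apply: contraT => /i0_neq0.
  by rewrite rmorphB h subrr eqxx.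
have dK : d%:R != 0 :> K by rewrite (iffLR (pcharf0P K) charK) -lt0n ltnW.
(* The Tschirnhaus shift: q = p(X - t) has no term of degree d - 1. *)
pose t := i0 d%:R^-1 * p`_d.-1.
pose q := p \Po ('X - t%:P).
have mq : q \is monic.
  by rewrite monicE lead_coef_comp ?size_XsubC // (monicP mp) lead_coefXsubC expr1n mulr1.
have sq : size q = d.+1 by rewrite size_comp_poly2 ?size_XsubC.
have dt : t *+ d = p`_d.-1.
  by rewrite -mulr_natl -(rmorph_nat i0) mulrA -rmorphM mulfV // rmorph1 mul1r.
(* A constant substitution would give p a root, impossible for a prime of degree d > 1. Otherwise
   degrees make the cofactor a constant, read off from leading coefficients. *)
have key x : x \in s -> i0 x.1 != 0 /\ p \Po (x.2%:P + i0 x.1 *: 'X) = i0 x.1 ^+ d *: p.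
  move=> xs; have [z zE] := hs _ xs; case: x xs zE => a l /= xs zE.
  have a0 : i0 a != 0.
    apply/eqP => a0; move: zE; rewrite a0 scale0r addr0 comp_polyCr => zE.
    have pl : p.[l] = 0.
      apply/eqP; rewrite -polyC_eq0 zE mulf_eq0 (negPf p0) orbF; apply: contraT => z0.
      have := congr1 (fun r : {poly S} => size r) zE; rewrite size_polyC size_mul // sp.
      by move: z0; rewrite -size_poly_gt0; move: (size z) (_ != 0) => i [] /=; lia.
    have /factor_theorem [w wE] : root p l by apply/rootP.
    have : rdvd p (w * ('X - l%:P)) by rewrite -wE; exact: rdvdxx.
    have w0 : w != 0 by apply: contraNneq p0 => w0; rewrite wE w0 mul0r.
    have sw : size p = (size w).+1.
      by rewrite wE size_mul ?polyXsubC_eq0 // size_XsubC addn2.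
    have dvd_size r : r != 0 -> rdvd p r -> (size p <= size r)%N.
      move=> r0 [y yE]; have y0 : y != 0 by apply: contraNneq r0 => y0; rewrite yE y0 mul0r.
      by rewrite yE size_mul //; move: y0; rewrite -size_poly_gt0; move: (size y) (size p) => i j; lia.
    case/pp => /dvd_size; first by move/(_ w0); rewrite sw ltnn.
    by rewrite polyXsubC_eq0 size_XsubC sp => /(_ isT); move: d1; case: (d) => [|[]].
  split=> //.
  have sl : size (l%:P + i0 a *: 'X) = 2%N.
    rewrite addrC size_polyDl size_scale ?size_polyX // size_polyC; by case: eqP.
  have sz : size (p \Po (l%:P + i0 a *: 'X)) = d.+1 by rewrite size_comp_poly2 // sl.
  have z0 : z != 0.
    by apply/eqP => z0; move: sz; rewrite zE z0 mul0r size_poly0.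
  have sz1 : (size z <= 1)%N.
    move: sz; rewrite zE size_mul // sp.
    by move: (size z) => i; lia.
  have lc : lead_coef (p \Po (l%:P + i0 a *: 'X)) = i0 a ^+ d.
    rewrite lead_coef_comp ?sl // (monicP mp) mul1r sp /=; congr (_ ^+ _).
    rewrite lead_coefE sl coefD coefC coefZ coefX /= mulr1 add0r //.
  rewrite zE (size1_polyC sz1) mul_polyC; congr (_ *: _).
  by rewrite -lc zE (size1_polyC sz1) lead_coefM lead_coefC (monicP mp) mulr1 coefC.
have dS : d%:R != 0 :> S by rewrite -(rmorph_nat i0) i0_neq0.
(* By comparison of the coefficients of degree d - 1, every substitution fixes -t. It becomes X |->
   a X for q, and it is determined by its scalar a. *)
have kl x : x \in s -> x.2 = (i0 x.1 - 1) * t.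
  move=> xs; have [a0 E] := key x xs; case: x xs a0 E => a l /= xs a0 E.
  apply: (mulfI dS); apply: (mulfI (expf_neq0 d.-1 a0)).
  have := congr1 (fun r : {poly S} => r`_d.-1) E.
  have [e de] : exists e, d = e.+1 by exists d.-1; rewrite prednK // ltnW.
  rewrite coefZ -dt comp_polyE sp de big_ord_recr big_ord_recr /= coefD coefD.
  rewrite coef_sum big1 => [|i _]; last first.
    by rewrite coefZ coef_affine_exp leqNgt ltn_ord mulr0.
  rewrite add0r !coefZ !coef_affine_exp leqnSn leqnn subnn subSnn binn binSn.
  have -> : p`_e.+1 = 1 by move/monicP: mp; rewrite lead_coefE sp de.
  have -> : p`_e = t *+ e.+1 by rewrite -[e in p`_e]/(e.+1.-1) -de -dt.
  rewrite expr1 expr0 mulr1n -(mulr_natl t) -(mulr_natl (l * _)) => H.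
  have -> : i0 a ^+ e * (e.+1%:R * l) = e.+1%:R * t * (1 * i0 a ^+ e) +
      1 * (e.+1%:R * (l * i0 a ^+ e)) - e.+1%:R * t * i0 a ^+ e by ring.
  by rewrite H exprS; ring.
have qa x j : x \in s -> q`_j * i0 x.1 ^+ j = i0 x.1 ^+ d * q`_j.
  move=> xs; have [a0 E] := key x xs.
  rewrite -coef_comp_scale -coefZ; congr (_`_j).
  rewrite -comp_polyZ -E /q -!comp_polyA; congr (p \Po _).
  rewrite !(comp_polyB, comp_polyD, comp_polyZ, comp_polyC, comp_polyX).
  by rewrite (kl x xs) mulrBl mul1r scalerBr -!mul_polyC polyCB (polyCM (i0 x.1) t); ring.
have uK : uniq (map fst s).
  rewrite map_inj_in_uniq // => -[a l] [a' l'] xs xs' /= e; rewrite -e in xs' *.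
  by have := kl _ xs; have := kl _ xs'; rewrite /= => -> ->.
(* A nonzero coefficient would make all the scalars, at least d of them and distinct, roots of X^(d
   - j) - 1. *)
have q0 j : (0 < j)%N -> (j < d)%N -> q`_j = 0.
  move=> j0 jd; apply: contraTeq ds => qj; rewrite -ltnNge.
  have hr : all (root ('X^(d - j) - 1%:P)) (map fst s).
    apply/allP => a /mapP [x xs ->]; rewrite rootE hornerD hornerN hornerXn hornerC.
    rewrite subr_eq0 -(inj_eq i0_inj) rmorphXn rmorph1.
    have := qa x j xs; rewrite mulrC => /(mulIf qj).
    rewrite -{1}(subnK (ltnW jd)) exprD -{1}[i0 x.1 ^+ j]mul1r => /mulIf.
    by rewrite expf_neq0 // => [/(_ isT) <- //|]; have [] := key x xs.
  have dj : (0 < d - j)%N by rewrite subn_gt0.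
  have := max_poly_roots _ hr uK; rewrite -size_poly_gt0 size_XnsubC //= size_map.
  by move=> /(_ isT); lia.
exists q`_0; have pE : p = q \Po ('X + t%:P).
  by rewrite /q -comp_polyA comp_polyB comp_polyX comp_polyC addrK comp_polyXr.
have qE : q = 'X^d + (q`_0)%:P.
  apply/polyP => j; rewrite coefD coefXn coefC.
  have [jd|] := ltnP j d.
    rewrite (ltn_eqF jd) add0r; case: j jd => [//|j jd]; exact: q0.
  rewrite leq_eqVlt => /orP[/eqP <-|dj].
    rewrite eqxx (gtn_eqF (ltnW d1)) addr0.
    by have /monicP := mq; rewrite lead_coefE sq.
  by rewrite (gtn_eqF dj) (gtn_eqF (leq_ltn_trans (leq0n d) dj)) addr0 nth_default // sq.
by rewrite [LHS]pE {1}qE comp_polyD comp_Xn_poly comp_polyC.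
Qed.

(** * Function fields and the dehomogenized equation *)

Section SubfieldValue.
Variables (E : fieldType) (S : divringClosed E).
Implicit Types x y : subfield S.

Lemma sfval_inj : injective (@sfval E S).
Proof. exact: val_inj. Qed.
Lemma sfvalD x y : sfval (x + y) = sfval x + sfval y. Proof. by []. Qed.
Lemma sfvalM x y : sfval (x * y) = sfval x * sfval y. Proof. by []. Qed.
Lemma sfval0 : sfval (0 : subfield S) = 0. Proof. by []. Qed.
Lemma sfval1 : sfval (1 : subfield S) = 1. Proof. by []. Qed.
Lemma sfvalX x k : sfval (x ^+ k) = sfval x ^+ k.
Proof. by elim: k => [|k IH]; rewrite ?expr0 // !exprS sfvalM IH. Qed.
Lemma sfval_sum I (r : seq I) (P : pred I) (F : I -> subfield S) :
  sfval (\sum_(i <- r | P i) F i) = \sum_(i <- r | P i) sfval (F i).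
Proof. exact: (big_morph _ sfvalD sfval0). Qed.
Lemma sfval_eq0 x : (sfval x == 0) = (x == 0).
Proof. by rewrite -sfval0 (inj_eq sfval_inj). Qed.
End SubfieldValue.

Section CommonDenominator.
Variables (K : fieldType) (n : nat).
Local Notation S := {mpoly K[n.+1]}.
Local Notation F0 := (funfield_proj K n).
Local Notation "x %:F" := (@FracField.tofrac S x).

Lemma ratfun_fraction (x : F0) : exists k (G H : S),
  [/\ G \is k.-homog, H \is k.-homog, H != 0 & sfval x = G%:F / H%:F].
Proof. by have /asboolP [k [G [H h]]] := sfvalP x; exists k, G, H. Qed.

Lemma common_denominator (q : nat -> F0) m : exists k (D : S) (G : nat -> S),
  [/\ D != 0, D \is k.-homog & forall j, (j < m)%N ->
    G j \is k.-homog /\ sfval (q j) = (G j)%:F / D%:F].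
Proof.
elim: m => [|m [k [D [G [D0 hD hG]]]]].
  by exists 0%N, 1, (fun=> 0); split; rewrite ?oner_eq0 ?dhomog1.
have [k' [G' [H [hG' hH H0 qE]]]] := ratfun_fraction (q m).
exists (k + k')%N, (D * H), (fun j => if j == m then D * G' else G j * H); split.
- by rewrite mulf_neq0.
- exact: dhomogM.
- move=> j; rewrite ltnS leq_eqVlt; case: eqP => [-> _|_ /= jm].
    split; first exact: dhomogM.
    by rewrite qE !tofracM -mulf_div divff ?mul1r ?tofrac_eq0.
  have [hGj ->] := hG j jm; split; first exact: dhomogM.
  by rewrite !tofracM -mulf_div divff ?mulr1 ?tofrac_eq0.
Qed.

End CommonDenominator.

Lemma mpolyU_neq0 (R : comNzRingType) n (i : 'I_n) : 'X_i != 0 :> {mpoly R[n]}.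
Proof.
apply/eqP => h; have := congr1 (ev (delta_mx 0 i)) h.
by rewrite evX !mxE !eqxx rmorph0 => /eqP; rewrite oner_eq0.
Qed.

Lemma clear_denominators (E : fieldType) (a b x y : E) i j : b != 0 -> y != 0 ->
  a / b * (x / y) ^+ j * (b * (y ^+ i * y ^+ j)) = a * y ^+ i * x ^+ j.
Proof. by move=> b0 y0; rewrite exprMn exprVn; field; rewrite b0 expf_neq0. Qed.

Lemma clear_power (E : fieldType) (a x y : E) i j : y != 0 ->
  y ^+ i * y ^+ j * (a / y ^+ i * x ^+ j) = a * (y ^+ j * x ^+ j).
Proof. by move=> y0; field; rewrite expf_neq0. Qed.

Section FunctionField.
Variables (K : closedFieldType) (n d : nat) (X : hypersurface K n d).
Variables (A : 'M[K]_(n.+2, n.+1)) (c : 'cV[K]_n.+2).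
Variables (B : 'M[K]_(n.+1, n.+2)) (v : 'rV[K]_n.+2).
Hypothesis fr : frame A c B v.
Hypothesis Fv : ev v (heq X) != 0.
Hypothesis d_gt0 : (0 < d)%N.
Local Notation F := (heq X).
Local Notation theta := (htheta X A c).
Local Notation Ft := (hpoly X B v).
Local Notation S := {mpoly K[n.+1]}.
Local Notation F0 := (funfield_proj K n).
Local Notation E0 := (funfield X).
Local Notation "x %:FR" := (@FracField.tofrac (coord_ring X) x)
  (at level 2, left associativity, format "x %:FR").
Local Notation "x %:FS" := (@FracField.tofrac S x)
  (at level 2, left associativity, format "x %:FS").

Lemma theta_pullback G : (coord_pi X (pullback A G))%:FR = theta G%:P.
Proof. by rewrite thetaE PsiC. Qed.

Let X0 : S := 'X_ord0.
Let lam := theta X0%:P.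

Let X0_neq0 : X0 != 0. Proof. exact: mpolyU_neq0. Qed.

Let thC (b : S) : b != 0 -> theta b%:P != 0.
Proof. exact: (theta_polyC_neq0 fr Fv d_gt0). Qed.

Lemma X0_homog k : X0 ^+ k \is k.-homog.
Proof. by rewrite -{2}[k]mul1n; apply: dhomogMn; rewrite dhomogX /= mdeg1. Qed.

Lemma lam_neq0 : lam != 0. Proof. exact: thC X0_neq0. Qed.

Variable iota : {rmorphism F0 -> E0}.
Hypothesis iotaE : induced_by A iota.

Lemma iota_value k (G H : S) (x : F0) : G \is k.-homog -> H \is k.-homog -> H != 0 ->
  sfval x = G%:FS / H%:FS -> sfval (iota x) = theta G%:P / theta H%:P.
Proof.
move=> hG hH H0 xE; have := iotaE hG hH H0 xE; rewrite !theta_pullback => <-.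
by rewrite mulfK // thC.
Qed.

(* The generator x / x_0 of the function field over its subfield. *)
Variable t : E0.
Hypothesis tE : sfval t = theta 'X / lam.

(** Clearing denominators and powers of x_0 turns [q] into a polynomial over S in the kernel of
    [theta], that is a nonzero multiple of the equation of X. *)
Lemma generator_degree (q : {poly F0}) : root (map_poly iota q) t -> q != 0 ->
  (d < size q)%N.
Proof.
move=> /rootP rt q0; set m := size q.
have [k [D [G [D0 hD hG]]]] := common_denominator (fun j => q`_j) m.
pose Q : {poly S} := \poly_(j < m) (G j * X0 ^+ (m - j)).
have lD0 : theta D%:P != 0 by exact: thC.
have Q0 : theta Q = 0.
  have := congr1 (@sfval _ _) rt; rewrite horner_coef size_map_poly sfval_sum sfval0.
  move/(congr1 (fun z => z * (theta D%:P * lam ^+ m))); rewrite mul0r => <-.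
  rewrite mulr_suml {1}/Q poly_def rmorph_sum; apply: eq_bigr => j _.
  have [hGj qE] := hG j (ltn_ord j).
  rewrite coef_map sfvalM sfvalX tE (iota_value hGj hD D0 qE) /=.
  have -> : lam ^+ m = lam ^+ (m - j) * lam ^+ j by rewrite -exprD subnK // ltnW.
  rewrite (clear_denominators _ _ _ _ lD0 lam_neq0).
  rewrite -mul_polyC rmorphM polyCM rmorphM /lam -!rmorphXn //.
have Qn0 : Q != 0.
  have m0 : (0 < m)%N by rewrite size_poly_gt0.
  have m1 : (m.-1 < m)%N by rewrite prednK.
  apply: contraTneq (m1) => Qz; have := congr1 (fun p : {poly S} => p`_m.-1) Qz.
  rewrite coef0 coef_poly m1 => /eqP; rewrite mulf_eq0 expf_eq0 (negPf X0_neq0) andbF orbF.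
  move=> /eqP Gz; have [_ qE] := hG _ m1; move: qE; rewrite Gz tofrac0 mul0r => /eqP.
  by rewrite sfval_eq0 -/m -lead_coefE lead_coef_eq0 (negPf q0).
have /(theta_eq0 fr Fv) [w wE] := Q0.
have w0 : w != 0 by apply: contraNneq Qn0 => w0; rewrite wE w0 mul0r.
have : (size Q <= m)%N by exact: size_poly.
rewrite wE size_mul // ?(monic_neq0 (hpoly_monic B Fv)) // hpoly_size //.
by move: w0; rewrite -size_poly_gt0; move: (size w) => i; lia.
Qed.

(** Divide the homogeneous equation by x_0^d: the coefficient of index j has degree d - j, so x_0^(d
    - j) makes it a rational function on P^n. *)
Lemma equation_exists : exists ft : {poly F0}, [/\ ft \is monic, size ft = d.+1,
  forall j, (j <= d)%N -> sfval ft`_j = (Ft`_j)%:FS / (X0 ^+ (d - j))%:FS &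
  forall x : E0, root (map_poly iota ft) x <-> hroot A c B v (lam * sfval x)].
Proof.
have hFt j : (j <= d)%N -> Ft`_j \is (d - j).-homog.
  by move=> jd; apply: coef_Phi_homog => //; exact: heq1_homog.
have Xn0 k : X0 ^+ k != 0 by rewrite expf_neq0.
have ex j : exists e : F0, (j <= d)%N -> sfval e = (Ft`_j)%:FS / (X0 ^+ (d - j))%:FS.
  case: (leqP j d) => [jd|_]; last by exists 0.
  have mem : (Ft`_j)%:FS / (X0 ^+ (d - j))%:FS \in
      degree0_frac (idfun : {rmorphism S -> S}).
    apply/asboolP; exists (d - j)%N, Ft`_j, (X0 ^+ (d - j)).
    by split; [exact: hFt|exact: X0_homog|exact: Xn0|].
  by exists (Subfield mem).
have [e eE] := choice ex.
have ed : e d = 1.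
  apply: sfval_inj; rewrite eE // sfval1 subnn expr0 tofrac1 divr1.
  have /monicP := hpoly_monic B Fv; rewrite lead_coefE hpoly_size // => ->.
  exact: tofrac1.
pose ft := \poly_(j < d.+1) e j.
have sft : size ft = d.+1 by rewrite size_poly_eq // ed oner_eq0.
have cft j : (j <= d)%N -> ft`_j = e j by move=> jd; rewrite coef_poly ltnS jd.
exists ft; split.
- by rewrite monicE lead_coefE sft /= cft // ed eqxx.
- exact: sft.
- by move=> j jd; rewrite cft // eE.
move=> x; have key : theta (X0%:P ^+ d) * sfval (map_poly iota ft).[x] =
    (map_poly (theta \o polyC) Ft).[lam * sfval x].
  rewrite horner_coef size_map_poly sft sfval_sum mulr_sumr.
  rewrite horner_coef size_map_poly_id0; last first.
    by rewrite (monicP (hpoly_monic B Fv)) /= polyC1 rmorph1 oner_eq0.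
  rewrite hpoly_size //; apply: eq_bigr => j _.
  have jd : (j <= d)%N by rewrite -ltnS.
  rewrite !coef_map cft // sfvalM sfvalX.
  rewrite (iota_value (hFt j jd) (X0_homog _) (Xn0 _) (eE j jd)) /=.
  rewrite !rmorphXn /= -/lam exprMn.
  have -> : lam ^+ d = lam ^+ (d - j) * lam ^+ j by rewrite -exprD subnK.
  exact: (clear_power _ _ _ _ lam_neq0).
rewrite /hroot !rootE -key mulf_eq0 rmorphXn /= -/lam expf_eq0 (negPf lam_neq0) andbF /=.
by rewrite sfval_eq0.
Qed.

Lemma hroot_X : hroot A c B v (theta 'X).
Proof.
rewrite /hroot rootE map_poly_comp horner_map -[_.['X]]/(Ft \Po 'X) comp_polyXr.
by apply/eqP/(theta_eq0 fr Fv); exact: rdvdxx.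
Qed.

(** The minimal polynomial of the generator has degree at least d, divides the equation of X, and by
    normality and separability splits into distinct factors. Its roots, multiplied by x_0, form
    [s]. *)
Lemma galois_roots : galois_extension iota -> exists s : seq {fraction coord_ring X},
  [/\ uniq s, (d <= size s)%N & forall x, x \in s -> hroot A c B v x /\
    exists k (G H : {mpoly K[n.+2]}), [/\ G \is k.-homog, H \is k.-homog,
      coord_pi X H != 0 & x * (coord_pi X H)%:FR = (coord_pi X (lsub A X0 * G))%:FR]].
Proof.
move=> [L [f [[g gK fK] fiota /and3P[_ sepL /normalFieldP nL]]]].
pose tau := g t; have ftau : f tau = t by exact: fK.
have [ft [mft sft _ rft]] := equation_exists.
have [r _ Er] := nL tau (memvf _).
have [q Eq] : exists q, minPoly 1 tau = map_poly (in_alg L) q.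
  exact/polyOver1P/minPolyOver.
have fin : f \o in_alg L =1 iota by move=> x; exact: fiota.
have fmap p : map_poly f (map_poly (in_alg L) p) = map_poly iota p.
  by rewrite -map_poly_comp; apply: eq_map_poly.
have q0 : q != 0.
  apply: contraTneq (monic_minPoly 1 tau) => q0.
  by rewrite Eq q0 rmorph0 monicE lead_coef0 eq_sym oner_eq0.
have rq : root (map_poly iota q) t.
  by rewrite -ftau -fmap fmorph_root -Eq root_minPoly.
have sr : (d <= size r)%N.
  have := generator_degree rq q0; rewrite -(size_map_poly (in_alg L)) -Eq Er.
  by rewrite size_prod_XsubC.
have ur : uniq r.
  rewrite -separable_prod_XsubC -Er; exact: (separableP sepL _ (memvf tau)).
exists [seq lam * sfval (f b) | b <- r]; split.
- rewrite map_inj_uniq // => b1 b2 /(mulfI lam_neq0) /sfval_inj.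
  exact: fmorph_inj.
- by rewrite size_map.
- move=> x /mapP [b br ->]; split.
    apply/rft; rewrite -fmap fmorph_root.
    have dv : minPoly 1 tau %| map_poly (in_alg L) ft.
      apply: minPoly_dvdp; first by apply/polyOver1P; exists ft.
      rewrite -(fmorph_root f) fmap ftau; apply/rft.
      have -> : lam * sfval t = theta 'X.
        by rewrite tE mulrCA mulfV ?mulr1 //; exact: lam_neq0.
      exact: hroot_X.
    have [w ->] := dvdpP _ _ dv.
    by rewrite rootM Er root_prod_XsubC br orbT.
  have /asboolP [k [G [H [hG hH H0 xE]]]] := sfvalP (f b).
  exists k, G, H; split=> //; rewrite xE rmorphM tofracM -/(pullback A X0).
  by rewrite theta_pullback -/lam -mulrA divfK // tofrac_eq0.
Qed.

End FunctionField.

(* The outer Galois points [v] will turn out to be those for which some c makes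
   this hold, i.e. F = F(v) c^d + (a form killed by the derivative along v). *)
Definition good_center (K : closedFieldType) (n d : nat) (X : hypersurface K n d)
    (v : 'rV[K]_n.+2) (c : 'cV[K]_n.+2) :=
  [/\ ev v (heq X) != 0, v *m c = 1%:M &
      dird v (heq X) = (ev v (heq X) *+ d) *: lin c ^+ d.-1].

Lemma galois_good (K : closedFieldType) (N d : nat) (X : hypersurface K N.+1 d)
    (P : pspace K N.+2) (v : 'rV[K]_N.+3) :
  [pchar K] =i pred0 -> (1 < d)%N -> ~ has_chain (hsing X) N.+1 ->
  outer_galois_points X P -> on P v -> exists c, good_center X v c.
Proof.
move=> charK d1 nch [[_ [A [iota [cA iA gi]]]] nP] oP.
have d0 : (0 < d)%N := ltnW d1.
have Fv : ev v (heq X) != 0 by apply: contra_notN nP => /eqP h; apply/(hpoints_ev X oP).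
have [c0 vc0] := dual_vector (proj2 oP).
have vA : v *m A = 0 by apply/eqP; rewrite -cA; case: oP.
have kerA (w : 'rV_N.+3) : w *m A = 0 -> exists a, w = a *: v.
  by move=> /eqP; rewrite -cA => /(on_mem _ oP).
have [B fr] := frame_of_center kerA vA vc0.
pose lam := htheta X A c0 ('X_ord0)%:P.
have hl : lsub A 'X_ord0 \is 1.-homog by apply: dhomog_lsub; rewrite dhomogX /= mdeg1.
have l0 : coord_pi X (lsub A 'X_ord0) != 0.
  by have := lam_neq0 fr Fv d0; rewrite thetaE PsiC tofrac_eq0.
have mem : htheta X A c0 'X / lam \in degree0_frac (coord_pi X).
  apply/asboolP; exists 1%N, (lin c0), (lsub A 'X_ord0).
  by split; [exact: dhomog_lin|exact: hl|exact: l0|rewrite /lam !thetaE PsiX PsiC].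
have [s [us ds hs]] := galois_roots fr Fv d0 iA (erefl (sfval (Subfield mem))) gi.
pose Ft := hpoly X B v.
pose S := {mpoly K[N.+2]}.
have ex x : exists el : K * S, x \in s ->
    el.2 \is 1.-homog /\ x = htheta X A c0 (el.2%:P + el.1%:MP *: 'X).
  case: (boolP (x \in s)) => [xs|_]; last by exists (0, 0).
  have [rx [k [G [H [hG hH H0 xE]]]]] := hs _ xs.
  have [e [l [hl' xE']]] := root_linear fr Fv d0 nch hl hG hH H0 xE rx.
  by exists (e, l).
have [el elE] := choice ex.
have [|||e FtE] := @affine_symmetric K S (@mpolyC N.+2 K) d Ft [seq el x | x <- s] charK
  (hpoly_monic B Fv) (hpoly_size B Fv) (hpoly_prime fr Fv d0) d1.
- rewrite map_inj_in_uniq // => x y xs ys e.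
  by have [_ ->] := elE _ xs; have [_ ->] := elE _ ys; rewrite e.
- by rewrite size_map.
- move=> _ /mapP [x xs ->]; have [rx _] := hs _ xs; have [_ xE] := elE _ xs.
  apply/(theta_eq0 fr Fv); move: rx; rewrite /hroot {1}xE map_poly_comp rootE.
  by rewrite (horner_map (htheta X A c0)) => /eqP.
set a := _ * _ in FtE.
have ha : a \is 1.-homog.
  rewrite /a mul_mpolyC; apply: rpredZ.
  have := coef_Phi_homog B v (heq1_homog X v) (leq_pred d).
  by rewrite -/(hpoly X B v) (_ : (d - d.-1)%N = 1%N) //; lia.
(* The form t + a in the original coordinates. It still takes the value 1 at v, since v A = 0. *)
have hL : lin c0 + lsub A a \is 1.-homog.
  by apply: rpredD; [exact: dhomog_lin|exact: dhomog_lsub].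
have [c cE] := homog1_lin hL; exists c; split; first exact: Fv.
  apply/matrixP => i j; rewrite !ord1 [RHS]mxE eqxx -ev_lin -cE evD ev_lin vc0 mxE eqxx.
  have := iffLR (dhomog_ev _ _) ha 0 0; rewrite scale0r expr1 mul0r => a0.
  by rewrite ev_lsub vA a0 addr0.
have E1 : Ft^`() = ('X + a%:P) ^+ d.-1 *+ d.
  by rewrite FtE derivD derivC addr0 deriv_exp derivD derivX derivC addr0 mul1r.
have E2 : Psi A c0 Ft^`() = dird v (heq1 X v).
  by rewrite /Ft /hpoly deriv_Phi (PhiK fr).
have E3 : Psi A c0 (('X + a%:P) ^+ d.-1 *+ d) = lin c ^+ d.-1 *+ d.
  have H1 := raddfMn (Psi A c0) d (('X + a%:P) ^+ d.-1).
  have H2 := rmorphXn (Psi A c0) d.-1 ('X + a%:P).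
  by rewrite /= in H1 H2; rewrite H1 H2 PsiD PsiX PsiC cE.
rewrite -E1 E2 /heq1 dirdZ in E3.
have -> : dird v (heq X) = ev v (heq X) *: ((ev v (heq X))^-1 *: dird v (heq X)).
  by rewrite scalerA mulfV // scale1r.
by rewrite E3 -scalerMnr scalerMnl.
Qed.

Lemma fraction_quotient (S : idomainType) (x : {fraction S}) :
  exists a b, b != 0 /\ x = FracField.tofrac a / FracField.tofrac b.
Proof.
exists (frac (repr x)).1, (frac (repr x)).2.
have nz := denom_ratioP (repr x); split=> //.
apply: (mulIf (x := FracField.tofrac (frac (repr x)).2)); first by rewrite tofrac_eq0.
rewrite divfK ?tofrac_eq0 // -{1}[x]reprK.
set r := repr x in nz *; set b := (frac r).2 in nz *; set a := (frac r).1.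
change (FracField.mul (\pi_(FracField.type S)%qT r) (FracField.tofrac b) = FracField.tofrac a).
rewrite !piE; apply/eqmodP; rewrite /= FracField.equivfE /FracField.mulf.
by rewrite !numden_Ratio ?mulf_neq0 ?oner_eq0 ?mulr1 // mulrC.
Qed.

Lemma fraction_lift (S : idomainType) (E : fieldType) (g : {rmorphism S -> E}) :
  (forall x, x != 0 -> g x != 0) ->
  exists G : {rmorphism {fraction S} -> E}, forall x, G (FracField.tofrac x) = g x.
Proof.
move=> g0; have ex (x : {fraction S}) : exists y, forall a b, b != 0 ->
    x = FracField.tofrac a / FracField.tofrac b -> y = g a / g b.
  have [a [b [b0 ->]]] := fraction_quotient x.
  exists (g a / g b) => a' b' b'0 /eqP; rewrite eqr_div ?tofrac_eq0 //.
  rewrite -!tofracM tofrac_eq => /eqP h; apply/eqP; rewrite eqr_div ?g0 //.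
  by rewrite -!rmorphM h.
have [G GE] := choice ex.
have Gf x : G (FracField.tofrac x) = g x.
  by rewrite (GE _ x 1) ?oner_eq0 ?tofrac1 ?divr1 // rmorph1 divr1.
have addG : zmod_morphism G.
  move=> x y; have [a [b [b0 xE]]] := fraction_quotient x.
  have [a' [b' [b'0 yE]]] := fraction_quotient y.
  rewrite (GE x a b) // (GE y a' b') // (GE (x - y) (a * b' - a' * b) (b * b')) ?mulf_neq0 //.
    by rewrite rmorphB !rmorphM -[in RHS]mulNr addf_div ?g0 // mulNr.
  by rewrite xE yE tofracB !tofracM -[in LHS]mulNr addf_div ?tofrac_eq0 // mulNr.
have mulG : monoid_morphism G.
  split=> [|x y]; first by rewrite -tofrac1 Gf rmorph1.
  have [a [b [b0 xE]]] := fraction_quotient x.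
  have [a' [b' [b'0 yE]]] := fraction_quotient y.
  rewrite (GE x a b) // (GE y a' b') // (GE (x * y) (a * a') (b * b')) ?mulf_neq0 //.
    by rewrite !rmorphM mulf_div.
  by rewrite xE yE !tofracM mulf_div.
pose H1 := GRing.isZmodMorphism.Build _ _ G addG.
pose H2 := GRing.isMonoidMorphism.Build _ _ G mulG.
pose G' : {rmorphism {fraction S} -> E} := HB.pack G H1 H2.
by exists G'.
Qed.

Lemma subfield_lift (F E : fieldType) (S : divringClosed E) (g : {rmorphism F -> E}) :
  (forall x, g x \in S) ->
  exists G : {rmorphism F -> subfield S}, forall x, sfval (G x) = g x.
Proof.
move=> gS; pose G x : subfield S := Subfield (gS x).
have addG : zmod_morphism G by move=> x y; apply: sfval_inj; exact: rmorphB.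
have mulG : monoid_morphism G.
  split=> [|x y]; apply: sfval_inj; [exact: rmorph1|exact: rmorphM].
pose H1 := GRing.isZmodMorphism.Build _ _ G addG.
pose H2 := GRing.isMonoidMorphism.Build _ _ G mulG.
pose G' : {rmorphism F -> subfield S} := HB.pack G H1 H2.
by exists G'.
Qed.

Section Pullback.
Variables (K : closedFieldType) (n d : nat) (X : hypersurface K n d).
Variables (A : 'M[K]_(n.+2, n.+1)) (c : 'cV[K]_n.+2).
Variables (B : 'M[K]_(n.+1, n.+2)) (v : 'rV[K]_n.+2).
Hypothesis fr : frame A c B v.
Hypothesis Fv : ev v (heq X) != 0.
Hypothesis d_gt0 : (0 < d)%N.
Local Notation S := {mpoly K[n.+1]}.

Lemma pullback_exists : exists iota : {rmorphism funfield_proj K n -> funfield X},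
  induced_by A iota.
Proof.
pose g : {rmorphism S -> {fraction coord_ring X}} := htheta X A c \o polyC.
have g0 x : x != 0 -> g x != 0 by exact: (theta_polyC_neq0 fr Fv d_gt0).
have [G Gf] := fraction_lift g0.
pose F0 := funfield_proj K n.
pose vl : {rmorphism F0 -> {fraction S}} := val.
have mem (x : F0) : (G \o vl) x \in degree0_frac (coord_pi X).
  have [k [a [b [ha hb b0 xE]]]] := ratfun_fraction x.
  apply/asboolP; exists k, (lsub A a), (lsub A b).
  have gE y : g y = FracField.tofrac (coord_pi X (lsub A y)).
    by rewrite /g /= thetaE PsiC.
  split.
  - exact: dhomog_lsub.
  - exact: dhomog_lsub.
  - by have := g0 _ b0; rewrite gE tofrac_eq0.
  - have -> : (G \o vl) x = G (FracField.tofrac a / FracField.tofrac b).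
      by rewrite -xE.
    by rewrite fmorph_div !Gf !gE.
have [iota iotaE] := subfield_lift mem.
exists iota => k a b x ha hb b0 xE; rewrite iotaE.
rewrite /=; have -> : G (vl x) = G (FracField.tofrac a / FracField.tofrac b) by rewrite -xE.
rewrite fmorph_div !Gf !(theta_pullback X A c) divfK //.
exact: g0.
Qed.

End Pullback.

Lemma divf_cancel (E : fieldType) (x y l : E) : l != 0 -> x / y = x / l / (y / l).
Proof. by move=> l0; rewrite invfM invrK mulrACA [l^-1 * l]mulVf // mulr1. Qed.

Lemma dhomog_const (R : comNzRingType) m (y : R) : (y%:MP : {mpoly R[m]}) \is 0.-homog.
Proof. by rewrite -[y%:MP]mulr1 mul_mpolyC; apply: rpredZ; exact: dhomog1. Qed.

(** * Kummer extensions: equations of the form t^d + a = 0 *)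

Section CyclicExtension.
Variables (K : closedFieldType) (n d : nat) (X : hypersurface K n d).
Variables (A : 'M[K]_(n.+2, n.+1)) (c : 'cV[K]_n.+2).
Variables (B : 'M[K]_(n.+1, n.+2)) (v : 'rV[K]_n.+2).
Hypothesis fr : frame A c B v.
Hypothesis Fv : ev v (heq X) != 0.
Hypothesis d_gt1 : (1 < d)%N.
Hypothesis charK : [pchar K] =i pred0.
Local Notation theta := (htheta X A c).
Local Notation Ft := (hpoly X B v).
Local Notation S := {mpoly K[n.+1]}.
Local Notation F0 := (funfield_proj K n).
Local Notation E0 := (funfield X).
Local Notation "x %:FS" := (@FracField.tofrac S x)
  (at level 2, left associativity, format "x %:FS").
Let X0 : S := 'X_ord0.
Let lam := theta X0%:P.
Let d_gt0 : (0 < d)%N. Proof. exact: ltnW. Qed.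

Variable a : S.
Hypothesis FtE : Ft = 'X^d + a%:P.
Variable iota : {rmorphism F0 -> E0}.
Hypothesis iotaE : induced_by A iota.
Variable t : E0.
Hypothesis tE : sfval t = theta 'X / lam.

Let lam0 : lam != 0. Proof. exact: (lam_neq0 fr Fv d_gt0). Qed.

(** A form of degree k divided by x_0^k is a polynomial in t over the base field, so quotients of
    forms of equal degree are rational in t. *)
Lemma funfield_generated (x : E0) : exists q : {poly F0}, exists r : {poly F0},
  x = (map_poly iota q).[t] / (map_poly iota r).[t].
Proof.
have hom k (G : {mpoly K[n.+2]}) : G \is k.-homog -> exists q : {poly F0},
    sfval (map_poly iota q).[t] = theta (Phi B v G) / lam ^+ k.
  move=> hG.
  have ex j : exists e : F0, (j <= k)%N ->
      sfval e = ((Phi B v G)`_j)%:FS / (X0 ^+ (k - j))%:FS.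
    case: (leqP j k) => [jk|_]; last by exists 0.
    have mem : ((Phi B v G)`_j)%:FS / (X0 ^+ (k - j))%:FS \in
        degree0_frac (idfun : {rmorphism S -> S}).
      apply/asboolP; exists (k - j)%N, (Phi B v G)`_j, (X0 ^+ (k - j)).
      split; [exact: coef_Phi_homog|exact: X0_homog| |by []].
      by rewrite expf_neq0 // mpolyU_neq0.
    by exists (Subfield mem).
  have [e eE] := choice ex.
  exists (\poly_(j < k.+1) e j).
  have PE : Phi B v G = \sum_(j < k.+1) (Phi B v G)`_j *: 'X^j.
    rewrite -poly_def; apply/polyP => j; rewrite coef_poly ltnS.
    by case: leqP => // kj; exact: (coef_Phi_gt _ _ hG).
  rewrite (horner_coef_wide t (n := k.+1)); last first.
    by rewrite size_map_poly; exact: size_poly.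
  rewrite sfval_sum [in theta _]PE.
  rewrite rmorph_sum mulr_suml; apply: eq_bigr => j _.
  have jk : (j <= k)%N by rewrite -ltnS.
  rewrite coef_map coef_poly ltn_ord sfvalM sfvalX tE /=.
  rewrite (iota_value fr Fv d_gt0 iotaE (coef_Phi_homog _ _ hG jk) (X0_homog K n (k - j)) _ (eE j jk)); last first.
    by rewrite expf_neq0 // mpolyU_neq0.
  have -> : theta ((Phi B v G)`_j *: 'X^j) = theta ((Phi B v G)`_j)%:P * theta 'X ^+ j.
    by rewrite -rmorphXn -rmorphM mul_polyC.
  have -> : theta (X0 ^+ (k - j))%:P = lam ^+ (k - j).
    by rewrite /lam -rmorphXn -rmorphXn.
  have -> : lam ^+ k = lam ^+ (k - j) * lam ^+ j by rewrite -exprD subnK.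
  by rewrite exprMn exprVn invfM mulrACA mulrC mulrACA mulrC mulrA.
have /asboolP [k [G [H [hG hH H0 xE]]]] := sfvalP x.
have [q qE] := hom k G hG; have [r rE] := hom k H hH; exists q, r.
apply: sfval_inj; apply: (etrans xE).
rewrite -[RHS]/(sfval (map_poly iota q).[t] / sfval (map_poly iota r).[t]) qE rE.
rewrite -(theta_Phi X fr G) -(theta_Phi X fr H).
exact: divf_cancel (expf_neq0 k lam0).
Qed.

(** The equation is irreducible by [generator_degree]. Its d roots are t times the d-th roots of
    unity, which lie in K and are distinct in characteristic 0, so adjoining t alone splits it. *)
Lemma cyclic_galois : galois_extension iota.
Proof.
have [p [mp sp _ rp]] := equation_exists fr Fv d_gt0 iotaE.
have lt : lam * sfval t = theta 'X by rewrite tE mulrCA mulfV // mulr1.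
have pt : root (map_poly iota p) t by apply/rp; rewrite -/lam lt; exact: hroot_X.
have p0 : p != 0 by exact: monic_neq0.
have irr : irreducible_poly p.
  apply/(subfx_irreducibleP pt p0) => q rq q0; rewrite sp.
  exact: (generator_degree fr Fv d_gt0 iotaE tE).
pose L : fieldExtType F0 := SubFieldExtType pt irr.
pose inj : {rmorphism L -> E0} := @subfx_inj F0 E0 iota t p.
pose z : L := subfx_root iota t p.
have injz : inj z = t by exact: subfx_inj_root.
have injA b : inj b%:A = iota b by exact: subfx_inj_base.
have inj_map q : map_poly inj (map_poly (in_alg L) q) = map_poly iota q.
  by rewrite -map_poly_comp; apply: eq_map_poly => b /=; rewrite injA.
have gen (x : L) : exists q, x = (map_poly (in_alg L) q).[z].
  by have [q ->] := subfxEroot pt p0 x; exists q.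
have evq q : inj (map_poly (in_alg L) q).[z] = (map_poly iota q).[t].
  by rewrite -injz -inj_map horner_map.
have [zs Ezs] := closed_field_poly_normal ('X^d - 1 : {poly K}).
have dK : d%:R != 0 :> K by rewrite (iffLR (pcharf0P K) charK) -lt0n.
move: Ezs; rewrite lead_coefDl ?lead_coefXn ?size_polyN ?size_poly1 ?size_polyXn // scale1r => Ezs.
have uzs : uniq zs.
  by rewrite -separable_prod_XsubC -Ezs; exact: separable_Xn_sub_1.
have szs : size zs = d.
  by apply: succn_inj; rewrite -(size_prod_XsubC zs id) -Ezs size_XnsubC.
have zsd y : (y \in zs) = (y ^+ d == 1).
  rewrite -[y \in zs]root_prod_XsubC -Ezs rootE hornerD hornerN hornerXn hornerC.
  by rewrite subr_eq0.
have ex y : exists e : F0, sfval e = (y%:MP)%:FS.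
  have mem : (y%:MP)%:FS \in degree0_frac (idfun : {rmorphism S -> S}).
    apply/asboolP; exists 0%N, y%:MP, 1.
    split; [|exact: dhomog1|exact: oner_neq0|by rewrite tofrac1 divr1].
    exact: dhomog_const.
  by exists (Subfield mem).
have [kap kapE] := choice ex.
have iokap y : sfval (iota (kap y)) = theta (y%:MP)%:P.
  have h : (y%:MP : S) \is 0.-homog by exact: dhomog_const.
  have e1 : sfval (kap y) = (y%:MP)%:FS / (1 : S)%:FS by rewrite kapE tofrac1 divr1.
  have e2 := iota_value fr Fv d_gt0 iotaE h (dhomog1 _ _) (oner_neq0 _) e1.
  have e3 : theta (1 : S)%:P = 1 by rewrite polyC1; exact: rmorph1.
  by rewrite e3 divr1 in e2.
pose rs := [seq (kap y)%:A * z | y <- zs].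
have t0 : t != 0.
  apply/eqP => t0; have : theta 'X = 0 by rewrite -lt t0 mulr0.
  move/(theta_eq0 fr Fv) => [w wE]; have := congr1 (fun q : {poly S} => size q) wE.
  have w0 : w != 0 by apply/eqP => w0; move/eqP: wE; rewrite w0 mul0r polyX_eq0.
  rewrite size_mul // ?(monic_neq0 (hpoly_monic B Fv)) // hpoly_size // size_polyX.
  by move: w0 d_gt1; rewrite -size_poly_gt0; move: (size w) => i; lia.
have injr y : inj ((kap y)%:A * z) = iota (kap y) * t.
  by rewrite -(injA (kap y)) -[in RHS]injz; exact: (rmorphM inj).
have urs : uniq rs.
  rewrite map_inj_uniq; first exact: uzs.
  move=> y1 y2 e.
  have := etrans (esym (injr y1)) (etrans (congr1 inj e) (injr y2)).
  move/(mulIf t0)/(fmorph_inj iota)/(congr1 (@sfval _ _)); rewrite !kapE.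
  by move/eqP; rewrite tofrac_eq mpolyC_eq => /eqP.
pose pL := map_poly (in_alg L) p.
have rootL : all (root pL) rs.
  apply/allP => _ /mapP [y yz ->]; rewrite -(fmorph_root inj) inj_map.
  rewrite (injr y); apply/rp; rewrite sfvalM mulrCA -/lam lt iokap.
  rewrite /hroot rootE FtE rmorphD /= map_polyXn map_polyC hornerD hornerXn hornerC /=.
  have e1 : (theta (y%:MP)%:P * theta 'X) ^+ d = theta 'X ^+ d.
    rewrite exprMn; have <- : theta ((y%:MP)%:P ^+ d) = theta (y%:MP)%:P ^+ d.
      exact: rmorphXn.
    have -> : (y%:MP : S)%:P ^+ d = 1.
      rewrite -rmorphXn -rmorphXn; move: yz; rewrite zsd => /eqP ->.
      by rewrite /= mpolyC1 polyC1.
    by rewrite (_ : theta 1 = 1) ?mul1r //; exact: rmorph1.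
  rewrite e1; have := hroot_X fr Fv.
  rewrite /hroot rootE FtE rmorphD /= map_polyXn map_polyC hornerD hornerXn hornerC /=.
  by [].
have pLE : pL = \prod_(x <- rs) ('X - x%:P).
  rewrite [LHS](@all_roots_prod_XsubC _ pL rs) //.
  - by rewrite (monicP (monic_map _ mp)) scale1r.
  - by rewrite size_map_poly sp size_map szs.
  - by rewrite uniq_rootsE.
have pL1 : pL \is a polyOver 1%VS by apply/polyOver1P; exists p.
have split : splittingFieldFor 1 pL {:L}.
  exists rs; first by rewrite pLE eqpxx.
  apply/eqP; rewrite eqEsubv subvf /=; apply/subvP => x _.
  have [q ->] := gen x; apply: rpred_horner.
    by apply/(polyOverSv (sub1v _))/polyOver1P; exists q.
  have z1 : z = (kap 1)%:A * z.
    have -> : kap 1 = 1 by apply: sfval_inj; rewrite kapE mpolyC1 tofrac1.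
    by rewrite scale1r mul1r.
  rewrite z1; apply: seqv_sub_adjoin; apply: map_f.
  by rewrite zsd expr1n.
pose SF := FieldExt_isSplittingField.Build F0 L (ex_intro2 _ _ pL pL1 split).
pose L' : splittingFieldType F0 := HB.pack (L : Type) L SF.
exists L', inj; split.
- have sur (x : E0) : exists y : L, inj y = x.
    have [q [r ->]] := funfield_generated x.
    exists ((map_poly (in_alg L) q).[z] / (map_poly (in_alg L) r).[z]).
    apply: (etrans (fmorph_div inj _ _)).
    exact: (congr2 (fun a b : E0 => a / b) (evq q) (evq r)).
  have [g gE] := choice sur.
  by exists g => // y; apply: (fmorph_inj inj); rewrite gE.
- exact: injA.
- apply/splitting_galoisField; exists pL; split=> //.
  by rewrite pLE separable_prod_XsubC.
Qed.

End CyclicExtension.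

Lemma pure_power (K : closedFieldType) (S : idomainType) (i0 : {rmorphism K -> S})
    (d : nat) (p : {poly S}) : [pchar K] =i pred0 -> (0 < d)%N ->
  p^`() = 'X^(d.-1) *+ d -> exists a, p = 'X^d + a%:P.
Proof.
move=> charK d0 pE; exists p`_0; apply/polyP => j.
rewrite coefD coefXn coefC; case: j => [|j]; first by rewrite eq_sym (gtn_eqF d0) add0r.
rewrite addr0.
have jS : (j.+1)%:R != 0 :> S.
  have jK : (j.+1)%:R != 0 :> K by rewrite (iffLR (pcharf0P K) charK).
  apply/eqP => h; have := rmorph1 i0; rewrite -(mulfV jK) rmorphM rmorph_nat h mul0r.
  by move/eqP; rewrite eq_sym oner_eq0.
apply: (mulIf jS); have := congr1 (fun q : {poly S} => q`_j) pE.
rewrite coef_deriv coefMn coefXn mulr_natr => ->.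
case: (eqVneq j d.-1) => [->|jd]; first by rewrite prednK // !eqxx mul1r.
suff -> : (j.+1 == d) = false by rewrite mul0r mul0rn.
by apply: contraNF jd => /eqP <-.
Qed.

(** * Outer Galois points and directional derivatives *)

Section GoodCenters.
Variables (K : closedFieldType) (n d : nat) (X : hypersurface K n d).
Hypothesis charK : [pchar K] =i pred0.
Hypothesis d_gt2 : (2 < d)%N.
Local Notation F := (heq X).
Let d_gt1 : (1 < d)%N. Proof. exact: ltnW. Qed.
Let d_gt0 : (0 < d)%N. Proof. exact: ltnW. Qed.

Lemma mx11_1 : (1%:M : 'M[K]_1) 0 0 = 1. Proof. by rewrite mxE eqxx. Qed.

Lemma natK_neq0 k : (0 < k)%N -> k%:R != 0 :> K.
Proof. by move=> k0; rewrite (iffLR (pcharf0P K) charK) -lt0n. Qed.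

(** In a frame whose fibre coordinate is [c] itself, the hypothesis says that the equation has
    derivative d t^(d-1), so it is t^d + a. *)
Lemma good_galois v c P : good_center X v c -> on P v -> outer_galois_points X P.
Proof.
move=> [Fv vc dF] oP; have [A [B fr]] := frame_exists vc.
have nP : ~ hpoints X P by move=> /(hpoints_ev X oP) /eqP; rewrite (negPf Fv).
split=> //; split; first by right.
have [BA Bc vA _ _] := fr.
have dFt : (hpoly X B v)^`() = 'X^(d.-1) *+ d.
  rewrite /hpoly deriv_Phi /heq1 dirdZ dF scalerA mulrnAr mulVf //.
  have hl : Phi B v (lin c) = 'X.
    rewrite Phi_lin Bc vc mxE eqxx mpolyC1 scale1r /lin big1 ?add0r // => i _.
    by rewrite mxE scale0r.
  have -> : (1 *+ d : K) *: lin c ^+ d.-1 = lin c ^+ d.-1 *+ d.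
    by rewrite -scaler_nat.
  have H1 := raddfMn (Phi B v) d (lin c ^+ d.-1).
  have H2 := rmorphXn (Phi B v) d.-1 (lin c).
  by rewrite /= in H1 H2; rewrite H1 H2 hl.
have [a FtE] := pure_power (@mpolyC n.+1 K) charK d_gt0 dFt.
have [iota iA] := pullback_exists fr Fv d_gt0.
pose lam := htheta X A c ('X_ord0)%:P.
have l0 : coord_pi X (lsub A 'X_ord0) != 0.
  by have := lam_neq0 fr Fv d_gt0; rewrite thetaE PsiC tofrac_eq0.
have mem : htheta X A c 'X / lam \in degree0_frac (coord_pi X).
  apply/asboolP; exists 1%N, (lin c), (lsub A 'X_ord0).
  split; [exact: dhomog_lin| |exact: l0|by rewrite /lam !thetaE PsiX PsiC].
  by apply: dhomog_lsub; rewrite dhomogX /= mdeg1.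
exists A, iota; split.
- move=> w; apply/idP/eqP => [/(on_mem _ oP) [b ->]|wA].
    by rewrite -scalemxAl vA scaler0.
  apply/(on_mem _ oP); exists ((w *m c) 0 0).
  by rewrite {1}(frame_point fr w) wA mul0mx add0r.
- exact: iA.
- exact: (cyclic_galois fr Fv d_gt1 charK FtE iA (erefl (sfval (Subfield mem)))).
Qed.

Lemma dird_lin_exp m (u : 'rV[K]_m) (c : 'cV[K]_m) k :
  dird u (lin c ^+ k.+1) = ((u *m c) 0 0 *+ k.+1) *: lin c ^+ k.
Proof.
by rewrite dird_exp dird_lin /= mulrC mul_mpolyC scalerMnl.
Qed.

Lemma deriv_eq0 (p : {poly K}) : p^`() = 0 -> p = (p`_0)%:P.
Proof.
move=> p'0; apply/polyP => -[|j]; rewrite coefC //=.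
have := congr1 (fun q : {poly K} => q`_j) p'0.
rewrite coef_deriv coef0 -mulr_natr => /eqP.
by rewrite mulf_eq0 (negPf (natK_neq0 _)) // orbF => /eqP.
Qed.

Lemma dird_eq0_ev m (u x : 'rV[K]_m) (G : {mpoly K[m]}) t :
  dird u G = 0 -> ev (x + t *: u) G = ev x G.
Proof.
move=> uG; have := deriv_evline x u G; rewrite uG rmorph0 => /deriv_eq0 pE.
have h0 : ev x G = (evline x u G).[0] by rewrite evlineE scale0r addr0.
by rewrite h0 -evlineE pE !hornerC.
Qed.

Hypothesis Delta_fin : finite_set (outer_galois_points X).

(* A cone with vertex [u] is invariant under x |-> x + t u, hence one outer
   Galois point yields infinitely many. *)
Lemma not_cone v c u : good_center X v c -> u != 0 -> dird u F <> 0.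
Proof.
move=> [Fv vc dF] u0 uF.
have Fu : ev u F = 0.
  have := dird_eq0_ev 0 1 uF; rewrite scale1r add0r => ->.
  by have := (iffLR (dhomog_ev _ _) (heq_homog X)) 0 v; rewrite scale0r expr0n (gtn_eqF d_gt0) mul0r.
(* The derivative along u of d F(v) c^(d-1) is zero, as derivatives commute; evaluate it at v, where
   c is 1. *)
have uc : (u *m c) 0 0 = 0.
  have := dird_comm u v F; rewrite uF [dird v 0](_ : _ = 0); last by rewrite -mpolyC0 dirdC.
  rewrite dF dirdZ -(prednK (_ : 0 < d.-1)%N); last by rewrite -ltnS prednK.
  rewrite dird_lin_exp scalerA => /(congr1 (ev v)).
  rewrite evZ rmorphXn /= ev_lin vc mx11_1 expr1n mulr1 evC.
  rewrite -(mulr_natr (ev v F)) -(mulr_natr ((u *m c) 0 0)) => /eqP.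
  by rewrite !mulf_eq0 (negPf Fv) !(negPf (natK_neq0 _)) // ?orbF => /eqP.
(* Moving v along the vertex changes neither F(v), nor the value of c, nor the directional
   derivative of F. The integers give infinitely many t. *)
have vt t : good_center X (v + t *: u) c.
  split; first by rewrite dird_eq0_ev.
    rewrite mulmxDl -scalemxAl vc; apply/matrixP => i j; rewrite !ord1 !mxE.
    by move: uc; rewrite mxE => ->; rewrite mulr0 addr0.
  by rewrite dird_eq0_ev // addrC dird_is_linear_dir uF scaler0 add0r.
have vt0 t : v + t *: u != 0.
  apply/eqP => h; have [_ + _] := vt t; rewrite h mul0mx => /matrixP /(_ 0 0) /eqP.
  by rewrite !mxE eq_sym oner_eq0.
have [f fP] := choice (fun k : nat => point_exists (vt0 k%:R)).
have f_inj : injective f.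
  move=> i j fij; have := fP j; rewrite -fij => /(on_proportional (fP i)) [a a0 h].
  have a1 : a = 1.
    have [_ hi _] := vt i%:R; have [_ hj _] := vt j%:R.
    have := congr1 (fun w : 'rV_n.+2 => (w *m c) 0 0) h; rewrite -scalemxAl hi hj.
    by rewrite !mxE eqxx mulr1.
  move: h; rewrite a1 scale1r => /addrI /eqP; rewrite -subr_eq0 -scalerBl scaler_eq0.
  rewrite (negPf u0) orbF subr_eq0 => /eqP ji.
  have nat_eq k l : (k <= l)%N -> k%:R = l%:R :> K -> k = l.
    move=> kl /eqP; rewrite eq_sym -subr_eq0 -natrB //.
    by case: (posnP (l - k)%N) => [|/natK_neq0 /negPf -> //]; lia.
  by case: (leqP i j) => [/nat_eq|/ltnW /nat_eq] h; [|symmetry]; apply: h.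
move: Delta_fin => /finite_setPn; apply.
apply: card_le_trans (subset_card_le (A := range f) _).
  by have /card_eqPle[] := inj_card_eq (in2W f_inj : {in [set: nat] &, injective f}).
by move=> _ [k _ <-]; exact: (good_galois (vt _) (fP k)).
Qed.

(* Compares the two iterated derivatives of F along v and w: either both linear
   forms vanish at the other point, or c and c' are proportional and F is a cone
   with vertex on the line through v and w. *)
Lemma good_pair v c w c' P Q : good_center X v c -> good_center X w c' ->
  on P v -> on Q w -> P <> Q -> (w *m c) 0 0 = 0 /\ (v *m c') 0 0 = 0.
Proof.
move=> gv gw oP oQ PQ; have [Fv vc dv] := gv; have [Fw wc dw] := gw.
set a := ev v F * (w *m c) 0 0; set b := ev w F * (v *m c') 0 0.
have ab : a *: lin c ^+ d.-2 = b *: lin c' ^+ d.-2.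
  have dp (k : nat) (y z : 'rV[K]_n.+2) (e : 'cV_n.+2) (x : K) : dird y F = (x *+ d) *: lin e ^+ d.-1 ->
      dird z (dird y F) = (d * d.-1)%:R *: ((x * (z *m e) 0 0) *: lin e ^+ d.-2).
    move=> ->; rewrite dirdZ -[in lin e ^+ d.-1](prednK (_ : 0 < d.-1)%N) ?dird_lin_exp; last by rewrite -ltnS prednK.
    rewrite !scalerA; congr (_ *: _).
    rewrite prednK; last by rewrite -ltnS prednK.
    by rewrite natrM -(mulr_natr x) -(mulr_natr _ d.-1); ring.
  have := dird_comm w v F; rewrite (dp 0%N _ _ _ _ dv) (dp 0%N _ _ _ _ dw).
  apply: scalerI; apply: natK_neq0; rewrite muln_gt0 d_gt0 /=.
  by rewrite -ltnS prednK.
have abE (y : 'rV_n.+2) : a * (y *m c) 0 0 ^+ d.-2 = b * (y *m c') 0 0 ^+ d.-2.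
  by have := congr1 (ev y) ab; rewrite !evZ !rmorphXn /= !ev_lin.
have one k : (1%:M : 'M[K]_1) 0 0 ^+ k = 1 by rewrite mx11_1 expr1n.
have d20 : (0 < d.-2)%N by lia.
have z0 : 0 ^+ d.-2 = 0 :> K by rewrite expr0n (gtn_eqF d20).
have [a0|a0] := eqVneq a 0.
  have b0 : b = 0 by have := abE w; rewrite a0 mul0r wc one mulr1 => <-.
  move/eqP: a0; rewrite mulf_eq0 (negPf Fv) => /eqP ->.
  by move/eqP: b0; rewrite mulf_eq0 (negPf Fw) => /eqP ->.
have wc0 : (w *m c) 0 0 != 0 by apply: contraNneq a0; rewrite /a => ->; rewrite mulr0.
have b0 : b != 0.
  apply: contraNneq a0 => b0; have /eqP := abE w; rewrite b0 mul0r mulf_eq0.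
  by rewrite expf_eq0 (negPf wc0) andbF orbF.
(* Here a and b are nonzero and d - 2 > 0, so c and c' have the same zeros and are proportional. *)
have ker (y : 'rV_n.+2) : (y *m c) 0 0 = 0 -> (y *m c') 0 0 = 0.
  move=> y0; have /eqP := abE y; rewrite y0 z0 mulr0 eq_sym mulf_eq0 (negPf b0).
  by rewrite expf_eq0 d20 => /eqP.
set x := (v *m c') 0 0.
have c'E : lin c' = x *: lin c.
  apply: ev_inj => y; rewrite evZ !ev_lin; set t := (y *m c) 0 0.
  have sE (e : 'cV_n.+2) : ((y - t *: v) *m e) 0 0 = (y *m e) 0 0 - t * (v *m e) 0 0.
    by rewrite mulmxBl -scalemxAl [LHS]mxE [X in _ + X]mxE [X in _ - X]mxE.
  have := ker (y - t *: v); rewrite !sE vc mx11_1 mulr1 subrr => /(_ erefl) /eqP.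
  by rewrite subr_eq0 mulrC => /eqP.
(* The candidate vertex. Both directional derivatives are multiples of c^(d-1), and the relation
   between a and b makes them cancel along this vector. *)
have u0 : w - (w *m c) 0 0 *: v != 0.
  rewrite subr_eq0; apply/eqP => wE; apply: PQ; apply: (on_inj oP (v := v)).
  have := on_scale oQ (_ : ((w *m c) 0 0)^-1 != 0); rewrite invr_eq0 => /(_ wc0).
  by rewrite {2}wE scalerA mulVf // scale1r.
case: (not_cone gv u0).
have abx : a = b * x ^+ d.-2 by have := abE v; rewrite vc one mulr1.
rewrite addrC -scaleNr dird_is_linear_dir dv dw c'E exprZn !scalerA -scalerDl.
rewrite (_ : _ + _ = 0) ?scale0r //.
rewrite -(prednK (_ : 0 < d.-1)%N) ?exprSr; last by rewrite -ltnS prednK.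
move: abx; rewrite /a /b -/x; clear c'E; move: (ev v F) (ev w F) ((w *m c) 0 0) x => p r q y.
move: (y ^+ d.-2) => e pq; rewrite mulNr -(mulr_natr p) -(mulr_natr r) mulrA [q * p]mulrC pq.
by clear; ring.
Qed.
End GoodCenters.

Definition prime_ideal (S : comNzRingType) (p : S -> Prop) :=
  [/\ p 0, forall a b, p a -> p b -> p (a + b), forall a b, p b -> p (a * b), ~ p 1 &
      forall a b, p (a * b) -> p a \/ p b].

(** * Chains of prime ideals *)

Section KrullDimension.
Variables (K : closedFieldType) (N : nat).
Local Notation S := {mpoly K[N]}.
Local Notation subst x := (mmap (@mpolyC N K) x).

Lemma prime_ideal_exp (p : S -> Prop) a k : prime_ideal p -> p (a ^+ k) -> p a.
Proof.
move=> [_ _ _ p1 pM]; elim: k => [|k IH]; first by rewrite expr0 => /p1.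
by rewrite exprS => /pM[].
Qed.

Lemma frame_last k : frame (\matrix_(i < k.+1, j < k) (i == widen_ord (leqnSn k) j)%:R)
  (delta_mx ord_max 0) (\matrix_(i < k, j < k.+1) (j == widen_ord (leqnSn k) i)%:R)
  (delta_mx 0 ord_max : 'rV[K]_k.+1).
Proof.
have wm (i : 'I_k) : (ord_max == widen_ord (leqnSn k) i) = false.
  by apply/eqP => /(congr1 val) /= h; have := ltn_ord i; rewrite -h ltnn.
have wi : injective (widen_ord (leqnSn k)) by move=> i j /(congr1 val) h; exact: val_inj.
split.
- apply/matrixP => i j; rewrite !mxE (bigD1 (widen_ord (leqnSn k) i)) //= big1 => [|l li].
    by rewrite !mxE eqxx mul1r addr0 (inj_eq (wi)).
  by rewrite mxE (negPf li) mul0r.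
- by rewrite -colE; apply/colP => i; rewrite !mxE wm.
- by rewrite -rowE; apply/rowP => i; rewrite !mxE wm.
- by rewrite -rowE; apply/rowP => i; rewrite !ord1 !mxE eqxx.
- apply/matrixP => i j; rewrite mxE [X in X + _]mxE [X in _ + X]mxE big_ord1 !mxE eqxx /=.
  have [l ->|->] := unliftP ord_max i.
    have e : lift ord_max l = widen_ord (leqnSn k) l.
      by apply: val_inj; rewrite /= /bump leqNgt ltn_ord.
    rewrite e eq_sym wm mul0r addr0 (bigD1 l) //= big1 => [|t tl].
      by rewrite !mxE eqxx mul1r addr0 eq_sym.
    by rewrite !mxE (inj_eq (wi)) eq_sym (negPf tl) mul0r.
  rewrite eqxx mul1r eq_sym big1 ?add0r // => t _.
  by rewrite !mxE wm mul0r.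
Qed.

(* A relation R(x_1, ..., x_k) in p_k may be divided by its power of T_k; setting
   T_k = 0 then gives a relation R(x_1, ..., x_(k-1), 0) in p_(k-1). *)
Lemma chain_independent k (p : nat -> S -> Prop) (x : 'I_k -> S) :
  (forall i, (i <= k)%N -> prime_ideal (p i)) ->
  (forall i a, (i < k)%N -> p i.+1 a -> p i a) ->
  (forall i : 'I_k, p i (x i) /\ ~ p i.+1 (x i)) ->
  forall R, R != 0 -> ~ p k (subst x R).
Proof.
elim: k x => [|k IH] x pp sub px R R0.
  have RE := mpoly0_const R.
  have r0 : ev 0 R != 0 by apply: contraNneq R0 => h; rewrite RE h mpolyC0.
  have [_ _ pm p1 _] := pp 0%N (leqnn _).
  rewrite RE mmapC => /(pm (ev 0 R)^-1%:MP).
  by rewrite -mpolyCM mulVf // mpolyC1.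
have fr := frame_last k; set A := (X in frame X) in fr; set c := (X in frame _ X) in fr.
set B := (X in frame _ _ X) in fr; set v := (X in frame _ _ _ X) in fr.
pose y i := x (widen_ord (leqnSn k) i).
have xA G : subst x (lsub A G) = subst y G.
  apply: (mpoly_rmorph_eq (f := subst x \o lsub A) (g := subst y)) => [a|i] /=.
    by rewrite lsubC !mmapC.
  rewrite lsubX (_ : col i A = delta_mx (widen_ord (leqnSn k) i) 0).
    by rewrite lin_delta !mmapX !mmap1U.
  by apply/colP => j; rewrite !mxE andbT.
have xc : subst x (lin c) = x ord_max by rewrite lin_delta mmapX mmap1U.
have Q0 : Phi B v R != 0.
  by apply: contraNneq R0 => h; rewrite -(PhiK fr R) h rmorph0.
have [e [q QE q0]] : exists e, exists2 q, Phi B v R = q * 'X^e & q`_0 != 0.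
  have [e [q q0 QE]] := multiplicity_XsubC (Phi B v R) 0.
  exists e, q; first by rewrite QE polyC0 subr0.
  by move: q0; rewrite Q0 /= -horner_coef0.
have Rq : subst x R = subst x (Psi A c q) * x ord_max ^+ e.
  rewrite -(PhiK fr R) QE PsiM.
  have H := rmorphXn (Psi A c) e 'X; rewrite /= PsiX in H; rewrite H.
  have := rmorphM (subst x) (Psi A c q) (lin c ^+ e); rewrite /= => ->; congr (_ * _).
  by have := rmorphXn (subst x) e (lin c); rewrite /= xc.
have ppk := pp k.+1 (leqnn _); have [_ _ _ _ pM] := ppk; have [pxk nxk] := px ord_max.
rewrite Rq => /pM [h|/(prime_ideal_exp ppk)]; last exact: nxk.
have [_ pd pm _ _] := pp k (leqnSn k).
apply: (IH y _ _ _ _ q0).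
- by move=> i /leqW; exact: pp.
- by move=> i a /ltnW; exact: sub.
- by move=> i; exact: (px (widen_ord (leqnSn k) i)).
have -> : subst y q`_0 = subst x (Psi A c q) - subst x (Psi A c (drop_poly 1 q)) * x ord_max.
  rewrite -xA -(PsiC A c) -xc.
  have := rmorphM (subst x) (Psi A c (drop_poly 1 q)) (lin c); rewrite /= => <-.
  have := rmorphB (subst x) (Psi A c q) (Psi A c (drop_poly 1 q) * lin c); rewrite /= => <-.
  congr (mmap _ _ _); rewrite -(PsiX A c) -PsiM; apply/eqP; rewrite eq_sym subr_eq eq_sym -PsiD.
  apply/eqP; congr (Psi A c _).
  by rewrite -{3}(poly_take_drop 1 q) expr1; congr (_ + _); apply/polyP => -[|j]; rewrite coef_take_poly coefC.
apply: pd; first exact: sub h.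
by rewrite -mulNr; apply: pm.
Qed.

Lemma msize_mmap1_le k (x : 'I_k -> S) (m : 'X_{1..k}) e D :
  (forall i, (msize (x i) <= e)%N) -> (forall i, (m i <= D)%N) ->
  (msize (mmap1 x m) <= k * (D * e.+1 + 2) + 1)%N.
Proof.
move=> xe mD.
have exp i j : (msize (x i ^+ j) <= j * e.+1 + 1)%N.
  elim: j => [|j IH]; first by rewrite expr0 msize1.
  rewrite exprS; have := msizeM_le (x i) (x i ^+ j); have := xe i.
  by move: (msize (x i * _)) (msize (x i)) (msize (x i ^+ j)) IH => ? ? ?; lia.
have -> : (k * (D * e.+1 + 2) + 1 = \sum_(i < k) (D * e.+1 + 2) + 1)%N.
  by rewrite sum_nat_const card_ord.
rewrite /mmap1; elim/big_ind2: _ => [|a f b g|i _].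
- by rewrite msize1.
- have [->|f0] := eqVneq f 0; first by rewrite mul0r msize0.
  have [->|g0] := eqVneq g 0; first by rewrite mulr0 msize0.
  move=> hf hg; have := msizeM f0 g0.
  by move: (msize (f * g)) (msize f) (msize g) hf hg => ? ? ?; lia.
- by apply: leq_trans (exp _ _) _; have := leq_mul (mD i) (leqnn e.+1); lia.
Qed.

(* The D^k monomials in x of exponents < D have degree at most linear in D, so
   they lie in a space of dimension O(D^N). *)
Lemma exists_algebraic_relation k (x : 'I_k -> S) : (N < k)%N ->
  exists2 R : {mpoly K[k]}, R != 0 & subst x R = 0.
Proof.
move=> Nk.
(* [L] is chosen so that monomials in x with exponents below D have all exponents below E = L D.
   There are D^k unknowns and E^N = L^N D^N equations, and D > L^N makes E^N < D^(N+1) <= D^k. *)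
pose e := \max_i msize (x i); pose L := (k * (e.+1 + 2) + 2)%N.
pose D := (L ^ N).+1; pose E := (L * D)%N.
pose mon (a : {ffun 'I_k -> 'I_D}) : 'X_{1..k} := [multinom (a i : nat) | i < k].
pose monN (b : {ffun 'I_N -> 'I_E}) : 'X_{1..N} := [multinom (b i : nat) | i < N].
pose mx : 'M[K]_(#|{ffun 'I_k -> 'I_D}|, #|{ffun 'I_N -> 'I_E}|) :=
  \matrix_(i, j) (mmap1 x (mon (enum_val i)))@_(monN (enum_val j)).
have : kermx mx != 0.
  rewrite kermx_eq0; apply/negP => rf; have := rank_leq_col mx.
  rewrite (eqP rf) !card_ffun !card_ord leqNgt => /negP; apply.
  rewrite expnMn; apply: leq_trans (_ : D ^ N.+1 <= _)%N; last exact: leq_pexp2l.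
  by rewrite expnS ltn_mul2r expn_gt0 /= leqnn.
move=> /rowV0Pn [u /sub_kermxP uM u0].
pose R : {mpoly K[k]} := \sum_i u 0 i *: 'X_[mon (enum_val i)].
have mon_inj : injective mon.
  move=> a b /mnmP h; apply/ffunP => i; apply: val_inj.
  by have := h i; rewrite !mnmE.
exists R.
  move/rV0Pn: u0 => [i0 ui0]; apply: contraNneq ui0 => R0.
  have := congr1 (mcoeff (mon (enum_val i0))) R0; rewrite mcoeff0 /R raddf_sum /=.
  rewrite (bigD1 i0) //= big1 => [|i ii].
    by rewrite addr0 mcoeffZ mcoeffX eqxx mulr1 => ->.
  rewrite mcoeffZ mcoeffX (inj_eq mon_inj) (inj_eq enum_val_inj) (negPf ii).
  by rewrite mulr0.
have -> : subst x R = \sum_i u 0 i *: mmap1 x (mon (enum_val i)).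
  rewrite /R (raddf_sum (subst x)); apply: eq_bigr => i _.
  by rewrite /= mmapZ mmapX mul_mpolyC.
apply/mpolyP => m; rewrite mcoeff0 raddf_sum /=.
have [mE|/forallPn [j mE]] := boolP [forall i, (m i < E)%N].
  have [j ->] : exists j : 'I_#|{ffun 'I_N -> 'I_E}|, m = monN (enum_val j).
    have mE' i : (m i < E)%N := forallP mE i.
    pose b : {ffun 'I_N -> 'I_E} := [ffun i => Ordinal (mE' i)].
    by exists (enum_rank b); rewrite enum_rankK; apply/mnmP => i; rewrite mnmE ffunE.
  have := congr1 (fun w : 'rV_ _ => w 0 j) uM; rewrite !mxE => h.
  by apply: etrans h; apply: eq_bigr => i _; rewrite mcoeffZ mxE.
apply: big1 => i _; rewrite mcoeffZ; apply/eqP; rewrite mulf_eq0; apply/orP; right.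
apply: contraNT mE; rewrite -mcoeff_msupp => /msize_mdeg_lt mlt.
have mj : (m j <= mdeg m)%N by rewrite mdegE (bigD1 j) //= leq_addr.
apply: leq_ltn_trans mj _; apply: leq_trans mlt _.
apply: leq_trans (msize_mmap1_le (e := e) (D := D) _ _) _.
- by move=> l; exact: (leq_bigmax (F := fun i => msize (x i))).
- by move=> l; rewrite mnmE ltnW.
- rewrite /E /L; have : (0 < D)%N by []; move: (D) => D' D0; nia.
Qed.

(** Elements chosen in p_i but not in p_(i+1) are algebraically independent modulo p_k, so there are
    at most N of them. *)
Lemma prime_chain_length k (p : nat -> S -> Prop) :
  (forall i, (i <= k)%N -> prime_ideal (p i)) ->
  (forall i a, (i < k)%N -> p i.+1 a -> p i a) ->
  (forall i, (i < k)%N -> exists2 a, p i a & ~ p i.+1 a) -> (k <= N)%N.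
Proof.
move=> pp sub str; rewrite leqNgt; apply/negP => Nk.
have h (i : 'I_k) : exists a, p i a /\ ~ p i.+1 a.
  by have [a ? ?] := str i (ltn_ord i); exists a.
have [x px] := choice h.
have [R R0 xR] := exists_algebraic_relation x Nk.
apply: (chain_independent pp sub px R0); rewrite xR.
by have [] := pp k (leqnn k).
Qed.
End KrullDimension.

Lemma prime_ideal_prod (S : comUnitRingType) (p : S -> Prop) u (s : seq S) :
  prime_ideal p -> u \is a GRing.unit -> p (u * \prod_(x <- s) x) ->
  exists2 x, x \in s & p x.
Proof.
move=> [_ _ pm p1 pM] uu /pM[|]; first by move=> /(pm u^-1); rewrite mulVr // => /p1.
elim: s => [|a s IH]; first by rewrite big_nil => /p1.
rewrite big_cons => /pM[pa|/IH [x xs px]]; first by exists a; rewrite ?mem_head.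
by exists x; rewrite // inE xs orbT.
Qed.

Lemma prime_ideal_preim (S T : comNzRingType) (f : {rmorphism S -> T}) (p : T -> Prop) :
  prime_ideal p -> prime_ideal (fun a => p (f a)).
Proof.
move=> [p0 pd pm p1 pM]; split.
- by rewrite rmorph0.
- by move=> a b pa pb; rewrite rmorphD; exact: pd.
- by move=> a b pb; rewrite rmorphM; exact: pm.
- by rewrite rmorph1.
- by move=> a b; rewrite rmorphM; exact: pM.
Qed.

Lemma prime_ideal0 (S : idomainType) : prime_ideal (fun a : S => a = 0).
Proof.
split=> [//|a b -> ->|a b ->|/eqP|a b /eqP]; rewrite ?addr0 ?mulr0 ?oner_eq0 //.
by rewrite mulf_eq0 => /orP[]/eqP; [left|right].
Qed.

Lemma prime_ideal_rdvd (S : idomainType) (h : S) : prime_elt h -> prime_ideal (rdvd h).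
Proof.
move=> [h0 hu hM]; split.
- exact: rdvd0.
- exact: rdvdD.
- by move=> a b; exact: rdvd_mull.
- by move=> [q qh]; move/negP: hu; apply; apply/unitrPr; exists q; rewrite mulrC.
- exact: hM.
Qed.

Lemma lsub_comp (K : closedFieldType) l m k (A : 'M[K]_(l, m)) (B : 'M[K]_(m, k)) G :
  lsub A (lsub B G) = lsub (A *m B) G.
Proof. by apply: ev_inj => w; rewrite !ev_lsub mulmxA. Qed.

Lemma lsub1 (K : closedFieldType) m (G : {mpoly K[m]}) : lsub 1%:M G = G.
Proof. by apply: ev_inj => w; rewrite !ev_lsub mulmx1. Qed.

(** The rows of V are completed by a basis of the left kernel of C; the inverse matrix then begins
    with the columns of C. *)
Lemma matrix_completion (K : fieldType) m N (V : 'M[K]_(m, N)) (C : 'M[K]_(N, m)) :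
  V *m C = 1%:M -> exists M M' : 'M[K]_N, [/\ M *m M' = 1%:M, M' *m M = 1%:M &
    forall (i : 'I_m) (j : 'I_N), i = j :> nat -> col j M = col i C /\ row j M' = row i V].
Proof.
move=> VC.
have rV : row_free V by apply/row_freeP; exists C.
have rC : \rank C = m.
  apply/eqP; rewrite -mxrank_tr; apply/row_freeP; exists V^T.
  by rewrite -trmx_mul VC trmx1.
have mN : (m <= N)%N by rewrite -(eqP rV) rank_leq_col.
move: V C VC rV rC; rewrite -(subnKC mN); move: (N - m)%N => k V C VC rV rC.
have [W WC rW] : exists2 W : 'M[K]_(k, m + k), W *m C = 0 & row_free W.
  have ex r : \rank (kermx C) = r -> exists2 W : 'M[K]_(r, m + k), W *m C = 0 & row_free W.
    move=> <-; exists (row_base (kermx C)); last exact: row_base_free.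
    by apply/sub_kermxP; rewrite eq_row_base.
  by apply: ex; rewrite mxrank_ker rC addKn.
pose M' := col_mx V W.
have uM' : M' \in unitmx.
  rewrite -row_free_unit -kermx_eq0 -submx0; apply/rV_subP => u /sub_kermxP.
  rewrite -[u]hsubmxK mul_row_col => h.
  have u1 : lsubmx u = 0.
    have := congr1 (mulmx^~ C) h.
    by rewrite mulmxDl -!mulmxA VC WC mulmx1 mulmx0 addr0 mul0mx.
  move: h; rewrite u1 mul0mx add0r => /sub_kermxP.
  by move: rW; rewrite -kermx_eq0 => /eqP ->; rewrite submx0 => /eqP ->; rewrite row_mx0 sub0mx.
exists (invmx M'), M'; split; [exact: mulVmx|exact: mulmxV|].
move=> i j ij; have -> : j = lshift k i by apply: val_inj.
split; last by rewrite rowKu.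
have CE : C = invmx M' *m col_mx 1%:M 0.
  by apply: (canRL (mulKmx uM')); rewrite mul_col_mx VC WC.
rewrite {1}CE !colE -mulmxA; congr (_ *m _); rewrite mul_col_mx mul1mx mul0mx.
apply/colP => a; have := fintype.splitK a; case: (fintype.split a) => b /= <-.
  by rewrite col_mxEu !mxE eq_lshift.
by rewrite col_mxEd !mxE eq_rlshift.
Qed.

Section ProjectiveEquivalence.
Variables (K : closedFieldType).

Lemma on_ptrans N (M : 'M[K]_N.+1) (uM : M \in unitmx) P v :
  on P v -> on (ptrans uM P) (v *m M).
Proof.
move=> [vP v0]; split; last first.
  by apply: contraNneq v0 => /(canRL (mulmxK uM)); rewrite mul0mx => ->.
by rewrite -[v *m M](lfunE (mulmxr M) v); exact: memv_img.
Qed.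

Lemma proj_equiv_lsub N (F : {mpoly K[N.+1]}) (M M' : 'M[K]_N.+1) :
  M *m M' = 1%:M -> M' *m M = 1%:M -> proj_equiv (zero_locus F) (zero_locus (lsub M' F)).
Proof.
move=> MM' M'M; have uM : M \in unitmx by case: (mulmx1_unit MM').
exists M, uM; apply/seteqP; split=> [_ [P PF <-]|Q QF].
  have [v oP] := on_exists P; apply/(vanishes_on _ (on_ptrans uM oP)) => t.
  rewrite ev_lsub -scalemxAl -mulmxA MM' mulmx1.
  exact: (iffLR (vanishes_on _ oP) PF).
have [w oQ] := on_exists Q.
have w0 : w *m M' != 0.
  apply/eqP => /(congr1 (mulmx^~ M)) /eqP.
  by rewrite -mulmxA M'M mulmx1 mul0mx; apply/negP; case: oQ.
have [P oP] := point_exists w0; exists P.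
  apply/(vanishes_on _ oP) => t.
  by have := iffLR (vanishes_on _ oQ) QF t; rewrite ev_lsub -scalemxAl.
by have := on_ptrans uM oP; rewrite -mulmxA M'M mulmx1 => oQ'; exact: on_inj oQ' oQ.
Qed.

(** Equality of point sets suffices: by [nullstellensatz] the equation of X divides the transformed
    T, and equal degrees make the quotient constant. *)
Lemma equation_of_proj_equiv n d (X : hypersurface K n d) T :
  (0 < d)%N -> T \is d.-homog -> T != 0 -> proj_equiv (hpoints X) (zero_locus T) ->
  exists M M' a, [/\ M *m M' = 1%:M, M' *m M = 1%:M & heq X = a *: lsub M T].
Proof.
move=> d0 hT T0 [M [uM XT]].
have MM' : M *m invmx M = 1%:M by exact: mulmxV.
have M'M : invmx M *m M = 1%:M by exact: mulVmx.
have T_lsub : T = lsub (invmx M) (lsub M T) by rewrite lsub_comp M'M lsub1.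
have hG : lsub M T \is d.-homog by exact: dhomog_lsub.
have [v Fv] := mpoly_nonroot (heq_neq0 X).
have v0 : v != 0.
  apply: contraNneq Fv => ->; have := iffLR (dhomog_ev _ _) (heq_homog X) 0 0.
  by rewrite scaler0 expr0n (gtn_eqF d0) mul0r => ->.
have [c vc] := dual_vector v0; have [A [B fr]] := frame_exists vc.
have [w|Q GE] := nullstellensatz fr Fv d0 (G := lsub M T).
  have [->|w0] := eqVneq w 0.
    move=> _; have := iffLR (dhomog_ev _ _) hG 0 0.
    by rewrite scaler0 expr0n (gtn_eqF d0) mul0r => ->.
  have [P oP] := point_exists w0; move=> /(hpoints_ev X oP) XP.
  have : zero_locus T (ptrans uM P) by rewrite -XT; exists P.
  by move=> /(iffLR (vanishes_homog (on_ptrans uM oP) hT)); rewrite ev_lsub.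
have GE' : lsub M T = pihomog mdeg 0 Q * heq X.
  have := pihomogM Q 0 (heq_homog X); rewrite add0n -GE => <-.
  by apply/esym/pihomog_dE.
have [b bE] : exists b : K, pihomog mdeg 0 Q = b%:MP.
  exists (ev 0 (pihomog mdeg 0 Q)); apply: ev_inj => w; rewrite evC.
  have := iffLR (dhomog_ev _ _) (pihomogP mdeg 0 Q) 0 w.
  by rewrite scale0r expr0 mul1r.
have b0 : b != 0.
  apply: contraNneq T0 => b0; rewrite T_lsub GE' bE b0 mpolyC0 mul0r.
  by rewrite -mpolyC0 lsubC.
exists M, (invmx M), b^-1; split=> //.
by rewrite GE' bE mul_mpolyC scalerA mulVf // scale1r.
Qed.
End ProjectiveEquivalence.

(** * Systems of Galois points *)

Section GaloisSystem.
Variables (K : closedFieldType) (n d : nat) (X : hypersurface K n d).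
Hypothesis charK : [pchar K] =i pred0.
Hypothesis d_gt2 : (2 < d)%N.
Hypothesis Delta_fin : finite_set (outer_galois_points X).
Local Notation F := (heq X).
Let d_gt0 : (0 < d)%N. Proof. exact: ltn_trans d_gt2. Qed.

Variables (m : nat) (V : 'M[K]_(m, n.+2)) (C : 'M[K]_(n.+2, m)).
Hypothesis VC : V *m C = 1%:M.
Hypothesis good : forall i, good_center X (row i V) (col i C).

Lemma row_mul_col i j : (row i V *m col j C) 0 0 = (i == j)%:R.
Proof. by have := congr1 (fun A : 'M_m => A i j) VC; rewrite !mxE => <-; apply: eq_bigr => k _; rewrite !mxE. Qed.

(** The projector onto the common zeros of the m linear forms, along the span of the m points. *)
Let e : 'M[K]_n.+2 := 1%:M - C *m V.

Let Ve : V *m e = 0.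
Proof. by rewrite mulmxBr mulmx1 mulmxA VC mul1mx subrr. Qed.
Let eC : e *m C = 0.
Proof. by rewrite mulmxBl mul1mx -mulmxA VC mulmx1 subrr. Qed.
Let ee : e *m e = e.
Proof. by rewrite {2}/e mulmxBr mulmx1 mulmxA eC mul0mx subr0. Qed.

Let dird_lin_d (u : 'rV[K]_n.+2) c : dird u (lin c ^+ d) = ((u *m c) 0 0 *+ d) *: lin c ^+ d.-1.
Proof. by rewrite -{1}(prednK d_gt0) dird_lin_exp prednK. Qed.

(** The difference H of F and the sum of powers has zero derivative along every row of V, so H(x) =
    H(x e); at x e the linear forms vanish, and only F contributes. *)
Lemma heq_decomposition :
  F = \sum_i ev (row i V) F *: lin (col i C) ^+ d + lsub e F.
Proof.
set S := \sum_i _; pose H := F - S.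
have dH i : dird (row i V) H = 0.
  have [_ _ dF] := good i.
  rewrite /H -scaleN1r dirdD dirdZ dF /S dird_sum (bigD1 i) //= big1 => [|j ji].
    rewrite addr0 dirdZ dird_lin_d.
    by rewrite row_mul_col eqxx scaleN1r scalerA mulrnAr mulr1 subrr.
  rewrite dirdZ dird_lin_d row_mul_col eq_sym (negPf ji).
  by rewrite mul0rn scale0r scaler0.
have HE x : ev (x *m e) H = ev x H.
  have -> : x *m e = x + \sum_i (- (x *m C) 0 i) *: row i V.
    rewrite mulmxBr mulmx1 mulmxA [x *m C *m V]mulmx_sum_row; congr (_ + _).
    by rewrite -sumrN; apply: eq_bigr => i _; rewrite scaleNr.
  have key r : forall z, ev (z + \sum_(i <- r) (- (x *m C) 0 i) *: row i V) H = ev z H.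
    elim: r => [|i r IH] z; first by rewrite big_nil addr0.
    by rewrite big_cons addrA IH dird_eq0_ev.
  exact: key.
apply/eqP; rewrite addrC -subr_eq; apply/eqP/ev_inj => x.
rewrite -/H -HE ev_lsub /H.
have -> : ev (x *m e) (F - S) = ev (x *m e) F - ev (x *m e) S by exact: rmorphB.
rewrite /S ev_sum big1 ?subr0 // => i _.
rewrite evZ ev_exp ev_lin colE !mulmxA -(mulmxA x) eC mulmx0 mul0mx mxE.
by rewrite expr0n (gtn_eqF d_gt0) mulr0.
Qed.

(** Otherwise F would be a polynomial in the m linear forms alone, hence a cone with vertex [u]. *)
Lemma lsub_neq0 (i0 : 'I_m) (u : 'rV[K]_n.+2) : u != 0 -> u *m C = 0 -> lsub e F != 0.
Proof.
move=> u0 uC; apply/eqP => F0; apply: (not_cone charK d_gt2 Delta_fin (good i0) u0).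
rewrite heq_decomposition F0 addr0 dird_sum big1 // => i _.
rewrite dirdZ dird_lin_d colE mulmxA uC mul0mx mxE.
by rewrite mul0rn scale0r scaler0.
Qed.

(** At a singular point the derivative of F along the i-th point, a nonzero multiple of c_i^(d-1),
    vanishes. *)
Lemma sing_mulC P (u : 'rV[K]_n.+2) : hsing X P -> on P u -> u *m C = 0.
Proof.
move=> sP oP; have [_ dF] := iffLR (hsing_ev X d_gt0 oP) sP.
apply/rowP => i; have [Fv _ dvF] := good i.
have := congr1 (ev u) dvF; rewrite {1}/dird ev_sum big1 => [|j _]; last first.
  by rewrite evZ dF mulr0.
rewrite evZ ev_exp ev_lin colE mulmxA -colE mxE => /esym/eqP.
rewrite -mulr_natr !mulf_eq0 (negPf Fv) (negPf (natK_neq0 charK _)) //= expf_eq0.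
by move=> /andP[_ /eqP ->]; rewrite mxE.
Qed.

Lemma sing_lsub P G : hsing X P -> vanishes_at (lsub e G) P <-> vanishes_at G P.
Proof.
move=> sP; have [u oP] := on_exists P.
have ue : u *m e = u by rewrite mulmxBr mulmx1 mulmxA (sing_mulC sP oP) mul0mx subr0.
split=> h; apply/(vanishes_on _ oP) => t; have := iffLR (vanishes_on _ oP) h t;
  by rewrite ev_lsub -scalemxAl ue.
Qed.

Lemma irreducible_prime_ideal (Z : set (pspace K n.+1)) :
  irreducible_closed Z -> prime_ideal (ideal_of Z).
Proof.
move=> /irreducibleP [_ [P ZP] ZM]; split.
- move=> Q _; have [w oQ] := on_exists Q; apply/(vanishes_on _ oQ) => t.
  exact: raddf0.
- by move=> A B hA hB Q ZQ; apply: vanishesD; [exact: hA|exact: hB].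
- by move=> A B hB Q ZQ; apply/vanishesM; right; exact: hB.
- move=> /(_ P ZP); have [w oP] := on_exists P; move=> /(iffLR (vanishes_on _ oP)) /(_ 0).
  by rewrite -mpolyC1 evC => /eqP; rewrite oner_eq0.
- exact: ZM.
Qed.

(** [dj] selects the first j points; [ej j] is the analogue of [e] for them, with [ej m = e]. *)
Let dj (j : nat) : 'M[K]_m := diag_mx (\row_a (a < j)%N%:R).
Let ej (j : nat) : 'M[K]_n.+2 := 1%:M - C *m dj j *m V.

Let ej_m : ej m = e.
Proof.
rewrite /ej (_ : dj m = 1%:M) ?mulmx1 //; apply/matrixP => a b.
by rewrite !mxE ltn_ord.
Qed.
Let ej_C j : ej j *m C = C *m (1%:M - dj j).
Proof. by rewrite mulmxBl mul1mx -!mulmxA VC mulmx1 mulmxBr mulmx1. Qed.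
Let ej_S j : ej j.+1 *m ej j = ej j.+1.
Proof.
rewrite {2}/ej mulmxBr mulmx1 !mulmxA ej_C -[C *m _ *m dj j]mulmxA mulmxBl mul1mx.
have -> : dj j.+1 *m dj j = dj j.
  rewrite mulmx_diag; congr diag_mx; apply/rowP => a; rewrite !mxE.
  case: (ltnP a j) => h; last by rewrite mulr0.
  by rewrite ltnS ltnW // mulr1.
by rewrite subrr mulmx0 mul0mx subr0.
Qed.
Let vanishing j : {mpoly K[n.+2]} -> Prop := fun B => lsub (ej j) B = 0.

Let vanishing_prime j : prime_ideal (vanishing j).
Proof. exact: (prime_ideal_preim (lsub (ej j)) (prime_ideal0 _)). Qed.

Let vanishing_sub j B : vanishing j B -> vanishing j.+1 B.
Proof. by rewrite /vanishing -(ej_S j) -lsub_comp => ->; exact: raddf0. Qed.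

Let vanishing_strict j : (j < m)%N -> exists2 B, vanishing j.+1 B & ~ vanishing j B.
Proof.
move=> jm; pose i := Ordinal jm; exists (lin (col i C)); rewrite /vanishing lin_mul.
  rewrite colE mulmxA ej_C -mulmxA mulmxBl mul1mx -[dj _ *m _]colE.
  rewrite (_ : _ - _ = 0) ?mulmx0; last first.
    by apply/colP => a; rewrite !mxE andbT [a == i]eq_sym; case: eqP => [<-|]; rewrite ?ltnSn subrr.
  by rewrite /lin big1 // => a _; rewrite mxE scale0r.
move=> /(congr1 (ev (row i V))); rewrite ev_lin rowE colE.
have -> : delta_mx 0 i *m V *m (ej j *m (C *m delta_mx i 0)) =
    delta_mx 0 i *m (1%:M - dj j) *m delta_mx i 0 :> 'M_1.
  by rewrite (mulmxA (ej j)) ej_C -!mulmxA (mulmxA V) VC mul1mx.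
have -> : ev (delta_mx 0 i *m V) 0 = 0 by exact: raddf0.
rewrite -rowE -colE !mxE eqxx ltnn mul0rn subr0 => /eqP.
by rewrite oner_eq0.
Qed.

(* The chain: irrelevant ideal > I(Z 0) > ... > I(Z r) > q > (c_0, ..., c_(j-1))
   > ... > (c_0) > 0, the ideal of the first j linear forms being the kernel of
   lsub (ej j). *)
Lemma prime_chain_bound r (Z : nat -> set (pspace K n.+1)) (q : {mpoly K[n.+2]} -> Prop) j :
  (j <= m)%N ->
  (forall i, (i <= r)%N -> irreducible_closed (Z i)) ->
  (forall i, (i < r)%N -> Z i `<` Z i.+1) ->
  prime_ideal q -> (forall B, q B -> ideal_of (Z r) B) ->
  (exists2 B, ideal_of (Z r) B & ~ q B) ->
  (forall B, lsub (ej j) B = 0 -> q B) -> (exists2 B, q B & lsub (ej j) B <> 0) ->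
  (r + j < n)%N.
Proof.
move=> jm irr str pq qsub qstr subq strq.
pose p i : {mpoly K[n.+2]} -> Prop :=
  if i == 0%N then fun B => ev 0 B = 0 else if (i <= r.+1)%N then ideal_of (Z i.-1)
  else if (i == r.+2)%N then q else vanishing (j - (i - r.+3)).
(* Indices 0 to r + j + 3: the irrelevant ideal, r + 1 ideals of the Z i, then q, and j + 1 ideals
   ending with 0, in a ring of n + 2 variables. *)
suff : (r + j + 3 <= n.+2)%N by lia.
have p0 : p 0%N = fun B => ev 0 B = 0 by [].
have pZ i : (i <= r)%N -> p i.+1 = ideal_of (Z i) by move=> ir; rewrite /p /= ltnS ir.
have pq' : p r.+2 = q by rewrite /p /= ltnn eqxx.
have pv i : (i <= j)%N -> p (r.+3 + i)%N = vanishing (j - i).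
  move=> ij; have -> : (j - i = j - (r.+3 + i - r.+3))%N by lia.
  by rewrite /p !ifN //; lia.
have cases i : (i <= r + j + 3)%N -> [\/ i = 0%N, exists2 k, (k <= r)%N & i = k.+1, i = r.+2 |
    exists2 k, (k <= j)%N & i = (r.+3 + k)%N].
  case: i => [|i] hi; first by constructor 1.
  case: (leqP i r) => ir; first by constructor 2; exists i.
  case: (eqVneq i r.+1) => [->|ir']; first by constructor 3.
  by constructor 4; exists (i.+1 - r.+3)%N; lia.
apply: (prime_chain_length (p := p)).
- move=> i /cases[->|[k kr ->]|->|[k kj ->]].
  + rewrite p0; exact: (prime_ideal_preim (ev 0) (prime_ideal0 _)).
  + by rewrite pZ //; apply: irreducible_prime_ideal; exact: irr.
  + by rewrite pq'.
  + by rewrite pv.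
- move=> i a ij; case: (cases i (ltnW ij)) => [iE|[k kr iE]|iE|[k kj iE]]; rewrite iE in ij *.
  + rewrite pZ // p0 => ha; have /irreducibleP [_ [P ZP] _] := irr 0%N (leq0n _).
    have [w oP] := on_exists P; have := iffLR (vanishes_on _ oP) (ha P ZP) 0.
    by rewrite scale0r.
  + case: (ltnP k r) => kr'.
      rewrite !pZ // => ha P ZP; apply: ha; have [+ _] := str k kr'; exact.
    have -> : k = r by lia.
    by rewrite pq' pZ //; exact: qsub.
  + rewrite pq' -(addn0 r.+3) (pv 0%N (leq0n _)) subn0; exact: subq.
  + rewrite pv // -addnS pv; last lia.
    have -> : (j - k = (j - k.+1).+1)%N by lia.
    exact: (@vanishing_sub (j - k.+1) a).
- move=> i ij; case: (cases i (ltnW ij)) => [iE|[k kr iE]|iE|[k kj iE]]; rewrite iE in ij *.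
  + rewrite pZ // p0; have /irreducibleP [_ [P ZP] _] := irr 0%N (leq0n _).
    have [w oP] := on_exists P; have /rV0Pn [l wl] := proj2 oP.
    exists 'X_l; first by rewrite evX mxE.
    move=> /(_ P ZP) /(iffLR (vanishes_on _ oP)) /(_ 1); rewrite scale1r evX => /eqP.
    by rewrite (negPf wl).
  + case: (ltnP k r) => kr'.
      rewrite !pZ //; have [_ /existsNP [P /not_implyP [ZP nZP]]] := str k kr'.
      have [cZ _ _] := irr k kr.
      have [B [l [hB _ nB]]] := closed_separate cZ nZP.
      by exists B => // /(_ P ZP).
    have -> : k = r by lia.
    by rewrite pq' pZ.
  + rewrite pq' -(addn0 r.+3) (pv 0%N (leq0n _)) subn0; exact: strq.
  + rewrite pv // -addnS pv; last lia.
    have -> : (j - k = (j - k.+1).+1)%N by lia.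
    by apply: (@vanishing_strict (j - k.+1)); lia.
Qed.

Section SingularChain.
Variables (i0 : 'I_m) (r : nat) (Z : nat -> set (pspace K n.+1)).
Hypothesis Z_irr : forall i, (i <= r)%N -> irreducible_closed (Z i).
Hypothesis Z_sing : forall i, (i <= r)%N -> Z i `<=` hsing X.
Hypothesis Z_strict : forall i, (i < r)%N -> Z i `<` Z i.+1.

Let m_gt0 : (0 < m)%N. Proof. exact: leq_ltn_trans (ltn_ord i0). Qed.

Let eF_neq0 : lsub e F != 0.
Proof.
have /irreducibleP [_ [P ZP] _] := Z_irr (leq0n r); have [w oP] := on_exists P.
exact: (lsub_neq0 i0 (proj2 oP) (sing_mulC (Z_sing (leq0n r) ZP) oP)).
Qed.

Let lsub_ideal B : ideal_of (Z r) (lsub e B) <-> ideal_of (Z r) B.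
Proof.
by split=> hB P ZP; have sP := Z_sing (leqnn r) ZP; have := hB P ZP;
  have [h1 h2] := sing_lsub B sP; [exact: h1|exact: h2].
Qed.

Let F_ideal : ideal_of (Z r) F.
Proof. by move=> P /(Z_sing (leqnn r)) []. Qed.

Lemma galois_system_bound : (r + m <= n)%N.
Proof.
(* The ideal of all m forms takes the place of q, so j = m - 1. It is strictly smaller than the
   ideal of Z r, which contains F, because [lsub e F] is nonzero. *)
have h := @prime_chain_bound r Z (vanishing m) m.-1 (leq_pred m) Z_irr Z_strict
  (vanishing_prime m).
have e0 B : vanishing m B = (lsub e B = 0) by rewrite /vanishing ej_m.
rewrite -(prednK m_gt0) addnS; apply: h.
- move=> B; rewrite e0 => hB; apply/lsub_ideal; rewrite hB.
  by have [] := irreducible_prime_ideal (Z_irr (leqnn r)).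
- by exists F; [exact: F_ideal|rewrite e0; exact/eqP].
- by move=> B; have := @vanishing_sub m.-1 B; rewrite prednK.
- have := @vanishing_strict m.-1; rewrite prednK // => /(_ (leqnn m)) [B hB nB].
  by exists B.
Qed.

(* Some prime factor H of G = lsub e F vanishes on Z r.  The chain being of
   maximal length, the ideal of Z r is {B : H | lsub e B}; it contains the partial
   derivatives of F, so H divides those of G. *)
Lemma multiple_factor : (r + m = n)%N ->
  exists2 H, (forall c : K, H != c%:MP) & mp_dvd (H ^+ 2) (lsub e F).
Proof.
move=> rm; have pZ := irreducible_prime_ideal (Z_irr (leqnn r)).
have [u [s [uu ps sE]]] := ufd_mpoly eF_neq0.
have [H Hs HZ] : exists2 H, H \in s & ideal_of (Z r) H.
  by apply: (prime_ideal_prod pZ uu); rewrite -sE; apply/lsub_ideal; exact: F_ideal.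
have pH := ps H Hs; have [H0 Hu HM] := pH.
have HF : rdvd H (lsub e F).
  by rewrite sE (big_rem H) //= mulrCA; exists (u * \prod_(y <- rem H s) y); rewrite mulrC.
have eB B : lsub e (lsub e B) = lsub e B by rewrite lsub_comp ee.
have HZr B : ideal_of (Z r) B -> rdvd H (lsub e B).
  move=> ZB; apply: contrapT => nB.
  suff : (r + m < n)%N by rewrite rm ltnn.
  apply: (@prime_chain_bound r Z (fun B => rdvd H (lsub e B)) m (leqnn m) Z_irr Z_strict).
  - exact: (prime_ideal_preim (lsub e) (prime_ideal_rdvd pH)).
  - move=> G [Q GE]; apply/lsub_ideal; rewrite GE.
    by have [_ _ pm _ _] := pZ; exact: pm.
  - by exists B.
  - by rewrite ej_m => G ->; exact: rdvd0.
  - by exists F => //; rewrite ej_m; exact/eqP.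
have HdF i : rdvd H (lsub e F)^`M(i).
  rewrite mderiv_lsub; apply: HZr => P ZP.
  have [w oP] := on_exists P; have [_ dF] := Z_sing (leqnn r) ZP.
  apply/(vanishes_on _ oP) => t; rewrite /dird ev_sum big1 // => j _.
  by rewrite evZ (iffLR (vanishes_on _ oP) (dF j)) mulr0.
have Hc (c : K) : H != c%:MP.
  apply/eqP => Hc; have c0 : c != 0 by apply: contraNneq H0 => c0; rewrite Hc c0 mpolyC0.
  move/negP: Hu; apply; rewrite Hc; apply: (rmorph_unit (@mpolyC n.+2 K)).
  by rewrite unitfE.
exists H => //; have [Q FE] := HF.
(* Differentiate G = Q H: H divides the derivative of G, hence Q times that of H. *)
have dQH i : rdvd H Q \/ rdvd H H^`M(i).
  apply: HM; have := HdF i; rewrite FE mderivM => h.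
  have -> : Q * H^`M(i) = Q^`M(i) * H + Q * H^`M(i) - Q^`M(i) * H by rewrite addrC addKr.
  by apply: rdvdB => //; exists (Q^`M(i)).
have [[Q' QE]|nQ] := pselect (rdvd H Q); first by exists Q'; rewrite FE QE expr2 mulrA.
(* Otherwise H divides all its partial derivatives. Having smaller degree they vanish, so in
   characteristic 0 H would be constant. *)
case/negP: (Hc (ev 0 H)); apply/eqP/ev_inj => x; rewrite evC.
have -> : x = 0 + 1 *: x by rewrite scale1r add0r.
rewrite dird_eq0_ev // /dird big1 // => i _.
suff -> : H^`M(i) = 0 by rewrite scaler0.
have [//|[q HE]] := dQH i; apply/eqP; apply: contraT => dH0.
have q0 : q != 0 by apply: contraNneq dH0 => q0; rewrite HE q0 mul0r.
have : (msize H <= msize H^`M(i))%N.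
  rewrite HE msizeM //; have : (0 < msize q)%N by rewrite lt0n msize_poly_eq0.
  by move: (msize q) (msize H) => a b; lia.
rewrite -(mlead_deg dH0); have := mlead_supp dH0.
rewrite mcoeff_msupp mcoeff_deriv => h.
have : (mlead H^`M(i) + U_(i))%MM \in msupp H.
  by rewrite mcoeff_msupp; apply: contraNneq h => ->; rewrite mul0rn.
by move=> /msize_mdeg_lt; rewrite mdegD mdeg1 => h1 h2; lia.
Qed.
End SingularChain.
End GaloisSystem.

Lemma dird_lsub (K : closedFieldType) l k (A : 'M[K]_(l, k)) u G :
  dird u (lsub A G) = lsub A (dird (u *m A) G).
Proof.
apply: ev_inj => w; rewrite ev_lsub /dird !ev_sum.
under eq_bigr => i _ do rewrite evZ mderiv_lsub ev_lsub /dird ev_sum mulr_sumr.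
rewrite exchange_big; apply: eq_bigr => j _; rewrite evZ mxE mulr_suml.
by apply: eq_bigr => i _; rewrite evZ mxE mulrA.
Qed.

(** * From systems of Galois points to equations and back *)

Section Systems.
Variables (K : closedFieldType) (n d : nat) (X : hypersurface K n d).
Hypothesis charK : [pchar K] =i pred0.
Hypothesis d_gt2 : (2 < d)%N.
Local Notation F := (heq X).
Let d_gt0 : (0 < d)%N. Proof. exact: ltn_trans d_gt2. Qed.

Definition galois_system m (V : 'M[K]_(m, n.+2)) (C : 'M[K]_(n.+2, m)) :=
  V *m C = 1%:M /\ forall i, good_center X (row i V) (col i C).

(** The dual linear forms separate the rows of V, so these are m distinct points. *)
Lemma system_card m (V : 'M[K]_(m, n.+2)) (C : 'M[K]_(n.+2, m)) :
  galois_system V C -> (`I_m #<= outer_galois_points X)%card.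
Proof.
move=> [VC good].
have ex (k : nat) : exists P : pspace K n.+1, forall h : (k < m)%N, on P (row (Ordinal h) V).
  have [km|mk] := pselect (is_true (k < m)%N); last first.
    have h0 : delta_mx 0 ord0 != 0 :> 'rV[K]_n.+2.
      by apply/eqP => /rowP /(_ ord0); rewrite !mxE eqxx => /eqP; rewrite oner_eq0.
    by have [P _] := point_exists h0; exists P => h; case: (mk h).
  have v0 : row (Ordinal km) V != 0.
    apply/eqP => h; have [_ + _] := good (Ordinal km); rewrite h mul0mx => /matrixP /(_ 0 0).
    by rewrite !mxE => /eqP; rewrite eq_sym oner_eq0.
  by have [P oP] := point_exists v0; exists P => h; rewrite (bool_irrelevance h km).
have [f fP] := choice ex.
have f_inj : {in `I_m &, injective f}.
  move=> k l; rewrite !in_setE /= => km lm fkl; have := fP l lm; rewrite -fkl.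
  move=> /(on_proportional (fP k km)) [a a0 h].
  have := congr1 (fun w : 'rV_n.+2 => (w *m col (Ordinal lm) C) 0 0) h.
  rewrite (row_mul_col VC) eqxx -scalemxAl [RHS]mxE (row_mul_col VC).
  by case: eqP => [[]//|_ /eqP]; rewrite mulr0 oner_eq0.
apply: card_le_trans (subset_card_le (A := f @` `I_m) _).
  by have /card_eqPle[] := inj_card_eq f_inj.
by move=> _ [k km <-]; exact: (good_galois charK d_gt2 (good _) (fP k km)).
Qed.

Lemma system_bound m (V : 'M[K]_(m, n.+2)) (C : 'M[K]_(n.+2, m)) :
  galois_system V C -> (m <= n.+2)%N.
Proof.
move=> [VC _]; have : row_free V by apply/row_freeP; exists C.
by move=> /eqP <-; exact: rank_leq_col.
Qed.

Lemma good_scale v c a : a != 0 -> good_center X v c -> good_center X (a *: v) (a^-1 *: c).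
Proof.
move=> a0 [Fv vc dF]; have hF := iffLR (dhomog_ev _ _) (heq_homog X) a v.
split; first by rewrite hF mulf_neq0 // expf_neq0.
  by rewrite -scalemxAl -scalemxAr scalerA mulfV // scale1r.
have -> : a *: v = a *: v + 0 by rewrite addr0.
rewrite dird_is_linear_dir addr0 {2}/dird big1 ?addr0; last by move=> i _; rewrite mxE scale0r.
rewrite dF hF linZ exprZn !scalerA; congr (_ *: _).
have ad : a ^+ d = a * a ^+ d.-1 by rewrite -exprS prednK.
have : a ^+ d.-1 != 0 by rewrite expf_neq0.
rewrite ad exprVn -(mulr_natr (ev v F)) -(mulr_natr (_ * ev v F)).
move: (ev v F) (a ^+ d.-1) d%:R => p q k q0; field.
exact: q0.
Qed.

Lemma dth_root (b : K) : exists a, a ^+ d = b.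
Proof.
have [a aE] := solve_monicpoly (fun k => if k == 0%N then b else 0) d_gt0.
exists a; rewrite aE -(prednK d_gt0) big_ord_recl big1 => [|j _]; last by rewrite mul0r.
by rewrite expr0 mulr1 addr0.
Qed.

(** Each point is rescaled by a d-th root of 1 / F(v), and its form inversely; this removes the
    coefficients of the powers. *)
Lemma system_normalize m (V : 'M[K]_(m, n.+2)) (C : 'M[K]_(n.+2, m)) :
  galois_system V C -> exists V' C', galois_system V' C' /\
    forall i : 'I_m, ev (row i V') F = 1.
Proof.
move=> [VC good].
have ex (i : 'I_m) : exists a : K, a ^+ d * ev (row i V) F = 1.
  have [Fv _ _] := good i.
  by have [a aE] := dth_root (ev (row i V) F)^-1; exists a; rewrite aE mulVf.
have [a aP] := choice ex.
have a0 i : a i != 0.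
  by apply/eqP => h; have := aP i; rewrite h expr0n (gtn_eqF d_gt0) mul0r => /eqP; rewrite eq_sym oner_eq0.
pose V' : 'M[K]_(m, n.+2) := \matrix_(i, j) (a i * V i j).
pose C' : 'M[K]_(n.+2, m) := \matrix_(i, j) ((a j)^-1 * C i j).
have rV i : row i V' = a i *: row i V by apply/rowP => j; rewrite !mxE.
have cC j : col j C' = (a j)^-1 *: col j C by apply/colP => i; rewrite !mxE.
exists V', C'; split; first split.
- apply/matrixP => i j; have h := congr1 (fun A : 'M_m => A i j) VC.
  transitivity (a i / a j * (1%:M : 'M[K]_m) i j).
    rewrite -h !mxE mulr_sumr; apply: eq_bigr => k _; rewrite !mxE.
    by rewrite -!mulrA; congr (_ * _); rewrite mulrCA.
  by rewrite mxE; case: eqP => [->|_]; rewrite ?mulr0 // mulfV // mulr1.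
- by move=> i; rewrite rV cC; exact: good_scale.
- by move=> i; rewrite rV (iffLR (dhomog_ev _ _) (heq_homog X)) aP.
Qed.

Lemma normal_form m (V : 'M[K]_(m, n.+2)) (C : 'M[K]_(n.+2, m)) :
  galois_system V C -> (forall i : 'I_m, ev (row i V) F = 1) ->
  exists M M', [/\ M *m M' = 1%:M, M' *m M = 1%:M,
    lsub M' F = \sum_(i < n.+2 | (i < m)%N) 'X_i ^+ d + lsub M' (lsub (1%:M - C *m V) F) &
    only_vars_from m (lsub M' (lsub (1%:M - C *m V) F))].
Proof.
move=> sys FV; have [VC good] := sys; have mn := system_bound sys.
have [M [M' [MM' M'M MV]]] := matrix_completion VC.
exists M, M'; split=> //.
- rewrite {1}(heq_decomposition charK d_gt2 VC good) rmorphD /=; congr (_ + _).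
  rewrite (big_ord_narrow mn) raddf_sum; apply: eq_bigr => i _ /=.
  rewrite FV scale1r lsub_exp lin_mul.
  have [<- _] := MV i (widen_ord mn i) erefl.
  by rewrite colE mulmxA M'M mul1mx lin_delta.
- move=> u uG i im; apply/eqP; rewrite -leqn0 leqNgt; apply/negP => ui.
  (* Row i of M' is the i-th point, which the projector kills. In characteristic 0 a vanishing
     derivative excludes every monomial that contains the variable. *)
  have dG : (lsub M' (lsub (1%:M - C *m V) F))^`M(i) = 0.
    have Ve : V *m (1%:M - C *m V) = 0 by rewrite mulmxBr mulmx1 mulmxA VC mul1mx subrr.
    rewrite lsub_comp mderiv_lsub row_mul; have [_ ->] := MV (Ordinal im) i erefl.
    rewrite -row_mul Ve row0.
    by rewrite /dird big1 ?raddf0 // => j _; rewrite mxE scale0r.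
  have := congr1 (mcoeff (u - U_(i))%MM) dG; rewrite mcoeff0 mcoeff_deriv submK; last first.
    by rewrite lep1mP -lt0n.
  move=> /eqP; rewrite -mulr_natr mulf_eq0 (negPf (natK_neq0 charK _)) // orbF.
  by apply/negP; rewrite -mcoeff_msupp.
Qed.

Lemma ev_delta_only_vars m (G : {mpoly K[n.+2]}) (i : 'I_n.+2) : G \is d.-homog ->
  only_vars_from m G -> (i < m)%N -> G^`M(i) = 0 /\ ev (delta_mx 0 i) G = 0.
Proof.
move=> hG oG im; split.
  apply/mpolyP => u; rewrite mcoeff0 mcoeff_deriv.
  suff -> : G@_(u + U_(i)) = 0 by rewrite mul0rn.
  apply: memN_msupp_eq0; apply/negP => /oG /(_ i im) /eqP.
  by rewrite mnmDE mnm1E eqxx addn1.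
rewrite /ev mevalE big_seq big1 // => u uG.
have [j uj] : exists j, u j != 0%N.
  apply/existsP; apply: contraT => /existsPn h.
  move/dhomogP: hG => /(_ u uG); rewrite /= mdegE big1 => [d0|j _].
    by move: d_gt0; rewrite -d0.
  by apply/eqP; have := h j; rewrite negbK.
have ij : j != i by apply: contraNneq uj => ->; rewrite (oG u uG i im).
by rewrite (bigD1 j) //= mxE (negPf ij) andbF expr0n (negPf uj) mul0r mulr0.
Qed.

Lemma system_of_form m G M M' a : (m <= n.+2)%N -> G \is d.-homog -> only_vars_from m G ->
  M *m M' = 1%:M -> M' *m M = 1%:M ->
  F = a *: lsub M (\sum_(i < n.+2 | (i < m)%N) 'X_i ^+ d + G) ->
  exists (V : 'M[K]_(m, n.+2)) (C : 'M[K]_(n.+2, m)), galois_system V C.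
Proof.
move=> mn hG oG MM' M'M FE; set T := _ + G in FE.
pose V : 'M[K]_(m, n.+2) := \matrix_(i, j) M' (widen_ord mn i) j.
pose C : 'M[K]_(n.+2, m) := \matrix_(i, j) M i (widen_ord mn j).
have rV i : row i V = delta_mx 0 (widen_ord mn i) *m M'.
  by rewrite -rowE; apply/rowP => j; rewrite !mxE.
have cC i : col i C = M *m delta_mx (widen_ord mn i) 0.
  by rewrite -colE; apply/colP => j; rewrite !mxE.
have a0 : a != 0 by apply: contraTneq (heq_neq0 X) => a0; rewrite FE a0 scale0r eqxx.
have TE (i : 'I_m) : ev (delta_mx 0 (widen_ord mn i)) T = 1 /\
    dird (delta_mx 0 (widen_ord mn i)) T = 'X_(widen_ord mn i) ^+ d.-1 *+ d.
  have [dG eG] := ev_delta_only_vars hG oG (ltn_ord i : widen_ord mn i < m)%N.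
  split.
    rewrite /T evD eG addr0 (big_ord_narrow mn) ev_sum (bigD1 i) //= big1 => [|j ji].
      by rewrite ev_exp evX mxE !eqxx expr1n addr0.
    rewrite ev_exp evX mxE eqxx -val_eqE /= val_eqE (negPf ji).
    by rewrite expr0n (gtn_eqF d_gt0).
  have dd (H : {mpoly K[n.+2]}) l : dird (delta_mx 0 l) H = H^`M(l).
    rewrite /dird (bigD1 l) //= big1 => [|k kl]; first by rewrite mxE !eqxx scale1r addr0.
    by rewrite mxE (negPf kl) andbF scale0r.
  rewrite /T dirdD (dd G) dG addr0 (big_ord_narrow mn) dird_sum (bigD1 i) //= big1 => [|j ji].
    by rewrite addr0 dird_exp dd mderivXU eqxx mulr1.
  by rewrite dird_exp dd mderivXU -val_eqE /= val_eqE (negPf ji) mulr0 mul0rn.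
exists V, C; split.
- apply/matrixP => i j; have := congr1 (fun A : 'M_n.+2 => A (widen_ord mn i) (widen_ord mn j)) M'M.
  by rewrite !mxE -[in RHS]val_eqE /= => <-; apply: eq_bigr => k _; rewrite !mxE.
- move=> i; have [T1 dT] := TE i.
  have Fv : ev (row i V) F = a.
    by rewrite FE evZ ev_lsub rV -mulmxA M'M mulmx1 T1 mulr1.
  split; first by rewrite Fv.
    rewrite rV cC mulmxA -(mulmxA _ M') M'M mulmx1 -rowE; apply/matrixP => k l.
    by rewrite !ord1 !mxE !eqxx.
  rewrite Fv FE dirdZ.
  have -> : dird (row i V) (lsub M T) = lsub M (dird (delta_mx 0 (widen_ord mn i)) T).
    by rewrite dird_lsub rV -mulmxA M'M mulmx1.
  rewrite dT cC -lin_mul lin_delta.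
  have H1 := raddfMn (lsub M) d ('X_(widen_ord mn i) ^+ d.-1).
  have H2 := rmorphXn (lsub M) d.-1 'X_(widen_ord mn i).
  by rewrite /= in H1 H2; rewrite H1 H2 -scaler_nat scalerA mulr_natr.
Qed.
End Systems.

(** The identity V C = 1 is [good_pair] off the diagonal and the normalization c(v) = 1 on it. *)
Lemma galois_system_exists (K : closedFieldType) (N d m : nat) (X : hypersurface K N.+1 d) :
  [pchar K] =i pred0 -> (2 < d)%N -> finite_set (outer_galois_points X) ->
  ~ has_chain (hsing X) N.+1 -> (`I_m #<= outer_galois_points X)%card ->
  exists (V : 'M[K]_(m, N.+3)) (C : 'M[K]_(N.+3, m)), galois_system X V C.
Proof.
move=> charK d_gt2 fin nch /card_leP [f].
have ex (i : 'I_m) : exists vc : 'rV[K]_N.+3 * 'cV[K]_N.+3,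
    on (val (f (exist _ (i : nat) (mem_set (ltn_ord i))))) vc.1 /\ good_center X vc.1 vc.2.
  set P := f _; have [v oP] := on_exists (val P).
  have PD : outer_galois_points X (val P) by have := valP P; rewrite in_setE.
  have [c gc] := galois_good charK (ltnW d_gt2) nch PD oP.
  by exists (v, c).
have [vc vcP] := choice ex.
exists (\matrix_i (vc i).1), (\matrix_(i, j) (vc j).2 i 0).
have rV i : row i (\matrix_i (vc i).1) = (vc i).1 by rewrite rowK.
have cC j : col j (\matrix_(i, j) (vc j).2 i 0) = (vc j).2 by apply/colP => i; rewrite !mxE.
split; last by move=> i; rewrite rV cC; case: (vcP i).
apply/matrixP => i j.
transitivity (((vc i).1 *m (vc j).2) 0 0).
  by rewrite !mxE; apply: eq_bigr => k _; rewrite !mxE.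
have [oi gi] := vcP i; have [oj gj] := vcP j.
have [<-|ij] := eqVneq i j.
  by have [_ -> _] := gi; rewrite !mxE !eqxx.
have [|_ ->] := good_pair charK d_gt2 fin gi gj oi oj; last by rewrite mxE (negPf ij).
move=> /val_inj h; move/eqP: ij; apply; apply: val_inj.
have := @inj _ _ _ f _ _ (in_setT _) (in_setT _) h.
by move=> /(congr1 val).
Qed.

Lemma card_le_bound T (A : set T) k : finite_set A ->
  (forall m, (`I_m #<= A)%card -> (m <= k)%N) -> (A #<= `I_k)%card.
Proof.
move=> /finite_setP [m Am] h; rewrite (card_le_eql Am) card_le_II; apply: h.
by move: Am => /card_eqPle[].
Qed.

Lemma form_homog (K : closedFieldType) n d m (G : {mpoly K[n.+2]}) : G \is d.-homog ->
  \sum_(i < n.+2 | (i < m)%N) 'X_i ^+ d + G \is d.-homog.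
Proof.
move=> hG; apply: rpredD => //; apply: rpred_sum => i _.
have := dhomogMn d (_ : 'X_i \is 1.-homog); rewrite mul1n; apply.
by rewrite dhomogX /= mdeg1.
Qed.

Lemma form_neq0 (K : closedFieldType) n d m (G : {mpoly K[n.+2]}) :
  (2 < d)%N -> (0 < m)%N -> G \is d.-homog -> only_vars_from m G ->
  \sum_(i < n.+2 | (i < m)%N) 'X_i ^+ d + G != 0.
Proof.
move=> d2 m0 hG oG; have d0 := ltn_trans (isT : 0 < 2)%N d2; apply/eqP => /(congr1 (ev (delta_mx 0 ord0))).
have [_ G0] := ev_delta_only_vars d2 hG oG (m0 : ((ord0 : 'I_n.+2) < m)%N).
rewrite evD G0 addr0 ev_sum (bigD1 ord0) //= big1 => [|i /andP[_ i0]].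
  rewrite ev_exp evX mxE !eqxx expr1n addr0.
  by move/eqP; rewrite [ev _ 0]raddf0 oner_eq0.
by rewrite ev_exp evX mxE (negPf i0) expr0n (gtn_eqF d0).
Qed.

Theorem theorem2 (K : closedFieldType) (charK : [pchar K] =i pred0)
    (n d : nat) (n_ge1 : (1 <= n)%N) (d_ge4 : (4 <= d)%N)
    (X : hypersurface K n d)
    (s : int) (s_dim : has_dim (hsing X) s) (s_le : s <= n%:Z - 2)
    (Delta_fin : finite_set (outer_galois_points X)) :
  (s = -1 ->
     (outer_galois_points X #<= `I_(n + 2))%card /\
     ((outer_galois_points X #= `I_(n + 2))%card <->
      proj_equiv (hpoints X) (zero_locus (fermat K n d)))) /\
  (forall r : nat, s = r%:Z ->
     (outer_galois_points X #<= `I_(n - r))%card /\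
     ((outer_galois_points X #= `I_(n - r))%card <->
      exists G : {mpoly K[n.+2]},
        [/\ G \is d.-homog,
            only_vars_from (n - r) G,
            has_multiple_component G &
            proj_equiv (hpoints X)
              (zero_locus (\sum_(i < n.+2 | (i < n - r)%N) 'X_i ^+ d + G))])).
Proof.
have d_gt2 : (2 < d)%N by exact: ltnW.
have d_gt0 : (0 < d)%N by exact: ltn_trans d_gt2.
have sys m : (`I_m #<= outer_galois_points X)%card ->
    exists (V : 'M[K]_(m, n.+2)) (C : 'M[K]_(n.+2, m)), galois_system X V C.
  case: n n_ge1 X s_dim s_le Delta_fin => // N _ X sd sl fin.
  (* A chain of n sets in Sing X would give n <= s + 1, against s <= n - 2. *)
  by apply: galois_system_exists => //; move=> /sd; lia.
have of_form m G : (0 < m <= n.+2)%N -> G \is d.-homog -> only_vars_from m G ->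
    proj_equiv (hpoints X) (zero_locus (\sum_(i < n.+2 | (i < m)%N) 'X_i ^+ d + G)) ->
    (`I_m #<= outer_galois_points X)%card.
  move=> /andP[m0 mn] hG oG.
  move=> /(equation_of_proj_equiv d_gt0 (form_homog m hG) (form_neq0 d_gt2 m0 hG oG)).
  move=> [M [M' [a [MM' M'M FE]]]].
  have [V [C VCs]] := system_of_form d_gt2 mn hG oG MM' M'M FE.
  exact: (system_card charK d_gt2 VCs).
split=> [s1|r sr].
  have bound : (outer_galois_points X #<= `I_(n + 2))%card.
    apply: card_le_bound => // m /sys [V [C VCs]].
    by rewrite addn2; exact: system_bound VCs.
  (* The Fermat form is the normal form with m = n + 2 and G = 0. *)
  have fermatE : fermat K n d = \sum_(i < n.+2 | (i < n.+2)%N) 'X_i ^+ d + 0.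
    by rewrite addr0; apply: eq_bigl => i; rewrite ltn_ord.
  split=> //; split=> [/card_eqPle [_]|FX].
    rewrite addn2 => /sys [V0 [C0 /(system_normalize d_gt2) [V [C [VCs FV]]]]].
    have [M [M' [MM' M'M FE _]]] := normal_form charK d_gt2 VCs FV.
    (* With n + 2 points V is square, so the projector is 0 and the remainder G is F evaluated at
       the origin. *)
    have e0 : 1%:M - C *m V = 0 by rewrite (mulmx1C (proj1 VCs)) subrr.
    have F0 : lsub (0 : 'M[K]_n.+2) (heq X) = 0.
      apply: ev_inj => w; rewrite ev_lsub mulmx0.
      have := iffLR (dhomog_ev _ _) (heq_homog X) 0 0.
      by rewrite scaler0 expr0n (gtn_eqF d_gt0) mul0r => ->; rewrite [RHS]raddf0.
    rewrite fermatE; move: FE; rewrite e0 F0 [lsub M' 0]raddf0 => <-.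
    exact: (proj_equiv_lsub (heq X) MM' M'M).
  apply/card_eqPle; split=> //; rewrite addn2; apply: (of_form _ 0).
  - by rewrite leqnn.
  - exact: rpred0.
  - by move=> u; rewrite msupp0.
  - by rewrite -fermatE.
(* Dimension r means a chain of r + 1 sets Z 0, ..., Z r. *)
have [Z [Zs Z_strict]] : has_chain (hsing X) r.+1 by apply/s_dim; rewrite sr; lia.
have Z_irr i : (i <= r)%N -> irreducible_closed (Z i) by move=> ir; case: (Zs i ir).
have Z_sing i : (i <= r)%N -> Z i `<=` hsing X by move=> ir; case: (Zs i ir).
have rn : (r + 2 <= n)%N by move: s_le; rewrite sr; lia.
have bound : (outer_galois_points X #<= `I_(n - r))%card.
  apply: card_le_bound => // m /sys [V [C [VC good]]].
  case: m V C VC good => // m V C VC good.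
  have := galois_system_bound charK d_gt2 Delta_fin VC good ord0 Z_irr Z_sing Z_strict.
  by move=> h; lia.
split=> //; split=> [/card_eqPle [_ /sys [V0 [C0 /(system_normalize d_gt2) [V [C [VCs FV]]]]]]|].
  have [M [M' [MM' M'M FE oG]]] := normal_form charK d_gt2 VCs FV.
  have i0 : 'I_(n - r) by apply: (Ordinal (_ : 0 < n - r)%N); lia.
  have rE : (r + (n - r) = n)%N by lia.
  have [H Hc [Q GE]] := multiple_factor charK d_gt2 Delta_fin (proj1 VCs) (proj2 VCs)
    i0 Z_irr Z_sing Z_strict rE.
  exists (lsub M' (lsub (1%:M - C *m V) (heq X))); split=> //.
  - by do 2 apply: dhomog_lsub; exact: heq_homog.
  - exists (lsub M' H); split; last first.
      by exists (lsub M' Q); rewrite GE rmorphM rmorphXn.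
    move=> c; apply: contraNneq (Hc c) => h.
    by rewrite -[H](lsub1) -MM' -lsub_comp h lsubC.
  - by rewrite -FE; exact: (proj_equiv_lsub (heq X) MM' M'M).
move=> [G [hG oG _ FX]]; apply/card_eqPle; split=> //.
by apply: (of_form _ G) => //; lia.
Qed.
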